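(* Every pair $(R,I)\in\mathcal{W}$ (that is, $R$ is a roof state and $I$ is a finite subset of $\mathbb{N}$) has a $\Theta_A$-state expansion. Explicitly: there exist a finite subset $\mathcal{P}'\subset\mathcal{W}$ and rational functions $0\neq Q_{R',I'}(A)\in\mathbb{Q}(A)$ for $(R',I')\in\mathcal{P}'$, such that (i) $R'$ is a middle state for each $(R',I')\in\mathcal{P}'$, (ii) $(R,I)\trianglelefteq(R',I')$ for each $(R',I')\in\mathcal{P}'$, and $$\Theta_A(R,I;\cdot)=\sum_{(R',I')\in\mathcal{P}'}Q_{R',I'}(A)\,\Theta_A(R',I';\cdot).$$
   Context: **Crossingless connections.** For integers $m,a,b\ge 0$ with $a+b$ even, consider a rectangle with points $x_1,\dots,x_a$ on its top side and $x'_1,\dots,x'_b$ on its bottom side (left to right), and $y_1,\dots,y_m$ on its left side and $y'_1,\dots,y'_m$ on its right side (top to bottom). A crossingless connection $C$ is a family of pairwise disjoint arcs embedded in the rectangle joining these points in pairs, considered up to isotopy fixing boundary points (equivalently, a noncrossing perfect matching of the boundary points). Put $\mathrm{ht}(C)=m$, $n_t(C)=a$, $n_b(C)=b$. An arc joining two top (bottom, left, right) points is a top (bottom, left, right) return. A roof state has no bottom returns; a floor state has no top returns; a middle state has neither top nor bottom returns; a top state is a roof state with $\mathrm{ht}=0$; a bottom state is a floor state with $\mathrm{ht}=0$. A Catalan state is a crossingless connection with $n_t(C)=n_b(C)$; $\mathrm{Cat}(m,n)$ is the set of those with $\mathrm{ht}=m$, $n_t=n_b=n$. **Products.** The vertical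 product $T_1*_vT_2$ is obtained by stacking $T_1$ on top of $T_2$ and gluing the $i$-th bottom point of $T_1$ to the $i$-th top point of $T_2$ when $n_b(T_1)=n_t(T_2)$ (side points of $T_1$ are numbered before those of $T_2$); if $n_b(T_1)\ne n_t(T_2)$, then $T_1*_vT_2=K_0$, a formal symbol, and any product involving $K_0$ is $K_0$. **Coefficients.** A Kauffman state $s\in\mathcal{K}(m,n)$ of the lattice crossing $L(m,n)$ is an assignment of $\pm1$ to the $mn$ crossings of the grid of $m$ horizontal and $n$ vertical segments. $D_s$ is obtained by smoothing every crossing: a crossing marked $+1$ is replaced by two disjoint arcs joining its top end to its right end and its left end to its bottom end; one marked $-1$ by arcs joining top to left and right to bottom. $|D_s|$ is the number of closed components of $D_s$, and $C_s\in\mathrm{Cat}(m,n)$ is $D_s$ with closed components removed. With $p(s),n(s)$ the numbers of $+1$'s and $-1$'s, for $C\in\mathrm{Cat}(m,n)$ put $C(A)=\sum_{s\in\mathcal{K}(m,n),\,C_s=C}A^{p(s)-n(s)}(-A^2-A^{-2})^{|D_s|}$. Set $[[C]]_A=C(A)$ if $C$ is a Catalan state, and $[[C]]_A=0$ if $C=K_0$ or $C$ is a crossingless connection that is not a Catalan state. **Index sets.** $\mathbb{N}$ is the set of positive integers, $\mathrm{Fin}(\mathbb{N})$ the set of its finite subsets. For a bottom state $F$ with $n_b(F)=n$, $\varphi_n(F)$ is the set of indices of left ends of bottom returns of $F$; $\varphi_n$ is a bijection from the set of such bottom states onto a set $\mathcal{L}_n\subset\mathrm{Fin}(\mathbb{N})$.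 For a crossingless connection $C$ with $n_b(C)=n$ and $I\in\mathcal{L}_n$, $C_I$ is the unique crossingless connection $C'$ with $C=C'*_v\varphi_n^{-1}(I)$ if it exists, and $C_I=K_0$ otherwise; also $C_I=K_0$ if $C=K_0$ or $I\notin\mathcal{L}_n$. For $I,J\in\mathrm{Fin}(\mathbb{N})$ write $J\preceq I$ if for some $n$ we have $I,J\in\mathcal{L}_n$ and $(\varphi_n^{-1}(I))_J\ne K_0$. $n_I$ is the integer with $I\in\mathcal{L}_n\iff n\ge n_I$. For $J\preceq I$, $I\ominus J=\varphi_{n_I-2|J|}\big((\varphi_{n_I}^{-1}(I))_J\big)$. **The set $\mathcal{W}$, $\trianglelefteq$, $\Theta_A$.** $\mathcal{W}$ is the set of pairs $(R,I)$ with $R$ a roof state and $I\in\mathrm{Fin}(\mathbb{N})$. Write $(R,I)\trianglelefteq(R',I')$ if a) $I\preceq I'$ and $I'\ominus I\in\mathcal{L}_{n_t(R)}$, b) $n_t(R)+2|I|=n_t(R')+2|I'|$, and c) $n_b(R)=n_b(R')$. For $(R,I)\in\mathcal{W}$, $\Theta_A(R,I;\cdot)$ is the function $F\mapsto\Theta_A(R,I;F)=[[R*_vF_I]]_A$ of $F$, where $F$ is any floor state or $F=K_0$. *)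

(* Defs.v *)
From HB Require Import structures.
From mathcomp Require Import all_boot all_order all_algebra finmap.

Set Implicit Arguments.
Unset Strict Implicit.
Unset Printing Implicit Defensive.

Import Order.TTheory GRing.Theory Num.Theory.

(* Boundary points are indexed from 0 inside ordinals; only the index sets
   I, J below use the 1-based numbering of the points x'_1, x'_2, ... *)

Definition bpt (m a b : nat) : Type := (('I_a + 'I_b) + ('I_m + 'I_m))%type.

Definition top_pt m a b (i : 'I_a) : bpt m a b := inl (inl i).
Definition bot_pt m a b (i : 'I_b) : bpt m a b := inl (inr i).
Definition left_pt m a b (i : 'I_m) : bpt m a b := inr (inl i).
Definition right_pt m a b (i : 'I_m) : bpt m a b := inr (inr i).

Definition is_top m a b (p : bpt m a b) : bool :=
  if p is inl (inl _) then true else false.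
Definition is_bot m a b (p : bpt m a b) : bool :=
  if p is inl (inr _) then true else false.

(* Rank of a boundary point when the boundary of the rectangle is traversed
   clockwise from its top left corner: top side rightwards, right side
   downwards, bottom side leftwards, left side upwards. *)
Definition cpos m a b (p : bpt m a b) : nat :=
  match p with
  | inl (inl i) => i
  | inr (inr i) => a + i
  | inl (inr i) => a + m + rev_ord i
  | inr (inl i) => a + m + b + rev_ord i
  end.

Definition noncrossing_matching m a b (f : {ffun bpt m a b -> bpt m a b}) :=
  [&& [forall p, f (f p) == p],
      [forall p, f p != p]
    & [forall p, forall q,
        ~~ [&& cpos p < cpos q, cpos q < cpos (f p) & cpos (f p) < cpos (f q)]]].

Record crossingless (m a b : nat) := Crossingless {
  mate :> {ffun bpt m a b -> bpt m a b};
  _ : noncrossing_matching mate }.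

HB.instance Definition _ m a b := [isSub for @mate m a b].
HB.instance Definition _ m a b := [Finite of crossingless m a b by <:].

Record conn := Conn {
  ht : nat;
  nt : nat;
  nb : nat;
  arcs :> crossingless ht nt nb }.

Definition conn_tag (C : conn) :
    {d : nat * nat * nat & crossingless d.1.1 d.1.2 d.2} :=
  existT (fun d : nat * nat * nat => crossingless d.1.1 d.1.2 d.2)
         (ht C, nt C, nb C) (arcs C).
Definition conn_untag
    (x : {d : nat * nat * nat & crossingless d.1.1 d.1.2 d.2}) : conn :=
  Conn (tagged x).
Lemma conn_tagK : cancel conn_tag conn_untag.
Proof. by case. Qed.
HB.instance Definition _ := Countable.copy conn (can_type conn_tagK).

(* The formal symbol K_0 is [None]. *)
Notation conn0 := (option conn).
Notation K0 := (@None conn).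

Definition no_top_return (C : conn) : bool :=
  [forall i : 'I_(nt C), ~~ is_top (arcs C (top_pt _ _ i))].
Definition no_bot_return (C : conn) : bool :=
  [forall i : 'I_(nb C), ~~ is_bot (arcs C (bot_pt _ _ i))].

Definition roof_state (C : conn) : bool := no_bot_return C.
Definition floor_state (C : conn) : bool := no_top_return C.
Definition middle_state (C : conn) : bool :=
  no_top_return C && no_bot_return C.
Definition bottom_state (C : conn) : bool := floor_state C && (ht C == 0).

(* Graph on the disjoint union of the boundary points of C1 and of C2 whose
   edges are the arcs of C1, the arcs of C2, and the identification of the
   i-th bottom point of C1 with the i-th top point of C2. *)
Definition stack_rel (C1 C2 : conn) :
    rel (bpt (ht C1) (nt C1) (nb C1) + bpt (ht C2) (nt C2) (nb C2)) :=
  fun u v =>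
    match u, v with
    | inl p, inl q => arcs C1 p == q
    | inr p, inr q => arcs C2 p == q
    | inl (inl (inr i)), inr (inl (inl j)) => i == j :> nat
    | inr (inl (inl j)), inl (inl (inr i)) => i == j :> nat
    | _, _ => false
    end.

Definition stack_outer (C1 C2 : conn)
    (p : bpt (ht C1 + ht C2) (nt C1) (nb C2)) :
    bpt (ht C1) (nt C1) (nb C1) + bpt (ht C2) (nt C2) (nb C2) :=
  match p with
  | inl (inl i) => inl (top_pt _ _ i)
  | inl (inr i) => inr (bot_pt _ _ i)
  | inr (inl i) => match split i with
                   | inl k => inl (left_pt _ _ k)
                   | inr k => inr (left_pt _ _ k)
                   end
  | inr (inr i) => match split i with
                   | inl k => inl (right_pt _ _ k)
                   | inr k => inr (right_pt _ _ k)
                   end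
  end.

Definition is_stack (C1 C2 : conn)
    (T : crossingless (ht C1 + ht C2) (nt C1) (nb C2)) : bool :=
  [forall p, forall q, (T p == q) ==
     (p != q) && connect (@stack_rel C1 C2) (stack_outer p) (stack_outer q)].

(* When nb C1 = nt C2, following the glued arcs between outer points always
   yields exactly one crossingless connection, so the [pick] does not fail.
   Closed curves, which can only arise from a bottom return of C1 meeting a
   top return of C2, are discarded. *)
Definition vprod1 (C1 C2 : conn) : conn0 :=
  if nb C1 == nt C2 then omap (@Conn _ _ _) [pick T | @is_stack C1 C2 T]
  else K0.

Definition vprod (C1 C2 : conn0) : conn0 :=
  match C1, C2 with
  | Some D1, Some D2 => vprod1 D1 D2
  | _, _ => K0
  end.

Definition QA : fieldType := {fraction {poly rat}}.
Definition varA : QA := tofrac ('X : {poly rat})%R.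

(* [true] marks +1 and [false] marks -1; row 0 is the uppermost one. *)
Definition kstate (m n : nat) : finType := {ffun 'I_m * 'I_n -> bool}.

(* Pieces into which the crossings cut L(m,n): [inl (i, k)] is the k-th piece,
   from the left, of the i-th horizontal segment and [inr (k, j)] the k-th
   piece, from the top, of the j-th vertical segment. *)
Definition piece (m n : nat) : Type := ('I_m * 'I_n.+1 + 'I_m.+1 * 'I_n)%type.

Section Kauffman.
Variables m n : nat.

Definition top_end (c : 'I_m * 'I_n) : piece m n :=
  inr (widen_ord (leqnSn m) c.1, c.2).
Definition bot_end (c : 'I_m * 'I_n) : piece m n := inr (lift ord0 c.1, c.2).
Definition left_end (c : 'I_m * 'I_n) : piece m n :=
  inl (c.1, widen_ord (leqnSn n) c.2).
Definition right_end (c : 'I_m * 'I_n) : piece m n := inl (c.1, lift ord0 c.2).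

Definition joins (x y u v : piece m n) : bool :=
  ((u == x) && (v == y)) || ((u == y) && (v == x)).

(* The diagram D_s, as the graph on pieces given by the smoothing arcs. *)
Definition smoothing (s : kstate m n) : rel (piece m n) := fun u v =>
  [exists c : 'I_m * 'I_n,
    if s c then joins (top_end c) (right_end c) u v
                || joins (left_end c) (bot_end c) u v
    else joins (top_end c) (left_end c) u v
         || joins (right_end c) (bot_end c) u v].

Definition boundary_piece (p : bpt m n n) : piece m n :=
  match p with
  | inl (inl j) => inr (ord0, j)
  | inl (inr j) => inr (ord_max, j)
  | inr (inl i) => inl (i, ord0)
  | inr (inr i) => inl (i, ord_max)
  end.

(* |D_s|: the components of D_s that do not reach the boundary. *)
Definition n_closed (s : kstate m n) : nat :=
  n_comp (smoothing s)
    [pred u | ~~ [exists p, connect (smoothing s) (boundary_piece p) u]].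

Definition realizes (s : kstate m n) (T : crossingless m n n) : bool :=
  [forall p, forall q, (T p == q) ==
     (p != q) && connect (smoothing s) (boundary_piece p) (boundary_piece q)].

(* C_s; here again exactly one T satisfies [realizes s T]. *)
Definition catalan_of (s : kstate m n) : conn0 :=
  omap (@Conn m n n) [pick T | realizes s T].

Definition n_plus (s : kstate m n) : nat := #|[set c | s c]|.
Definition n_minus (s : kstate m n) : nat := #|[set c | ~~ s c]|.

Definition state_weight (s : kstate m n) : QA :=
  (varA ^ ((n_plus s)%:Z - (n_minus s)%:Z)
     * (- varA ^+ 2 - varA ^- 2) ^+ n_closed s)%R.

End Kauffman.

Definition is_catalan (C : conn) : bool := nt C == nb C.

Definition coeff (C : conn) : QA :=
  (\sum_(s : kstate (ht C) (nt C) | catalan_of s == Some C) state_weight s)%R.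

Definition bracket (C : conn0) : QA :=
  if C is Some D then (if is_catalan D then coeff D else 0%R) else 0%R.

(* Fin(N), with N the positive integers, is the set of those {fset nat}
   that do not contain 0. *)
Definition in_FinN (I : {fset nat}) : bool := 0 \notin I.

Definition left_of_return (C : conn) (i : 'I_(nb C)) : bool :=
  [exists j : 'I_(nb C), (i < j) && (arcs C (bot_pt _ _ i) == bot_pt _ _ j)].

(* phi_n, n = nb F, with 1-based indices. *)
Definition phi (F : conn) : {fset nat} :=
  [fset k in [seq (val i).+1 | i <- enum 'I_(nb F) & left_of_return i]]%fset.

(* phi_n^{-1}(I), or None when I is not in L_n.  A bottom state with n bottom
   points and #|I| bottom returns has n - 2 #|I| top points. *)
Definition phi_inv (n : nat) (I : {fset nat}) : conn0 :=
  omap (@Conn _ _ _)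
    [pick T : crossingless 0 (n - 2 * #|` I|) n |
       bottom_state (Conn T) && (phi (Conn T) == I)].

Definition in_L (n : nat) (I : {fset nat}) : bool := phi_inv n I != K0.

(* C_I.  As the bottom state B has height 0, an equation C = C' *_v B with C
   different from K_0 forces ht C' = ht C, nt C' = nt C and nb C' = nt B; so
   C' is searched among such connections, where there is at most one. *)
Definition strip1 (C : conn) (I : {fset nat}) : conn0 :=
  if phi_inv (nb C) I is Some B then
    omap (@Conn _ _ _)
      [pick T : crossingless (ht C) (nt C) (nt B) | vprod1 (Conn T) B == Some C]
  else K0.

Definition strip (C : conn0) (I : {fset nat}) : conn0 :=
  if C is Some D then strip1 D I else K0.

(* J \preceq I *)
Definition preceq (J I : {fset nat}) : Prop :=
  exists n, [/\ in_L n I, in_L n J & strip (phi_inv n I) J <> K0].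

(* k is the integer n_I *)
Definition is_n_of (I : {fset nat}) (k : nat) : Prop :=
  forall n, in_L n I <-> k <= n.

(* K is I \ominus J *)
Definition is_ominus (I J K : {fset nat}) : Prop :=
  exists k, is_n_of I k /\
    exists C, strip (phi_inv k I) J = Some C /\ K = phi C.

Definition in_W (w : conn * {fset nat}) : bool :=
  roof_state w.1 && in_FinN w.2.

Definition trileq (w w' : conn * {fset nat}) : Prop :=
  [/\ preceq w.2 w'.2 /\
      (exists K, is_ominus w'.2 w.2 K /\ in_L (nt w.1) K),
      nt w.1 + 2 * #|` w.2| = nt w'.1 + 2 * #|` w'.2|
    & nb w.1 = nb w'.1].

Definition floor_or_K0 (F : conn0) : bool :=
  if F is Some D then floor_state D else true.

Definition Theta (w : conn * {fset nat}) (F : conn0) : QA :=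
  bracket (vprod (Some w.1) (strip F w.2)).

(* Main.v *)
Require Import Defs.
From HB Require Import structures.
From mathcomp Require Import all_boot all_order all_algebra finmap.
From mathcomp Require Import zify ring.
From Stdlib Require Import Relations.

(* Fix n = n_t(R) and regard y_m ... y_1 x_1 ... x_n y'_1 ... y'_m as one word
   with a window of length n on it.  Expanding the first row of the lattice over
   its sign words, a sign change "- +" creates a return facing down.  It slides
   through all further rows, because in each of them the three smoothings
   ++, --, +- cancel (A^2 + A^-2 + delta = 0), and it comes out as a bottom
   return: such a term is a function Theta_A(R', I'; .) with n_t(R') < n, dealt
   with by induction.  The words + ... + - ... - pluck one arc of R in the window
   and contribute A^(2p - n), p being the number of signs +.

   Let rotate^n R be R with the window moved n steps to the left through n new
   arcs x_i -- y_i; it is a middle state.  Expanding its first n rows expresses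
   Theta_A(rotate^n R, I; .), up to lower terms, through the functions
   Theta_A(R'', I; .) for R'' of the height of R, with coefficients which after
   multiplication by A^(n^2) lie in Q[A] and at A = 0 form the identity matrix.
   So this system can be solved over Q(A). *)

Set Implicit Arguments.
Unset Strict Implicit.
Unset Printing Implicit Defensive.

Import Order.TTheory GRing.Theory Num.Theory.

(** * Untyped boundary labels *)

(** The system is square: its unknowns are the functions [Theta (x, I)] for the finitely many roof
    states x of the height of R with the same n_t and n_b. Each of the n rows contributes a factor
    A^(2p - n), whence A^(n^2). At A = 0 only the word - ... - survives in each row; it plucks just
    the new arc between y_1 and x_1, so it undoes one rotation, and as rotation is injective the
    matrix at 0 is the identity. The expanded row lies in R, so neither the coefficients nor the
    plucked states depend on F. The returns that come out at the bottom form a bottom state K; if I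
    = [phi B], the new index set is that of [K *_v B]. Condition (ii) is therefore carried along as
    a factorization of bottom states, and chaining it is associativity of the product. Heights and
    side lengths are sums and counts, which makes points indexed by ordinals awkward to compare; so
    points and pieces are labelled by plain numbers, and the sizes enter as side conditions. *)

Inductive lab := LT of nat | LB of nat | LL of nat | LR of nat.

Definition lab_code (l : lab) : nat * nat :=
  match l with LT i => (0, i) | LB i => (1, i) | LL i => (2, i) | LR i => (3, i) end.
Definition lab_decode (c : nat * nat) : lab :=
  match c with
  | (0, i) => LT i | (1, i) => LB i | (2, i) => LL i | (_, i) => LR i
  end.
Lemma lab_codeK : cancel lab_code lab_decode. Proof. by case. Qed.
HB.instance Definition _ := Countable.copy lab (can_type lab_codeK).

Lemma lab_eqE (l l' : lab) : (l == l') =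
  match l, l' with
  | LT i, LT j | LB i, LB j | LL i, LL j | LR i, LR j => i == j
  | _, _ => false
  end.
Proof.
by case: l l' => i [] j //=; apply/eqP/eqP => [[->]|->].
Qed.

Definition top_lab l := if l is LT _ then true else false.
Definition bot_lab l := if l is LB _ then true else false.

Definition dom m a b (l : lab) : bool :=
  match l with LT i => i < a | LB i => i < b | LL i | LR i => i < m end.

Definition lpos m a b (l : lab) : nat :=
  match l with
  | LT i => i
  | LR i => a + i
  | LB i => a + m + (b - i.+1)
  | LL i => a + m + b + (m - i.+1)
  end.

Definition lab_of m a b (p : bpt m a b) : lab :=
  match p with
  | inl (inl i) => LT i
  | inl (inr i) => LB i
  | inr (inl i) => LL i
  | inr (inr i) => LR i
  end.

Lemma lab_of_dom m a b (p : bpt m a b) : dom m a b (lab_of p).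
Proof. by case: p => [] [] i /=. Qed.

Lemma lab_of_inj m a b : injective (@lab_of m a b).
Proof.
by move=> [[i|i]|[i|i]] [[j|j]|[j|j]] //= [] /val_inj ->.
Qed.

Lemma dom_lab_of m a b l : dom m a b l -> exists p : bpt m a b, lab_of p = l.
Proof.
case: l => i /= h.
- by exists (inl (inl (Ordinal h))).
- by exists (inl (inr (Ordinal h))).
- by exists (inr (inl (Ordinal h))).
- by exists (inr (inr (Ordinal h))).
Qed.

Lemma cpos_lab m a b (p : bpt m a b) : cpos p = lpos m a b (lab_of p).
Proof. by case: p => [] [] i. Qed.

Lemma lpos_inj m a b l l' : dom m a b l -> dom m a b l' ->
  lpos m a b l = lpos m a b l' -> l = l'.
Proof.
case: l l' => i [] j /= *;
  first [congr LT; lia | congr LB; lia | congr LL; lia | congr LR; lia | exfalso; lia].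
Qed.

Lemma lpos_lt m a b l : dom m a b l -> lpos m a b l < a + b + m + m.
Proof. case: l => i /=; lia. Qed.

Local Notation cdom C := (dom (ht C) (nt C) (nb C)).
Local Notation cps C := (lpos (ht C) (nt C) (nb C)).

(** The matching as a total function on labels: labels outside the boundary are fixed, so that it is
    involutive and injective without side conditions. *)
Definition cm (C : conn) (l : lab) : lab :=
  if [pick p : bpt (ht C) (nt C) (nb C) | lab_of p == l] is Some p
  then lab_of (arcs C p) else l.

Lemma cmE (C : conn) p : cm C (lab_of p) = lab_of (arcs C p).
Proof.
rewrite /cm; case: pickP => [q /eqP /lab_of_inj -> //|/(_ p)].
by rewrite eqxx.
Qed.

Lemma cm_out C l : ~~ cdom C l -> cm C l = l.
Proof.
rewrite /cm; case: pickP => // p /eqP <-; by rewrite lab_of_dom.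
Qed.

Lemma cm_dom C l : cdom C (cm C l) = cdom C l.
Proof.
case: (boolP (cdom C l)) => [/dom_lab_of [p <-]|h]; last first.
  by rewrite cm_out //; apply: negbTE.
by rewrite cmE lab_of_dom.
Qed.

Lemma mate_props m a b (f : crossingless m a b) : noncrossing_matching f.
Proof. by case: f. Qed.

Lemma cmK C : involutive (cm C).
Proof.
move=> l; case: (boolP (cdom C l)) => [/dom_lab_of [p <-]|h]; last first.
  by rewrite !cm_out // cm_out.
rewrite !cmE; congr lab_of; apply/eqP.
by case/and3P: (mate_props (arcs C)) => /forallP/(_ p).
Qed.

Lemma cm_neq C l : cdom C l -> cm C l != l.
Proof.
case/dom_lab_of => p <-; rewrite cmE; apply/negP => /eqP /lab_of_inj /eqP.
by case/and3P: (mate_props (arcs C)) => _ /forallP/(_ p)/negbTE ->.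
Qed.

Lemma cm_eq_sym C l l' : cm C l = l' <-> cm C l' = l.
Proof. by split=> <-; rewrite cmK. Qed.

Lemma cm_inj C : injective (cm C).
Proof. exact: inv_inj (@cmK C). Qed.

Lemma cm_noncross C l l' : cdom C l -> cdom C l' ->
  cps C l < cps C l' -> cps C l' < cps C (cm C l) ->
  cps C (cm C l) < cps C (cm C l') -> False.
Proof.
case/dom_lab_of => p <- /dom_lab_of [q <-]; rewrite !cmE -!cpos_lab => h1 h2 h3.
case/and3P: (mate_props (arcs C)) => _ _ /forallP/(_ p)/forallP/(_ q).
by rewrite h1 h2 h3.
Qed.

(** The way back from labels to ordinals. Outside the boundary [f] may be anything. *)
Lemma build m a b (f : lab -> lab) :
  (forall l, dom m a b l -> dom m a b (f l)) ->
  (forall l, dom m a b l -> f (f l) = l) ->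
  (forall l, dom m a b l -> f l <> l) ->
  (forall l l', dom m a b l -> dom m a b l' ->
     lpos m a b l < lpos m a b l' -> lpos m a b l' < lpos m a b (f l) ->
     lpos m a b (f l) < lpos m a b (f l') -> False) ->
  exists C : conn, [/\ ht C = m, nt C = a, nb C = b &
    forall l, dom m a b l -> cm C l = f l].
Proof.
move=> fd fK fN fnc.
pose g (p : bpt m a b) : bpt m a b :=
  odflt p [pick q | lab_of q == f (lab_of p)].
have gE p : lab_of (g p) = f (lab_of p).
  rewrite /g; case: pickP => [q /eqP //|].
  case: (dom_lab_of (fd _ (lab_of_dom p))) => q hq /(_ q); by rewrite hq eqxx.
have gP : noncrossing_matching [ffun p => g p].
  apply/and3P; split.
  - apply/forallP => p; rewrite !ffunE; apply/eqP/lab_of_inj.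
    by rewrite !gE fK // lab_of_dom.
  - apply/forallP => p; rewrite !ffunE; apply/eqP => e.
    by apply: (fN _ (lab_of_dom p)); rewrite -gE e.
  - apply/forallP => p; apply/forallP => q; apply/negP.
    rewrite !ffunE !cpos_lab !gE => /and3P [h1 h2 h3].
    by apply: fnc h1 h2 h3; apply: lab_of_dom.
exists (Conn (Crossingless gP)); split=> // l /dom_lab_of [p <-].
by rewrite (@cmE (Conn (Crossingless gP))) /= ffunE gE.
Qed.

Lemma conn_ext C D : ht C = ht D -> nt C = nt D -> nb C = nb D ->
  (forall l, cdom C l -> cm C l = cm D l) -> C = D.
Proof.
case: C D => m a b f [m' a' b' g] /= e1 e2 e3; subst m' a' b' => H.
congr Conn; apply/val_inj/ffunP => p; apply: lab_of_inj.
by have := H _ (lab_of_dom p); rewrite (@cmE (Conn f)) (@cmE (Conn g)).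
Qed.

(** A set of points closed under the matching inherits a noncrossing matching. The rank [ps] is a
    parameter because plucking reads the boundary from y_1 and not from x_1. *)
Lemma restrict C m a b (io : lab -> lab) (ps : lab -> nat) :
  (forall l l', cdom C l -> cdom C l' -> ps l < ps l' -> ps l' < ps (cm C l) ->
     ps (cm C l) < ps (cm C l') -> False) ->
  (forall l, dom m a b l -> cdom C (io l)) ->
  (forall l l', dom m a b l -> dom m a b l' ->
     lpos m a b l < lpos m a b l' -> ps (io l) < ps (io l')) ->
  (forall l, dom m a b l -> exists2 l', dom m a b l' & cm C (io l) = io l') ->
  exists D : conn, [/\ ht D = m, nt D = a, nb D = b &
    forall l, dom m a b l -> cm C (io l) = io (cm D l)].
Proof.
move=> nC ioD ioM ioC.
have ioI l l' : dom m a b l -> dom m a b l' -> io l = io l' -> l = l'.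
  move=> d d' e; apply: (lpos_inj d d').
  by case: (ltngtP (lpos m a b l) (lpos m a b l')) => // h;
    [have := ioM _ _ d d' h | have := ioM _ _ d' d h]; rewrite e ltnn.
pose f l := if [pick q : bpt m a b | cm C (io l) == io (lab_of q)] is Some q
            then lab_of q else l.
have fE l : dom m a b l -> dom m a b (f l) /\ cm C (io l) = io (f l).
  move=> d; rewrite /f; case: pickP => [q /eqP ->|]; first by rewrite lab_of_dom.
  case: (ioC _ d) => l' /dom_lab_of [q <-] e /(_ q); by rewrite e eqxx.
have [||||D [h1 h2 h3 h4]] := @build m a b f.
- by move=> l /fE [].
- move=> l d; have [d1 e1] := fE _ d; have [d2 e2] := fE _ d1.
  by apply: (ioI _ _ d2 d); rewrite -e2 -e1 cmK.
- move=> l d e; have [_ e1] := fE _ d; have := cm_neq (ioD _ d).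
  by rewrite e1 e eqxx.
- move=> l l' d d' k1 k2 k3; have [df e] := fE _ d; have [df' e'] := fE _ d'.
  have := nC _ _ (ioD _ d) (ioD _ d'); rewrite e e'.
  by apply; apply: ioM.
exists D; split=> // l d; rewrite h4 //; by case: (fE _ d).
Qed.

Lemma domE C m a b l : ht C = m -> nt C = a -> nb C = b -> cdom C l = dom m a b l.
Proof. by move=> -> -> ->. Qed.

(** * Stacking on top of a floor state *)

Lemma no_top_returnP C : reflect (forall i, i < nt C -> ~~ top_lab (cm C (LT i)))
  (no_top_return C).
Proof.
have E (i : 'I_(nt C)) : is_top (arcs C (top_pt _ _ i)) = top_lab (cm C (LT i)).
  rewrite -[LT i]/(lab_of (top_pt (ht C) (nb C) i)) cmE.
  by case: (arcs C _) => [] [].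
apply: (iffP forallP) => [H i hi|H i]; last by rewrite E H.
by have := H (Ordinal hi); rewrite E.
Qed.

Lemma no_bot_returnP C : reflect (forall i, i < nb C -> ~~ bot_lab (cm C (LB i)))
  (no_bot_return C).
Proof.
have E (i : 'I_(nb C)) : is_bot (arcs C (bot_pt _ _ i)) = bot_lab (cm C (LB i)).
  rewrite -[LB i]/(lab_of (bot_pt (ht C) (nt C) i)) cmE.
  by case: (arcs C _) => [] [].
apply: (iffP forallP) => [H i hi|H i]; last by rewrite E H.
by have := H (Ordinal hi); rewrite E.
Qed.

Definition tau h (l : lab) : lab :=
  match l with LL i => LL (h + i) | LR i => LR (h + i) | _ => l end.

(* The end in C1 *_v C2 of the strand of C1 that ends at l. *)
Definition sg (C1 C2 : conn) (l : lab) : lab :=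
  if l is LB i then tau (ht C1) (cm C2 (LT i)) else l.

(** The product without connectivity. When C2 has no top return, a strand of C1 that reaches a glued
    point continues along a single arc of C2 to the outside. The two clauses on [cm T] treat the
    arcs of C1, prolonged by [sg], and the arcs of C2 that avoid the glued points. *)
Record stack_spec (C1 C2 T : conn) : Prop := StackSpec {
  stack_ht : ht T = ht C1 + ht C2;
  stack_nt : nt T = nt C1;
  stack_nb : nb T = nb C2;
  stack_sg : forall l, cdom C1 l -> cm T (sg C1 C2 l) = sg C1 C2 (cm C1 l);
  stack_tau : forall l, cdom C2 l -> ~~ top_lab l -> ~~ top_lab (cm C2 l) ->
     cm T (tau (ht C1) l) = tau (ht C1) (cm C2 l) }.

Lemma tau_inj h : injective (tau h).
Proof. by case=> i [] j //= [] e; first [by rewrite e | by move/addnI: e => ->]. Qed.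

Lemma tauA h k l : tau h (tau k l) = tau (h + k) l.
Proof. by case: l => i //=; rewrite addnA. Qed.

Lemma tau0 l : tau 0 l = l.
Proof. by case: l. Qed.

Lemma top_tau h l : top_lab (tau h l) = top_lab l.
Proof. by case: l. Qed.

(** Noncrossing forces the arcs that leave the top side to be nested. *)
Lemma top_antimono C2 i j : no_top_return C2 -> i < j -> j < nt C2 ->
  cps C2 (cm C2 (LT j)) < cps C2 (cm C2 (LT i)).
Proof.
move=> fC2 ij hj; have hi : i < nt C2 by lia.
have di : cdom C2 (LT i) by []. have dj : cdom C2 (LT j) by [].
case: (ltngtP (cps C2 (cm C2 (LT j))) (cps C2 (cm C2 (LT i)))) => // h.
  exfalso; apply: (cm_noncross di dj) => //=.
  have := no_top_returnP _ fC2 i hi; case: (cm C2 (LT i)) => //= *; lia.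
by have := lpos_inj _ _ h; rewrite !cm_dom di dj => /(_ isT isT) /cm_inj []; lia.
Qed.

Section StackExists.
Variables C1 C2 : conn.
Hypothesis fC2 : no_top_return C2.
Hypothesis e12 : nb C1 = nt C2.

Let topC2 i : i < nt C2 -> ~~ top_lab (cm C2 (LT i)).
Proof. exact/no_top_returnP. Qed.

Let dT := dom (ht C1 + ht C2) (nt C1) (nb C2).
Let pT := lpos (ht C1 + ht C2) (nt C1) (nb C2).

Lemma tau_dom l : cdom C2 l -> ~~ top_lab l -> dT (tau (ht C1) l).
Proof. by case: l => i //= *; rewrite /dT /=; lia. Qed.

Lemma sg_dom l : cdom C1 l -> dT (sg C1 C2 l).
Proof.
case: l => i /= hi; rewrite /dT /=; try lia.
by apply: tau_dom; rewrite ?cm_dom /= -?e12 // topC2 // -e12.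
Qed.

Lemma pT_tau l : cdom C2 l -> ~~ top_lab l ->
  pT (tau (ht C1) l) + nt C2 = cps C2 l + (nt C1 + ht C1) /\ nt C2 <= cps C2 l.
Proof. by case: l => i //= *; rewrite /pT /=; lia. Qed.

(** The bottom of C1 is read from right to left, and by [top_antimono] the prolonged strands come
    out in that same order; the other points are only shifted. *)
Lemma sg_mono u v : cdom C1 u -> cdom C1 v -> cps C1 u < cps C1 v ->
  pT (sg C1 C2 u) < pT (sg C1 C2 v).
Proof.
have zone i : i < nb C1 -> nt C1 + ht C1 <= pT (tau (ht C1) (cm C2 (LT i))) /\
    pT (tau (ht C1) (cm C2 (LT i))) < nt C1 + ht C1 + (ht C2 + nb C2 + ht C2).
  move=> hi; rewrite e12 in hi; have d : cdom C2 (cm C2 (LT i)) by rewrite cm_dom.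
  have [] := pT_tau d (topC2 hi); have := lpos_lt d; lia.
case: u => i; case: v => j //=;
  try (by move=> *; rewrite /pT /=; lia);
  try (by move=> hi hj *; first [have [] := zone i hi | have [] := zone j hj];
     rewrite /pT /=; lia).
move=> hi hj h; rewrite e12 in hi hj.
have di : cdom C2 (cm C2 (LT i)) by rewrite cm_dom.
have dj : cdom C2 (cm C2 (LT j)) by rewrite cm_dom.
have [] := pT_tau di (topC2 hi); have [] := pT_tau dj (topC2 hj).
by have := @top_antimono C2 j i fC2; lia.
Qed.

Definition stack_fun (l : lab) : lab :=
  let l2 := match l with LL i => LL (i - ht C1) | LR i => LR (i - ht C1) | _ => l end in
  let lower := match l with LT _ => false | LB _ => true
                          | LL i | LR i => ht C1 <= i end in
  if lower then
    if cm C2 l2 is LT i then sg C1 C2 (cm C1 (LB i)) else tau (ht C1) (cm C2 l2)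
  else sg C1 C2 (cm C1 l).

Lemma stack_fun_sg l : cdom C1 l -> stack_fun (sg C1 C2 l) = sg C1 C2 (cm C1 l).
Proof.
case: l => i //= hi; rewrite /stack_fun /=; try by rewrite leqNgt hi.
rewrite e12 in hi; have := topC2 hi; have := cmK C2 (LT i).
by case: (cm C2 (LT i)) => //= j; rewrite ?leq_addr ?addKn => ->.
Qed.

Lemma stack_fun_tau l : cdom C2 l -> ~~ top_lab l -> ~~ top_lab (cm C2 l) ->
  stack_fun (tau (ht C1) l) = tau (ht C1) (cm C2 l).
Proof.
by case: l => i //= hi _; rewrite /stack_fun /= ?leq_addr ?addKn; case: (cm C2 _).
Qed.

Lemma stack_cover l : dT l -> (exists2 u, cdom C1 u & l = sg C1 C2 u) \/
  (exists v, [/\ cdom C2 v, ~~ top_lab v, ~~ top_lab (cm C2 v) & l = tau (ht C1) v]).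
Proof.
have low v : cdom C2 v -> ~~ top_lab v ->
    (exists2 u, cdom C1 u & tau (ht C1) v = sg C1 C2 u) \/
    (exists w, [/\ cdom C2 w, ~~ top_lab w, ~~ top_lab (cm C2 w)
                 & tau (ht C1) v = tau (ht C1) w]).
  move=> dv tv; case: (boolP (top_lab (cm C2 v))) => h; last by right; exists v.
  left; move: (dv); rewrite -cm_dom; have := cmK C2 v.
  case: (cm C2 v) h => //= i _ e di; exists (LB i) => /=; first by rewrite e12.
  by rewrite e.
case: l => i; rewrite /dT /= => hi.
- by left; exists (LT i).
- exact: (low (LB i)).
- case: (ltnP i (ht C1)) => h; first by left; exists (LL i).
  have := low (LL (i - ht C1)); rewrite /= subnKC //; apply => //; lia.
- case: (ltnP i (ht C1)) => h; first by left; exists (LR i).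
  have := low (LR (i - ht C1)); rewrite /= subnKC //; apply => //; lia.
Qed.

(** The arc from the top point i starts before every point off the top, so it would cross the arc
    from v. *)
Lemma no_arc_over_glued i v : i < nt C2 -> cdom C2 v -> ~~ top_lab v ->
  cps C2 v < cps C2 (cm C2 (LT i)) -> cps C2 (cm C2 (LT i)) < cps C2 (cm C2 v) -> False.
Proof.
move=> hi dv tv h1 h2; have di : cdom C2 (LT i) by [].
apply: (cm_noncross di dv) => //=.
by have [] := pT_tau dv tv; lia.
Qed.

(** For noncrossing, two prolonged strands of C1 are compared by [sg_mono] and two arcs of C2 by
    translation of ranks. In a mixed pair, no prolonged strand ends between the two ends of an arc
    of C2 that avoids the glued points ([zone]). *)
Lemma stack_exists : exists T, stack_spec C1 C2 T.
Proof.
have [||||T [h1 h2 h3 h4]] := @build (ht C1 + ht C2) (nt C1) (nb C2) stack_fun.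
- move=> l /stack_cover [[u du ->]|[v [dv tv tcv ->]]].
    by rewrite stack_fun_sg //; apply: sg_dom; rewrite cm_dom.
  by rewrite stack_fun_tau //; apply: tau_dom; rewrite ?cm_dom.
- move=> l /stack_cover [[u du ->]|[v [dv tv tcv ->]]].
    by rewrite !stack_fun_sg ?cm_dom // cmK.
  by rewrite !stack_fun_tau ?cm_dom ?cmK.
- move=> l /stack_cover [[u du ->]|[v [dv tv tcv ->]]].
    rewrite stack_fun_sg // => e; have := cm_neq du.
    have dcu : cdom C1 (cm C1 u) by rewrite cm_dom.
    case: (ltngtP (cps C1 u) (cps C1 (cm C1 u))) => [h|h|/(lpos_inj du dcu) <-];
      last by rewrite eqxx.
      by have := sg_mono du dcu h; rewrite e ltnn.
    by have := sg_mono dcu du h; rewrite e ltnn.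
  by rewrite stack_fun_tau // => /tau_inj e; have := cm_neq dv; rewrite e eqxx.
- have mono u v : cdom C1 u -> cdom C1 v -> pT (sg C1 C2 u) < pT (sg C1 C2 v) ->
      cps C1 u < cps C1 v.
    move=> du dv h; case: (ltngtP (cps C1 u) (cps C1 v)) => // [k|/(lpos_inj du dv) e].
      by have := sg_mono dv du k; lia.
    by move: h; rewrite e ltnn.
  have zone v w : cdom C2 v -> ~~ top_lab v -> cdom C1 w ->
      cdom C2 (cm C2 v) -> ~~ top_lab (cm C2 v) ->
      pT (tau (ht C1) v) < pT (sg C1 C2 w) ->
      pT (sg C1 C2 w) < pT (tau (ht C1) (cm C2 v)) -> False.
    move=> dv tv dw dcv tcv; have [] := pT_tau dv tv; have [] := pT_tau dcv tcv.
    have := lpos_lt dcv.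
    case: w dw => i //= hi; rewrite /pT /=; try lia.
    rewrite -/pT; rewrite e12 in hi.
    have di : cdom C2 (cm C2 (LT i)) by rewrite cm_dom.
    have [] := pT_tau di (topC2 hi); have := @no_arc_over_glued i v hi dv tv.
    by rewrite /pT /=; lia.
  move=> l l' /stack_cover [[u du ->]|[v [dv tv tcv ->]]]
             /stack_cover [[u' du' ->]|[v' [dv' tv' tcv' ->]]].
  + rewrite !stack_fun_sg // => k1 k2 k3; apply: (cm_noncross du du'); apply: mono;
      by rewrite ?cm_dom.
  + rewrite stack_fun_sg // stack_fun_tau // => k1 k2 k3.
    by apply: (@zone v' (cm C1 u)); rewrite ?cm_dom.
  + rewrite stack_fun_sg // stack_fun_tau // => k1 k2 k3.
    by apply: (@zone v u'); rewrite ?cm_dom.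
  + rewrite !stack_fun_tau // => k1 k2 k3; apply: (cm_noncross dv dv').
    * by have [] := pT_tau dv tv; have [] := pT_tau dv' tv'; move: k1; rewrite /pT; lia.
    * have [||] := @pT_tau (cm C2 v); rewrite ?cm_dom //.
      by have [] := pT_tau dv' tv'; move: k2; rewrite /pT; lia.
    * have [||] := @pT_tau (cm C2 v); rewrite ?cm_dom //.
      have [||] := @pT_tau (cm C2 v'); rewrite ?cm_dom //.
      by move: k3; rewrite /pT; lia.
exists T; split=> // l.
  by move=> dl; rewrite h4 ?stack_fun_sg //; apply: sg_dom.
by move=> dl tl tcl; rewrite h4 ?stack_fun_tau //; apply: tau_dom.
Qed.

Lemma stack_specP T l : stack_spec C1 C2 T -> cdom T l ->
  (exists2 u, cdom C1 u & l = sg C1 C2 u) \/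
  (exists v, [/\ cdom C2 v, ~~ top_lab v, ~~ top_lab (cm C2 v) & l = tau (ht C1) v]).
Proof. by case=> h1 h2 h3 _ _; rewrite h1 h2 h3; apply: stack_cover. Qed.

Lemma stack_spec_uniq T T' : stack_spec C1 C2 T -> stack_spec C1 C2 T' -> T = T'.
Proof.
move=> s s'; apply: conn_ext.
- by rewrite (stack_ht s) (stack_ht s').
- by rewrite (stack_nt s) (stack_nt s').
- by rewrite (stack_nb s) (stack_nb s').
move=> l /(stack_specP s) [[u du ->]|[v [dv tv tcv ->]]].
  by rewrite (stack_sg s) // (stack_sg s').
by rewrite (stack_tau s) // (stack_tau s').
Qed.

Lemma sg_injective u v : cdom C1 u -> cdom C1 v -> sg C1 C2 u = sg C1 C2 v -> u = v.
Proof.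
move=> du dv e; apply: (lpos_inj du dv).
by case: (ltngtP (cps C1 u) (cps C1 v)) => // h;
  [have := sg_mono du dv h | have := sg_mono dv du h]; rewrite e ltnn.
Qed.

End StackExists.

Lemma stack_rel_inl C1 C2 p q :
  @stack_rel C1 C2 (inl p) (inl q) = (arcs C1 p == q).
Proof. by case: p => [[]|[]]. Qed.

Lemma stack_rel_inr C1 C2 p q :
  @stack_rel C1 C2 (inr p) (inr q) = (arcs C2 p == q).
Proof. by case: p => [[]|[]]. Qed.

Section StackConnect.
Variables (C1 C2 : conn) (f : crossingless (ht C1 + ht C2) (nt C1) (nb C2)).
Hypothesis fC2 : no_top_return C2.
Hypothesis e12 : nb C1 = nt C2.
Hypothesis sp : stack_spec C1 C2 (Conn f).

Let T := Conn f.
Let V := (bpt (ht C1) (nt C1) (nb C1) + bpt (ht C2) (nt C2) (nb C2))%type.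

(** An outer point on the component of u. Along an edge it stays or turns into its mate in T, hence
    a component of the gluing graph has at most two outer points. *)
Definition strand_end (u : V) : lab :=
  match u with
  | inl p => sg C1 C2 (lab_of p)
  | inr q => if lab_of q is LT i then tau (ht C1) (cm C2 (LT i))
             else tau (ht C1) (lab_of q)
  end.

Lemma strand_end_outer p : strand_end (@stack_outer C1 C2 p) = lab_of p.
Proof.
case: p => [[i|i]|[i|i]] //=; case: splitP => k /= ->; by case: k.
Qed.

Lemma strand_end_step u v : stack_rel u v ->
  strand_end v = strand_end u \/ strand_end v = cm T (strand_end u).
Proof.
case: u v => [p|q] [p'|q'].
- rewrite stack_rel_inl => /eqP <- /=; right.
  rewrite -(@cmE C1) (stack_sg sp) //; exact: lab_of_dom.
- by case: p => [[i|i]|[i|i]] //; case: q' => [[j|j]|[j|j]] //= /eqP ->; left.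
- by case: q => [[i|i]|[i|i]] //; case: p' => [[j|j]|[j|j]] //= /eqP ->; left.
- rewrite stack_rel_inr => /eqP <- /=; rewrite -(@cmE C2).
  have d := lab_of_dom q; have := cm_dom C2 (lab_of q); rewrite d => d'.
  case: (boolP (top_lab (lab_of q))) => tq.
    left; move: (no_top_returnP _ fC2); case: (lab_of q) tq d => //= i _ hi /(_ _ hi).
    by case: (cm C2 (LT i)).
  case: (boolP (top_lab (cm C2 (lab_of q)))) => tq'.
    left; have := cmK C2 (lab_of q).
    by case: (cm C2 (lab_of q)) tq' => //= i _ ->; case: (lab_of q) tq.
  right; have := stack_tau sp d tq tq'.
  by case: (lab_of q) tq tq' => //= i _ h ->; case: (cm C2 _) h.
Qed.

Lemma strand_end_connect u v : connect (@stack_rel C1 C2) u v ->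
  strand_end v = strand_end u \/ strand_end v = cm T (strand_end u).
Proof.
case/connectP => p; elim: p u => [|w p IH] u /=; first by move=> _ ->; left.
case/andP => /strand_end_step h /IH IHp /IHp; case: h => ->; rewrite ?cmK; tauto.
Qed.

Lemma stack_rel_sym : connect_sym (@stack_rel C1 C2).
Proof.
apply: sym_connect_sym.
have K m a b (g : crossingless m a b) p q : (g p == q) = (g q == p).
  have gK : involutive g.
    by move=> x; apply/eqP; case/and3P: (mate_props g) => /forallP/(_ x).
  by apply/eqP/eqP => <-.
move=> [p|q] [p'|q']; rewrite ?stack_rel_inl ?stack_rel_inr; try exact: K.
  by case: p => [[i|i]|[i|i]] //; case: q' => [[j|j]|[j|j]].
by case: q => [[i|i]|[i|i]] //; case: p' => [[j|j]|[j|j]].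
Qed.

Lemma lab_of_tau (q : bpt (ht C2) (nt C2) (nb C2))
    (p : bpt (ht C1 + ht C2) (nt C1) (nb C2)) :
  ~~ top_lab (lab_of q) -> lab_of p = tau (ht C1) (lab_of q) ->
  stack_outer p = inr q.
Proof.
case: q => [[i|i]|[i|i]] //= _; case: p => [[j|j]|[j|j]] //= [] e.
- by congr (inr (inl (inr _))); apply: val_inj.
- case: splitP => k /= ek; first by have := ltn_ord k; lia.
  by congr (inr (inr (inl _))); apply: val_inj => /=; lia.
- case: splitP => k /= ek; first by have := ltn_ord k; lia.
  by congr (inr (inr (inr _))); apply: val_inj => /=; lia.
Qed.

Lemma connect_strand_end (u : V) p : lab_of p = strand_end u ->
  connect (@stack_rel C1 C2) u (stack_outer p).
Proof.
have low (q : bpt (ht C2) (nt C2) (nb C2)) : lab_of p = strand_end (inr q) ->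
    connect (@stack_rel C1 C2) (inr q) (stack_outer p).
  move=> e; case: (boolP (top_lab (lab_of q))) => tq; last first.
    rewrite (@lab_of_tau q) //; move: e => /=; by case: (lab_of q) tq.
  rewrite (@lab_of_tau (arcs C2 q)); first by apply: connect1; rewrite stack_rel_inr.
    rewrite -cmE; case: q tq {e} => [[i|i]|[i|i]] //= _.
    by have := no_top_returnP _ fC2 i; apply.
  by rewrite e /= -cmE; case: (lab_of q) tq.
case: u => [r|]; last exact: low.
move=> e; case: (boolP (bot_lab (lab_of r))) => br; last first.
  have -> : stack_outer p = inl r; last exact: connect0.
  case: r e br => [[i|i]|[i|i]] //=; case: p {low} => [[j|j]|[j|j]] //= [] e _.
  - by congr (inl (inl (inl _))); apply: val_inj.
  - case: splitP => k /= ek; last by have := ltn_ord i; lia.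
    by congr (inl (inr (inl _))); apply: val_inj; rewrite /= -ek.
  - case: splitP => k /= ek; last by have := ltn_ord i; lia.
    by congr (inl (inr (inr _))); apply: val_inj; rewrite /= -ek.
case: r e br => [[i|i]|[i|i]] //= e _.
have hi : i < nt C2 by rewrite -e12.
apply: connect_trans (low (inl (inl (Ordinal hi))) _); last exact: e.
by apply: connect1 => /=.
Qed.

Lemma spec_is_stack : is_stack f.
Proof.
apply/forallP => p; apply/forallP => q; apply/eqP.
have E : lab_of (f p) = cm T (lab_of p) by rewrite (@cmE T).
apply/idP/idP => [/eqP fpq|/andP [pq /strand_end_connect]]; last first.
  rewrite !strand_end_outer => -[/lab_of_inj e|e]; first by rewrite e eqxx in pq.
  by apply/eqP/lab_of_inj; rewrite E e.
apply/andP; split.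
  by apply/negP => /eqP e; have := @cm_neq T _ (lab_of_dom p);
  rewrite -E fpq e eqxx.
move: E; rewrite fpq => E.
case: (@stack_specP C1 C2 fC2 e12 _ _ sp (lab_of_dom p)) => [[u du e]|[v [dv tv tcv e]]].
  case: (dom_lab_of du) => r hr; subst u.
  apply: (@connect_trans _ _ (inl r)).
    by rewrite stack_rel_sym; apply: connect_strand_end.
  apply: (@connect_trans _ _ (inl (arcs C1 r))); first by apply: connect1; rewrite stack_rel_inl.
  by apply: connect_strand_end; rewrite E e (stack_sg sp) //= cmE.
case: (dom_lab_of dv) => r hr; subst v.
rewrite (lab_of_tau tv e) (@lab_of_tau (arcs C2 r)) -?cmE //.
  by apply: connect1; rewrite stack_rel_inr.
by rewrite E e (stack_tau sp).
Qed.

End StackConnect.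

Lemma is_stack_uniq C1 C2 T T' : @is_stack C1 C2 T -> @is_stack C1 C2 T' -> T = T'.
Proof.
move=> h h'; apply/val_inj/ffunP => p; apply/esym/eqP.
by rewrite (eqP (forallP (forallP h' p) _)) -(eqP (forallP (forallP h p) _)).
Qed.

(** From here on products are handled through [stack_spec]; the gluing graph is not consulted
    again. *)
Lemma vprod1P C1 C2 T : no_top_return C2 -> nb C1 = nt C2 ->
  vprod1 C1 C2 = Some T <-> stack_spec C1 C2 T.
Proof.
move=> fC2 e12; have [T0 sp] := stack_exists fC2 e12.
have -> : vprod1 C1 C2 = Some T0.
  case: T0 sp => m a b f sp.
  have /= h1 := stack_ht sp; have /= h2 := stack_nt sp; have /= h3 := stack_nb sp.
  subst m a b; rewrite /vprod1 e12 eqxx; case: pickP => [g hg|/(_ f)] /=.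
    by rewrite (is_stack_uniq hg (spec_is_stack fC2 e12 sp)).
  by rewrite spec_is_stack.
split=> [[<-] //|sp']; by rewrite (stack_spec_uniq fC2 e12 sp sp').
Qed.

Lemma vprod1_nb C1 C2 T : vprod1 C1 C2 = Some T -> nb C1 = nt C2.
Proof. by rewrite /vprod1; case: eqP. Qed.

Lemma vprod1_spec C1 C2 T : no_top_return C2 ->
  vprod1 C1 C2 = Some T -> stack_spec C1 C2 T.
Proof. by move=> f2 h; apply/(vprod1P _ f2 (vprod1_nb h)). Qed.

Lemma spec_vprod1 C1 C2 T : no_top_return C2 -> nb C1 = nt C2 ->
  stack_spec C1 C2 T -> vprod1 C1 C2 = Some T.
Proof. by move=> f2 e h; apply/(vprod1P _ f2 e). Qed.

Lemma stack_floor C1 C2 T : no_top_return C1 -> no_top_return C2 -> nb C1 = nt C2 ->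
  stack_spec C1 C2 T -> no_top_return T.
Proof.
move=> f1 f2 e sp; apply/no_top_returnP => i hi.
rewrite (stack_nt sp) in hi.
rewrite -[LT i]/(sg C1 C2 (LT i)) (stack_sg sp) //.
have := cm_dom C1 (LT i); have := no_top_returnP _ f1 i hi.
case: (cm C1 (LT i)) => //= j _; rewrite hi e top_tau => hj.
exact: (no_top_returnP _ f2).
Qed.

Lemma stack_floor_inv C1 C2 T : stack_spec C1 C2 T -> no_top_return T -> no_top_return C1.
Proof.
move=> sp f; apply/no_top_returnP => i hi; have := stack_sg sp (l := LT i) hi => /=.
have := no_top_returnP _ f i; rewrite (stack_nt sp) => /(_ hi).
by case: (cm C1 (LT i)) => //= j h e; rewrite e in h.
Qed.

(** [sg] is functorial: prolonging a strand of X through [W = Y *_v Z] is prolonging it through Y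
    and then through Z. *)
Lemma stack_assoc X Y Z T1 T2 W : no_top_return Y -> no_top_return Z ->
  nb X = nt Y -> nb Y = nt Z ->
  stack_spec X Y T1 -> stack_spec T1 Z T2 -> stack_spec Y Z W -> stack_spec X W T2.
Proof.
move=> fY fZ eXY eYZ s1 s2 sW.
have fW := stack_floor fY fZ eYZ sW.
have sgT l : cdom X l -> sg X W l = sg T1 Z (sg X Y l).
  case: l => //= i hi; rewrite eXY in hi.
  rewrite -[LT i]/(sg Y Z (LT i)) (stack_sg sW) //.
  have := no_top_returnP _ fY i hi; case: (cm Y (LT i)) => //= j _.
  by rewrite (stack_ht s1) tauA.
split.
- by rewrite (stack_ht s2) (stack_ht s1) (stack_ht sW) addnA.
- by rewrite (stack_nt s2) (stack_nt s1).
- by rewrite (stack_nb s2) (stack_nb sW).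
- move=> l dl; have dl' : cdom T1 (sg X Y l).
    by rewrite (domE _ (stack_ht s1) (stack_nt s1) (stack_nb s1)); apply: sg_dom.
  rewrite !sgT ?cm_dom // (stack_sg s2) // (stack_sg s1) //.
move=> l dl tl tcl.
case: (stack_specP fZ eYZ sW dl) => [[u du e]|[v [dv tv tcv ->]]]; last first.
  rewrite (stack_tau sW) // !tauA -(stack_ht s1) (stack_tau s2) //.
rewrite e in tl tcl *; rewrite (stack_sg sW) //.
have E w : cdom Y w -> ~~ top_lab w ->
    tau (ht X) (sg Y Z w) = sg T1 Z (tau (ht X) w).
  by case: w => //= i _ _; rewrite tauA (stack_ht s1).
have tu : ~~ top_lab u by case: u tl {du e tcl}.
have tcu : ~~ top_lab (cm Y u).
  by move: tcl; rewrite (stack_sg sW) //; case: (cm Y u).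
rewrite !E ?cm_dom // (stack_sg s2); last first.
  rewrite (domE _ (stack_ht s1) (stack_nt s1) (stack_nb s1)).
  by case: u du tu {dl e tl tcl tcu} => //= i; lia.
by rewrite (stack_tau s1).
Qed.

(** * Bottom states *)

Lemma bottom_floor B : bottom_state B -> no_top_return B.
Proof. by case/andP. Qed.

Lemma bottom_ht B : bottom_state B -> ht B = 0.
Proof. by case/andP => _ /eqP. Qed.

Lemma bottom_dom B l : bottom_state B -> cdom B l ->
  (exists2 i, i < nt B & l = LT i) \/ (exists2 i, i < nb B & l = LB i).
Proof.
move=> /bottom_ht h; case: l => i /=; rewrite ?h //; by [left; exists i | right; exists i].
Qed.

(* Equal to i when the i-th bottom point is joined to the top. *)
Definition bmate B i := if cm B (LB i) is LB j then j else i.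

Lemma bottom_cmB B i : bottom_state B -> i < nb B ->
  (exists2 t, t < nt B & cm B (LB i) = LT t) \/
  [/\ bmate B i < nb B, bmate B i != i & cm B (LB i) = LB (bmate B i)].
Proof.
move=> bB hi; have := cm_dom B (LB i); rewrite /= hi => d.
have := @cm_neq B (LB i) hi.
case: (bottom_dom bB d) => [[t ht e] _|[j hj e]]; first by left; exists t.
by rewrite /bmate e lab_eqE => n; right.
Qed.

Lemma bottom_cmT B t : bottom_state B -> t < nt B ->
  exists2 i, i < nb B & cm B (LT t) = LB i.
Proof.
move=> bB ht; have := cm_dom B (LT t); rewrite /= ht => d.
have := no_top_returnP _ (bottom_floor bB) t ht.
by case: (bottom_dom bB d) => [[j _ ->]|[j hj ->]] // _; exists j.
Qed.

Lemma bmateK B i : bmate B (bmate B i) = i.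
Proof.
rewrite {2}/bmate; case e: (cm B (LB i)) => [j|j|j|j]; rewrite /bmate ?e //.
by move/cm_eq_sym: e => ->.
Qed.

Lemma bmate_lt B i : i < nb B -> bmate B i < nb B.
Proof.
move=> hi; have := cm_dom B (LB i); rewrite /bmate /= hi.
by case: (cm B (LB i)).
Qed.

Lemma bmateE B i j : i != j -> (bmate B i == j) = (cm B (LB i) == LB j).
Proof.
move=> n; rewrite /bmate; case e: (cm B (LB i)) => [k|k|k|k];
  by rewrite lab_eqE // (negbTE n).
Qed.

(** A bottom state has no sides, so an arc that starts under a return cannot leave without crossing
    it. *)
Lemma bmate_inner B i k : bottom_state B -> i < k -> k < bmate B i -> i < nb B ->
  i < bmate B k < bmate B i /\ bmate B k != k.
Proof.
move=> bB ik kj hi; have hj := bmate_lt hi.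
have hk : k < nb B by lia.
case: (bottom_cmB bB hi) => [[t _ e]|[_ _ ei]].
  by move: kj; rewrite /bmate e; lia.
have ej : cm B (LB (bmate B i)) = LB i by apply/cm_eq_sym.
case: (bottom_cmB bB hk) => [[t ht ek]|[hbk nbk ek]].
  exfalso; have et : cm B (LT t) = LB k by apply/cm_eq_sym.
  by apply: (@cm_noncross B (LT t) (LB (bmate B i))); rewrite ?et ?ej /=; lia.
split=> //.
have n1 : bmate B k != i.
  by apply/eqP => e; have := bmateK B k; rewrite e; lia.
have n2 : bmate B k != bmate B i.
  by apply/eqP => e; have := bmateK B k; rewrite e bmateK; lia.
have ekb : cm B (LB (bmate B k)) = LB k by apply/cm_eq_sym.
apply/negPn/negP; rewrite negb_and -!leqNgt => /orP [h|h].
  by apply: (@cm_noncross B (LB (bmate B i)) (LB k)); rewrite ?ej ?ek /=; lia.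
by apply: (@cm_noncross B (LB (bmate B k)) (LB (bmate B i))); rewrite ?ekb ?ej /=; lia.
Qed.

Lemma phiP B k : reflect (exists i, [/\ k = i.+1, i < nb B & i < bmate B i])
  (k \in phi B).
Proof.
rewrite /phi inE /=; apply: (iffP mapP) => [[i]|[i [-> hi hm]]].
  rewrite mem_filter => /andP [/existsP [j /andP [ij /eqP e]] _] ->.
  exists (nat_of_ord i); split=> //.
  have : cm B (LB i) = LB j.
    by rewrite -[LB i]/(lab_of (bot_pt (ht B) (nt B) i)) cmE e.
  by rewrite /bmate => ->.
exists (Ordinal hi) => //; rewrite mem_filter mem_enum andbT.
have hj := bmate_lt hi; apply/existsP; exists (Ordinal hj) => /=; rewrite hm /=.
apply/eqP/(@lab_of_inj (ht B) (nt B) (nb B)); rewrite -cmE /=.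
apply/eqP; rewrite -bmateE //; by rewrite neq_ltn hm.
Qed.

(** A bracket word is determined by its opening brackets. Induction on the length of the return at
    i: those strictly inside agree already, so the mate of i in B' cannot lie among them. Were it
    further right, the mate of i in B would have to open a return of B', although in B it closes
    one. *)
Lemma bmate_phi_le B B' : bottom_state B -> bottom_state B' -> nb B = nb B' ->
  phi B = phi B' -> forall d i, i < nb B -> i < bmate B i -> bmate B i - i <= d ->
  bmate B' i = bmate B i.
Proof.
move=> bB bB' eb ephi; elim=> [|d IH] i hi him hd; first by lia.
have inner k : i < k -> k < bmate B i -> bmate B' k = bmate B k /\ i < bmate B k < bmate B i.
  move=> ik kj; have [h1 h2] := bmate_inner bB ik kj hi; split=> //.
  have hk : k < nb B by have := bmate_lt hi; lia.
  have hk' := bmate_lt hk.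
  case: (ltngtP k (bmate B k)) => h.
  - by apply: IH => //; lia.
  - have e : bmate B' (bmate B k) = k.
      by rewrite IH ?bmateK //; lia.
    by rewrite -{1}e bmateK.
  - by lia.
have hj := bmate_lt hi.
have : i.+1 \in phi B' by rewrite -ephi; apply/phiP; exists i.
case/phiP => i' [[<-] hi' him'].
have hj' := bmate_lt hi'.
case: (ltngtP (bmate B' i) (bmate B i)) => // h.
  have [e1 e2] := inner _ him' h; rewrite bmateK in e1; lia.
have [/andP [h1 h2] h3] := bmate_inner bB' him h hi'.
case: (ltngtP (bmate B' (bmate B i)) (bmate B i)) => [h4|h4|h4].
- have [e1 e2] := inner _ h1 h4; rewrite bmateK in e1; lia.
- have : (bmate B i).+1 \in phi B.
    by rewrite ephi; apply/phiP; exists (bmate B i); split=> //; lia.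
  by case/phiP => k [[<-]]; rewrite bmateK; lia.
- by rewrite h4 eqxx in h3.
Qed.

Lemma bmate_phi B B' i : bottom_state B -> bottom_state B' -> nb B = nb B' ->
  phi B = phi B' -> i < nb B -> bmate B' i = bmate B i.
Proof.
move=> bB bB' eb ephi hi.
have hi' : i < nb B' by rewrite -eb.
case: (ltngtP i (bmate B i)) => h.
- exact: (bmate_phi_le bB bB' eb ephi hi h (leqnn _)).
- have h2 : bmate B i < bmate B (bmate B i) by rewrite bmateK.
  have := bmate_phi_le bB bB' eb ephi (bmate_lt hi) h2 (leqnn _).
  by rewrite bmateK => e; rewrite -{1}e bmateK.
- case: (ltngtP i (bmate B' i)) => h'; last by rewrite -h' -h.
    have := bmate_phi_le bB' bB (esym eb) (esym ephi) hi' h' (leqnn _); lia.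
  have h2 : bmate B' i < bmate B' (bmate B' i) by rewrite bmateK.
  have := bmate_phi_le bB' bB (esym eb) (esym ephi) (bmate_lt hi') h2 (leqnn _).
  by rewrite bmateK => e; have := bmateK B (bmate B' i); rewrite e; lia.
Qed.

(** The bottom end of the t-th through strand; 0 is a dummy value. *)
Definition thr B t := if cm B (LT t) is LB i then i else 0.

Lemma thrE B t : bottom_state B -> t < nt B -> thr B t < nb B /\ cm B (LT t) = LB (thr B t).
Proof. by move=> bB ht; have [i hi e] := bottom_cmT bB ht; rewrite /thr e. Qed.

Lemma thr_mono B s t : bottom_state B -> s < t -> t < nt B -> thr B s < thr B t.
Proof.
move=> bB st ht.
have := top_antimono (bottom_floor bB) st ht.
have [h1 ->] := thrE bB ht; have [h2 ->] := thrE bB (ltn_trans st ht).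
rewrite /=; lia.
Qed.

Lemma thr_sorted B : bottom_state B ->
  sorted ltn [seq thr B t | t <- iota 0 (nt B)].
Proof.
move=> bB; apply: (@homo_sorted_in _ _ (fun t => t < nt B) _ ltn).
- by move=> s t hs ht st; apply: thr_mono.
- by apply/allP => t; rewrite mem_iota.
- exact: iota_ltn_sorted.
Qed.

Lemma mem_thr B i : bottom_state B ->
  (i \in [seq thr B t | t <- iota 0 (nt B)]) = (i < nb B) && (bmate B i == i).
Proof.
move=> bB; apply/mapP/andP => [[t]|[hi /eqP e]].
  rewrite mem_iota => /= ht ->; have [h /cm_eq_sym e] := thrE bB ht.
  by rewrite h /bmate e.
case: (bottom_cmB bB hi) => [[t ht /cm_eq_sym et]|[_]]; last by rewrite e eqxx.
by exists t; [rewrite mem_iota | rewrite /thr et].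
Qed.

(** Bottom points are left ends, right ends or ends of through strands; [bmate] exchanges the first
    two classes. *)
Lemma phi_card B : bottom_state B -> nb B = nt B + 2 * #|` phi B|.
Proof.
move=> bB.
pose L := [seq i <- iota 0 (nb B) | i < bmate B i].
pose R := [seq i <- iota 0 (nb B) | bmate B i < i].
have uL : uniq L by rewrite filter_uniq // iota_uniq.
have uR : uniq R by rewrite filter_uniq // iota_uniq.
have sT : nt B = count (fun i => bmate B i == i) (iota 0 (nb B)).
  rewrite -size_filter -{1}(size_iota 0 (nt B)) -(size_map (thr B)).
  apply/perm_size/uniq_perm.
  - by apply: (sorted_uniq ltn_trans ltnn); apply: thr_sorted.
  - by rewrite filter_uniq // iota_uniq.
  - by move=> i; rewrite mem_thr // mem_filter mem_iota andbC.
have sR : size R = size L.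
  rewrite -(size_map (bmate B) L); apply/perm_size/uniq_perm => //.
    by rewrite map_inj_uniq //; apply: (can_inj (@bmateK B)).
  move=> i; rewrite mem_filter mem_iota /= add0n.
  apply/andP/mapP => [[h hi]|[j]].
    by exists (bmate B i); rewrite ?bmateK // mem_filter bmateK h mem_iota bmate_lt.
  rewrite mem_filter mem_iota /= add0n => /andP [h hj] ->.
  by rewrite bmateK h bmate_lt.
have sL : #|` phi B| = size L.
  rewrite -(size_map S L); apply/perm_size/uniq_perm.
  - exact: fset_uniq.
  - by rewrite map_inj_uniq //; apply: succn_inj.
  - move=> k; apply/phiP/mapP => [[i [-> hi h]]|[i]].
      by exists i; rewrite // mem_filter h mem_iota.
    by rewrite mem_filter mem_iota /= add0n => /andP [h hi] ->; exists i.
have -> : nb B = size L + size R + nt B.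
  rewrite sT -{1}(size_iota 0 (nb B)) !size_filter.
  elim: (iota 0 (nb B)) => //= i s ->; case: ltngtP => h /=; lia.
rewrite sR sL; lia.
Qed.

(** [phi] fixes the returns. The remaining bottom points are met by the through strands from left to
    right, so these are fixed too. *)
Lemma phi_inj B B' : bottom_state B -> bottom_state B' -> nb B = nb B' ->
  phi B = phi B' -> B = B'.
Proof.
move=> bB bB' eb ephi.
have ent : nt B = nt B' by have := phi_card bB; have := phi_card bB'; rewrite ephi; lia.
have ethr : [seq thr B t | t <- iota 0 (nt B)] = [seq thr B' t | t <- iota 0 (nt B)].
  apply: (irr_sorted_eq ltn_trans ltnn); rewrite ?thr_sorted //.
    by rewrite ent thr_sorted.
  move=> i; rewrite mem_thr // ent mem_thr // eb; case: ltnP => //= h.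
  by rewrite (@bmate_phi B B') // eb.
have eT t : t < nt B -> thr B t = thr B' t.
  move=> ht; have /(congr1 (fun s => nth 0 s t)) := ethr.
  by rewrite !(nth_map 0) ?size_iota // nth_iota.
apply: conn_ext => //; first by rewrite !bottom_ht.
move=> l dl; case: (bottom_dom bB dl) => [[t ht ->]|[i hi ->]].
  have [_ ->] := thrE bB ht; rewrite eT //.
  by have [|_ ->] := thrE bB' (t := t); rewrite -?ent.
have hi' : i < nb B' by rewrite -eb.
case: (bottom_cmB bB hi) => [[t ht /cm_eq_sym e]|[_ h e]].
  have e1 : thr B t = i by rewrite /thr e.
  rewrite eT // in e1; have [|_ e2] := thrE bB' (t := t); first by rewrite -ent.
  by rewrite e1 in e2; move/cm_eq_sym: e2 => ->; apply/cm_eq_sym.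
by apply/esym/eqP; rewrite e -bmateE 1?eq_sym // (@bmate_phi B B').
Qed.

Lemma phi_invP n I B : phi_inv n I = Some B <-> [/\ bottom_state B, nb B = n & phi B = I].
Proof.
have S B1 B2 : phi_inv n I = Some B1 -> [/\ bottom_state B2, nb B2 = n & phi B2 = I] ->
    [/\ bottom_state B1, nb B1 = n & phi B1 = I].
  move=> h _; move: h; rewrite /phi_inv; case: pickP => //= T /andP [bT /eqP eT] [<-].
  by split.
split=> [h|h].
  move: h; rewrite /phi_inv; case: pickP => //= T /andP [bT /eqP eT] [<-].
  by split.
case: (h) => bB eb ephi.
case e: (phi_inv n I) => [B1|].
  have [b1 e1 e2] := S _ _ e h; congr Some; apply: phi_inj => //; congruence.
exfalso; move: e; rewrite /phi_inv; case: pickP => // H _.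
have ea : nt B = n - 2 * #|` I| by have := phi_card bB; rewrite eb ephi; lia.
have e0 := bottom_ht bB.
case: B bB h eb ephi ea e0 => m a b f /= bB h eb ephi ea e0.
move: f bB h ephi; rewrite eb ea e0 => f bB h ephi.
by have := H f; rewrite bB ephi eqxx.
Qed.

Lemma in_LP n I : reflect (exists B, [/\ bottom_state B, nb B = n & phi B = I]) (in_L n I).
Proof.
rewrite /in_L; case e: (phi_inv n I) => [B|] /=; constructor.
  by exists B; apply/phi_invP.
by case=> B /phi_invP; rewrite e.
Qed.

(** [sg] is injective and depends on the upper factor only through its height, so the arcs of G can
    be read off from F. *)
Lemma strip_uniq B F G G' : bottom_state B -> vprod1 G B = Some F ->
  vprod1 G' B = Some F -> G = G'.
Proof.
move=> bB v v'; have fB := bottom_floor bB; have hB := bottom_ht bB.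
have s := vprod1_spec fB v; have s' := vprod1_spec fB v'.
have e := vprod1_nb v; have e' := vprod1_nb v'.
have eh : ht G = ht G' by have := stack_ht s; have := stack_ht s'; lia.
have en : nt G = nt G' by rewrite -(stack_nt s) -(stack_nt s').
have eb : nb G = nb G' by congruence.
have E l : sg G' B l = sg G B l by rewrite /sg eh.
apply: conn_ext => // l dl.
apply: (@sg_injective G B) => //; rewrite ?cm_dom //.
  by rewrite (domE _ eh en eb) cm_dom -(domE _ eh en eb).
rewrite -(stack_sg s) // -E (stack_sg s'); first exact: E.
by rewrite -(domE _ eh en eb).
Qed.

Lemma strip1P F B G : bottom_state B -> nb F = nb B ->
  strip1 F (phi B) = Some G <-> vprod1 G B = Some F.
Proof.
move=> bB eF.
rewrite /strip1; have -> : phi_inv (nb F) (phi B) = Some B by apply/phi_invP.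
case: pickP => [T /eqP hT|H] /=; split=> //.
- by case=> <-.
- by move=> h; congr Some; apply: strip_uniq h.
move=> h.
exfalso; have s := vprod1_spec (bottom_floor bB) h; have e := vprod1_nb h.
have := stack_ht s; rewrite (bottom_ht bB) addn0 => eh; have en := stack_nt s.
case: G h {s} e eh en => m a b f /= h e eh en.
move: f h; rewrite e -eh -en => f h.
by have := H f; rewrite h eqxx.
Qed.

Lemma in_FinN_phi B : in_FinN (phi B).
Proof. by apply/negP => /phiP [i []]. Qed.

Lemma bottom_stateI B : ht B = 0 -> no_top_return B -> bottom_state B.
Proof. by move=> h f; apply/andP; split; rewrite // h. Qed.

Lemma stack_bottom C1 C2 T : bottom_state C1 -> bottom_state C2 -> nb C1 = nt C2 ->
  stack_spec C1 C2 T -> bottom_state T.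
Proof.
move=> b1 b2 e s; apply: bottom_stateI.
  by rewrite (stack_ht s) !bottom_ht.
by apply: stack_floor s => //; apply: bottom_floor.
Qed.

Lemma phi_ext B B' : nb B' = (nb B).+1 -> bmate B' (nb B) = nb B ->
  (forall i, i < nb B -> bmate B' i = bmate B i) -> phi B' = phi B.
Proof.
move=> en el e; apply/fsetP => k; apply/phiP/phiP => -[i [-> hi h]]; exists i; split=> //.
- by move: hi h; rewrite en ltnS leq_eqVlt => /predU1P [->|//]; rewrite el ltnn.
- move: hi h; rewrite en ltnS leq_eqVlt => /predU1P [->|hi]; first by rewrite el ltnn.
  by rewrite e.
- by rewrite en ltnW.
- by rewrite e.
Qed.

Lemma add_strand B : bottom_state B -> exists B',
  [/\ bottom_state B', nb B' = (nb B).+1, phi B' = phi B & cm B' (LB (nb B)) = LT (nt B)].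
Proof.
move=> bB; pose a := nt B; pose b := nb B.
pose f l := if l == LT a then LB b else if l == LB b then LT a else cm B l.
have old l : dom 0 a.+1 b.+1 l -> l != LT a -> l != LB b -> cdom B l.
  case: l => i; rewrite !lab_eqE /= -/a -/b ?(bottom_ht bB); lia.
have old' l : cdom B l -> [/\ dom 0 a.+1 b.+1 l, l != LT a & l != LB b].
  by case: l => i; rewrite !lab_eqE /= -/a -/b ?(bottom_ht bB) // => h; split=> //; lia.
have fo l : cdom B l -> f l = cm B l.
  by case/old' => _ h1 h2; rewrite /f (negbTE h1) (negbTE h2).
have fT : f (LT a) = LB b by rewrite /f eqxx.
have fB : f (LB b) = LT a by rewrite /f eqxx.
have cases l : dom 0 a.+1 b.+1 l -> [\/ l = LT a, l = LB b | cdom B l].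
  move=> d; case: (altP (l =P LT a)) => [->|h]; first by constructor 1.
  case: (altP (l =P LB b)) => [->|h']; first by constructor 2.
  by constructor 3; apply: old.
have pos l : cdom B l -> (lpos 0 a.+1 b.+1 l < a /\ cps B l = lpos 0 a.+1 b.+1 l) \/
    (lpos 0 a.+1 b.+1 l > a.+1 /\ (cps B l).+2 = lpos 0 a.+1 b.+1 l).
  by rewrite /a /b; case: l => i /=; rewrite ?(bottom_ht bB); lia.
have pT : lpos 0 a.+1 b.+1 (LT a) = a by [].
have pB : lpos 0 a.+1 b.+1 (LB b) = a.+1 by rewrite /=; lia.
have [||||B' [h1 h2 h3 h4]] := @build 0 a.+1 b.+1 f.
- move=> l /cases [->|->|d]; rewrite ?fT ?fB ?fo //=.
  by have [] := old' (cm B l); rewrite ?cm_dom.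
- by move=> l /cases [->|->|d]; rewrite ?fT ?fB ?fT // !fo ?cm_dom ?cmK.
- move=> l /cases [->|->|d]; rewrite ?fT ?fB ?fo //.
  by apply/eqP/cm_neq.
- move=> l l' /cases [->|->|d] /cases [->|->|d']; rewrite ?fT ?fB ?fo ?pT ?pB //; try lia.
  move=> k1 k2 k3; have dc : cdom B (cm B l) by rewrite cm_dom.
  have dc' : cdom B (cm B l') by rewrite cm_dom.
  apply: (cm_noncross d d').
  + by case: (pos _ d) => -[]; case: (pos _ d') => -[]; lia.
  + by case: (pos _ d') => -[]; case: (pos _ dc) => -[]; lia.
  + by case: (pos _ dc) => -[]; case: (pos _ dc') => -[]; lia.
have bm i : i < b -> bmate B' i = bmate B i.
  move=> hi; have d : cdom B (LB i) by [].
  by rewrite /bmate h4 ?fo //=; case: (old' _ d).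
have last : cm B' (LB b) = LT a by rewrite h4 //= ltnSn.
exists B'; split=> //.
- apply: bottom_stateI => //; apply/no_top_returnP => i; rewrite h2 => hi.
  have d : dom 0 a.+1 b.+1 (LT i) by [].
  rewrite h4 //; case: (cases _ d) => [->|//|d']; first by rewrite fT.
  by rewrite fo // (no_top_returnP _ (bottom_floor bB)).
- by apply: phi_ext => //; rewrite /bmate last.
Qed.

(** Through strands keep their order, so the one that ends at the last bottom point starts at the
    last top point and can be removed. *)
Lemma drop_strand B N t : bottom_state B -> nb B = N.+1 -> cm B (LB N) = LT t ->
  exists B', [/\ [/\ bottom_state B', nb B' = N, nt B = (nt B').+1 & nt B' = t],
    phi B' = phi B & forall l, cdom B' l -> cdom B l /\ cm B l = cm B' l].
Proof.
move=> bB eN e; have hN : N < nb B by rewrite eN.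
have et : cm B (LT t) = LB N by apply/cm_eq_sym.
have ht : t < nt B by have := cm_dom B (LB N); rewrite e /= hN.
have et' : nt B = t.+1.
  apply/eqP; rewrite eqn_leq ht andbT leqNgt; apply/negP => h.
  have [h1 e1] := thrE bB (t := t.+1) h.
  have := @thr_mono B t t.+1 bB (ltnSn _) h; rewrite {1}/thr et; lia.
have dE l : cdom B l -> [\/ l = LT t, l = LB N | dom 0 t N l].
  move=> d; case: (bottom_dom bB d) => [[i hi ->]|[i hi ->]] /=.
    case: (ltngtP i t) => h; [by constructor 3|lia|by constructor 1; rewrite h].
  case: (ltngtP i N) => h; [by constructor 3|lia|by constructor 2; rewrite h].
have [||||B' [h1 h2 h3 h4]] := @restrict B 0 t N id (cps B).
- exact: cm_noncross.
- by case=> i //=; lia.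
- by case=> i [] j //= *; rewrite (bottom_ht bB) eN; lia.
- move=> l d; have dl : cdom B l by case: l d => i //=; lia.
  exists (cm B l) => //; have := dE (cm B l); rewrite cm_dom => /(_ dl) [] // k.
    by move/cm_eq_sym: k; rewrite et => k; rewrite -k /= ltnn in d.
  by move/cm_eq_sym: k; rewrite e => k; rewrite -k /= ltnn in d.
have h4' l : cdom B' l -> cm B l = cm B' l by rewrite h1 h2 h3; apply: h4.
have bB' : bottom_state B'.
  apply: bottom_stateI => //; apply/no_top_returnP => i hi; rewrite -h4' //.
  by apply: (no_top_returnP _ (bottom_floor bB)); lia.
exists B'; split=> //; first by split=> //; rewrite h2.
  apply/esym/phi_ext; rewrite h3 // /bmate ?e // => i hi.
  by rewrite h4' //= h3.
move=> l d; split; last exact: h4'.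
by case: l d => i /=; rewrite ?(bottom_ht bB) ?h1 ?h2 ?h3 ?et' ?eN // => /ltnW.
Qed.

Lemma in_LS n I : in_L n I -> in_L n.+1 I.
Proof.
case/in_LP => B [bB eb <-]; have [B' [bB' eb' ep _]] := add_strand bB.
by apply/in_LP; exists B'; rewrite eb' eb.
Qed.

Lemma is_n_of_exists n I : in_L n I -> exists k, is_n_of I k.
Proof.
move=> h; have ex : exists n, in_L n I by exists n.
exists (ex_minn ex); case: ex_minnP => k hk mk m; split; first exact: mk.
move=> /subnK <-; elim: (m - k) => // j IH; by rewrite addSn; apply: in_LS.
Qed.

(* Removing the last through strand of B' removes one of B and one of K, which
   leaves all index sets unchanged; so the bottom states may be shortened until
   B' has n_I bottom points. *)
Lemma strip_min k K B B' : bottom_state K -> bottom_state B -> bottom_state B' ->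
  stack_spec K B B' -> nb K = nt B -> is_n_of (phi B') k ->
  exists C, strip (phi_inv k (phi B')) (phi B) = Some C /\ phi K = phi C.
Proof.
move=> bK bB bB' sp e hk.
have : k <= nb B' by apply/hk/in_LP; exists B'.
move=> /subnK; move: (nb B' - k) => d.
elim: d K B B' bK bB bB' sp e hk => [|d IH] K B B' bK bB bB' sp e hk ed.
  have -> : phi_inv k (phi B') = Some B' by apply/phi_invP; rewrite -ed.
  exists K; split=> //=; apply/strip1P => //; first exact: (stack_nb sp).
  by apply: spec_vprod1 => //; apply: bottom_floor.
have fB := bottom_floor bB.
pose N := d + k.
have eN : nb B' = N.+1 by rewrite -ed addSn.
have eNB : nb B = N.+1 by rewrite -(stack_nb sp).
(* [phi B'] is also realized on N points. Adding a strand to that state gives [B'] back, so the last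
   bottom point of [B'] ends a through strand. *)
have /in_LP [B1 [bB1 eB1 pB1]] : in_L N (phi B') by apply/hk; rewrite leq_addl.
have [B2 [bB2 eB2 pB2 lB2]] := add_strand bB1.
have E2 : B2 = B' by apply: phi_inj => //; rewrite ?eB2 ?eB1 ?eN ?pB2.
rewrite E2 eB1 in lB2.
(* A return of B at this point would be a return of [B'], so B has a through strand here; likewise
   for K below. *)
have [t htB eB] : exists2 t, t < nt B & cm B (LB N) = LT t.
  case: (@bottom_cmB B N bB); rewrite ?eNB // => -[_ h eb]; exfalso.
  have := stack_tau sp (l := LB N); rewrite /= eNB eb /= lB2.
  by move=> /(_ (ltnSn _) isT isT).
have [B3 [[bB3 nB3 tB3 tB3'] pB3 cB3]] := drop_strand bB eNB eB.
have eK : nb K = t.+1 by rewrite e tB3 tB3'.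
have [u eKu] : exists u, cm K (LB t) = LT u.
  have ht : t < nb K by rewrite eK.
  case: (bottom_cmB bK ht) => [[u _ ?]|[h1 h2 h3]]; first by exists u.
  exfalso; have := stack_sg sp (l := LB t) ht; rewrite h3 /=.
  move/cm_eq_sym: eB => ->; rewrite /= lB2.
  by have [] := bottom_cmT bB (t := bmate K t); rewrite -?e // => i _ ->.
have [K3 [[bK3 nK3 tK3 tK3'] pK3 cK3]] := drop_strand bK eK eKu.
have [B4 [[bB4 nB4 tB4 tB4'] pB4 cB4]] := drop_strand bB' eN lB2.
have e3 : nb K3 = nt B3 by rewrite nK3 tB3'.
have [T sT] := stack_exists (bottom_floor bB3) e3.
have sg3 l : cdom K3 l -> sg K3 B3 l = sg K B l.
  by case: l => //= i hi; rewrite !bottom_ht //; have [|_ ->] := cB3 (LT i); rewrite /= -?e3.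
have hT : ht T = ht B4 by rewrite (stack_ht sT) !bottom_ht.
have nT : nt T = nt B4.
  by rewrite (stack_nt sT); have := stack_nt sp; rewrite tK3 tB4; case.
have nbT : nb T = nb B4 by rewrite (stack_nb sT) nB3 nB4.
have sp4 : stack_spec K3 B3 B4.
  split; first by rewrite -hT (stack_ht sT).
  - by rewrite -nT (stack_nt sT).
  - by rewrite nB3 nB4.
  - move=> l dl; have [|_ <-] := cB4 (sg K3 B3 l).
      rewrite -hT -nT -nbT (domE _ (stack_ht sT) (stack_nt sT) (stack_nb sT)).
      by apply: sg_dom => //; apply: bottom_floor.
    by have [dl' e5] := cK3 _ dl; rewrite !sg3 ?cm_dom // (stack_sg sp) // e5.
  - move=> l dl tl tcl; rewrite bottom_ht // !tau0.
    have [|_ <-] := cB4 l.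
      rewrite (domE _ (esym hT) (esym nT) (esym nbT)).
      rewrite (domE _ (stack_ht sT) (stack_nt sT) (stack_nb sT)).
      by case: l dl tl tcl => //= i; rewrite ?bottom_ht.
    have [dl' e5] := cB3 _ dl.
    by have := stack_tau sp dl' tl; rewrite (bottom_ht bK) !tau0 e5 => ->.
rewrite -pB4 -pB3 -pK3; by apply: IH => //; rewrite pB4.
Qed.

(** The relation [trileq] from (R, I) to a pair w with a middle state, stated by bottom states: B
    has index set I, [B' = K *_v B] has that of w, and K has the difference of the two. R enters
    only through n = n_t(R) and b = n_b(R). *)
Definition target n b (I : {fset nat}) (w : conn * {fset nat}) : Prop :=
  [/\ middle_state w.1, nb w.1 = b & exists B B' K : conn,
    [/\ [/\ bottom_state B, bottom_state B' & bottom_state K],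
        [/\ nt B = n, phi B = I, phi B' = w.2 & nt B' = nt w.1]
      & vprod1 K B = Some B']].

(** The factorization is given on [nb B] bottom points, while the difference of index sets is
    defined on the least possible number; [strip_min] bridges the two. *)
Lemma target_trileq R I w : target (nt R) (nb R) I w ->
  [/\ in_W w, middle_state w.1 & trileq (R, I) w].
Proof.
case: w => R' I' [/= mR' eb [B [B' [K [[bB bB' bK] [nB pB pB' nB'] v]]]]].
rewrite /= in nB' pB'; have sp := vprod1_spec (bottom_floor bB) v; have e := vprod1_nb v.
have enb := stack_nb sp.
have ivB : phi_inv (nb B) I = Some B by apply/phi_invP.
have ivB' : phi_inv (nb B) I' = Some B' by apply/phi_invP.
have iB : in_L (nb B) I by rewrite /in_L ivB.
have iB' : in_L (nb B) I' by rewrite /in_L ivB'.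
split=> //.
  rewrite /in_W /= -pB' in_FinN_phi andbT; by case/andP: mR'.
split=> //=; last by rewrite -nB -nB' -pB -pB' -!phi_card.
split.
  exists (nb B); split=> //; rewrite ivB' /= -pB.
  by have /strip1P -> : vprod1 K B = Some B'.
have [k hk] := is_n_of_exists iB'.
exists (phi K); split.
  exists k; split=> //; rewrite -pB -pB'; apply: (strip_min bK bB bB' sp e).
  by rewrite pB'.
by apply/in_LP; exists K; split=> //; rewrite e.
Qed.

Lemma ident_exists n : exists K, [/\ bottom_state K, nt K = n, nb K = n &
  forall i, i < n -> cm K (LT i) = LB i].
Proof.
pose f l := match l with LT i => LB i | LB i => LT i | _ => l end.
have [||||K [h1 h2 h3 h4]] := @build 0 n n f.
- by case.
- by case.
- by case.
- by case=> i [] j //=; lia.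
exists K; split=> //; last by move=> i hi; rewrite h4.
by apply: bottom_stateI => //; apply/no_top_returnP => i; rewrite h2 => hi; rewrite h4.
Qed.

Lemma ident_stack K B : bottom_state K -> bottom_state B -> nb K = nt B ->
  (forall i, i < nb K -> cm K (LB i) = LT i) -> nt K = nb K -> stack_spec K B B.
Proof.
move=> bK bB e cK en; have hK := bottom_ht bK; split=> //.
- by rewrite hK.
- by rewrite en.
- move=> l dl; case: (bottom_dom bK dl) => [] [i hi ->] /=.
    have -> : cm K (LT i) = LB i by apply/cm_eq_sym/cK; lia.
    by rewrite /= hK tau0.
  by rewrite cK //= hK tau0 cmK.
- by move=> l _ _ _; rewrite hK !tau0.
Qed.

Lemma target_refl B R : bottom_state B -> nt B = nt R -> middle_state R ->
  target (nt R) (nb R) (phi B) (R, phi B).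
Proof.
move=> bB e mR; split=> //; have [K [bK e1 e2 cK]] := ident_exists (nt R).
exists B, B, K; split=> //; apply: spec_vprod1; rewrite ?bottom_floor ?e2 //.
apply: ident_stack => //; rewrite ?e1 ?e2 // => i hi; exact/cm_eq_sym/cK.
Qed.

(** If [B1 = K1 *_v B] and [B' = K2 *_v B1], then [B' = (K2 *_v K1) *_v B]. *)
Lemma target_trans K1 B B1 b w : bottom_state K1 -> bottom_state B ->
  stack_spec K1 B B1 -> nb K1 = nt B -> target (nt K1) b (phi B1) w ->
  target (nt B) b (phi B) w.
Proof.
move=> bK1 bB s1 e1 [mw bw [B2 [B' [K2 [[bB2 bB' bK2] [nB2 pB2 pB' nB'] v]]]]].
have bB1 := stack_bottom bK1 bB e1 s1.
have E : B2 = B1.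
  apply: phi_inj => //; have := phi_card bB2; have := phi_card bB1.
  by rewrite pB2 nB2 (stack_nt s1); lia.
subst B2; have e2 : nb K2 = nt K1 by rewrite (vprod1_nb v) (stack_nt s1).
have s2 := vprod1_spec (bottom_floor bB1) v.
have fK1 := bottom_floor bK1; have fB := bottom_floor bB.
have [K sK] := stack_exists fK1 e2.
have eK : nb K = nt B by rewrite (stack_nb sK).
have [T sT] := stack_exists fB eK.
have sA := stack_assoc fK1 fB e2 e1 sK sT s1.
have ET : B' = T.
  by apply: (stack_spec_uniq _ _ s2 sA); rewrite ?bottom_floor // (vprod1_nb v).
subst T; split=> //; exists B, B', K; split=> //.
  by split=> //; apply: stack_bottom sK.
exact: spec_vprod1.
Qed.

(** * Smoothed diagrams as graphs on pieces *)

(* PH i c and PV i c are pieces of the i-th horizontal and of the c-th vertical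
   segment; PD and PB are extra isolated vertices, used as images of components
   that disappear when the lattice is reduced. *)
Inductive lp := PH of nat & nat | PV of nat & nat | PD of nat | PB of nat.

Definition valid m n (u : lp) : bool :=
  match u with
  | PH i c => (i < m) && (c <= n)
  | PV i c => (i <= m) && (c < n)
  | _ => false
  end.

(** Signs form a function on all pairs of numbers, so lattices of different sizes share it without
    casts. Each smoothing arc is listed in one direction; [eqv] closes up. *)
Inductive edge m n (s : nat -> nat -> bool) : lp -> lp -> Prop :=
| EdgeTR i j of i < m & j < n & s i j : edge m n s (PV i j) (PH i j.+1)
| EdgeLB i j of i < m & j < n & s i j : edge m n s (PH i j) (PV i.+1 j)
| EdgeTL i j of i < m & j < n & ~~ s i j : edge m n s (PV i j) (PH i j)
| EdgeRB i j of i < m & j < n & ~~ s i j : edge m n s (PH i j.+1) (PV i.+1 j).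

Definition eqv m n s := clos_refl_sym_trans lp (edge m n s).

Lemma eqv_refl m n s u : eqv m n s u u. Proof. exact: rst_refl. Qed.
Lemma eqv_sym m n s u v : eqv m n s u v -> eqv m n s v u.
Proof. exact: rst_sym. Qed.
Lemma eqv_trans m n s u v w : eqv m n s u v -> eqv m n s v w -> eqv m n s u w.
Proof. by move=> h1 h2; apply: rst_trans h1 h2. Qed.
Lemma eqv_edge m n s u v : edge m n s u v -> eqv m n s u v.
Proof. by move=> h; apply: rst_step. Qed.

Lemma eqv_map m n s m' n' s' (f : lp -> lp) :
  (forall u v, edge m n s u v -> eqv m' n' s' (f u) (f v)) ->
  forall u v, eqv m n s u v -> eqv m' n' s' (f u) (f v).
Proof.
move=> H u v; elim=> {u v} [u v /H //|u|u v _ IH|u v w _ IH1 _ IH2].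
- exact: eqv_refl.
- exact: eqv_sym.
- exact: eqv_trans IH1 IH2.
Qed.

Lemma eqv_invariant m n s (P : lp -> bool) :
  (forall u v, edge m n s u v -> P u = P v) ->
  forall u v, eqv m n s u v -> P u = P v.
Proof. by move=> H u v; elim=> // *; congruence. Qed.

Definition bp m n (l : lab) : lp :=
  match l with LT j => PV 0 j | LB j => PV m j | LL i => PH i 0 | LR i => PH i n end.

Section Bridge.
Variables m n : nat.

Definition pl (u : piece m n) : lp :=
  match u with inl (i, c) => PH i c | inr (i, c) => PV i c end.

Lemma pl_inj : injective pl.
Proof.
by move=> [[i c]|[i c]] [[j d]|[j d]] //= [] /val_inj -> /val_inj ->.
Qed.

Lemma pl_valid u : valid m n (pl u).
Proof.
case: u => -[i c] /=; rewrite ?(ltn_ord i) ?(ltn_ord c) ?andbT //=.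
  by rewrite -ltnS ltn_ord.
by rewrite -ltnS ltn_ord.
Qed.

Lemma valid_pl u : valid m n u -> exists v, pl v = u.
Proof.
case: u => //= i c /andP [hi hc].
  by exists (inl (Ordinal hi, Ordinal (hc : c < n.+1))).
by exists (inr (Ordinal (hi : i < m.+1), Ordinal hc)).
Qed.

Definition sN (s : kstate m n) (i j : nat) : bool :=
  match insub i, insub j with
  | Some i', Some j' => s (i', j') | _, _ => false end.

Lemma sNE (s : kstate m n) (i : 'I_m) (j : 'I_n) : sN s i j = s (i, j).
Proof. by rewrite /sN !valK. Qed.

Lemma edge_valid s u v : edge m n s u v -> valid m n u /\ valid m n v.
Proof. by case=> i j hi hj _ /=; split; rewrite ?hi ?hj //= ltnW. Qed.

Lemma smoothing_edge (s : kstate m n) u v :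
  smoothing s u v <-> edge m n (sN s) (pl u) (pl v) \/ edge m n (sN s) (pl v) (pl u).
Proof.
have J x y a b : joins x y a b -> (a = x /\ b = y) \/ (a = y /\ b = x).
  by move=> /orP [] /andP [/eqP -> /eqP ->]; [left | right].
have J1 x y : joins x y x y by rewrite /joins !eqxx.
have J2 x y : joins x y y x by rewrite /joins !eqxx orbT.
split.
  case/existsP => -[i j] /=; rewrite -sNE.
  have hi := ltn_ord i; have hj := ltn_ord j.
  case h: (sN s i j) => /orP [] /J [] [-> ->] /=; rewrite /bump /= ?add1n ?add0n.
  + by left; apply: EdgeTR.
  + by right; apply: EdgeTR.
  + by left; apply: EdgeLB.
  + by right; apply: EdgeLB.
  + by left; apply: EdgeTL; rewrite ?h.
  + by right; apply: EdgeTL; rewrite ?h.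
  + by left; apply: EdgeRB; rewrite ?h.
  + by right; apply: EdgeRB; rewrite ?h.
have K a b x y : edge m n (sN s) x y -> (pl a = x /\ pl b = y) \/ (pl b = x /\ pl a = y) ->
    smoothing s a b.
  move=> e H; apply/existsP.
  have : exists c : 'I_m * 'I_n, exists xx yy, [/\ pl xx = x, pl yy = y &
     forall a b, (a = xx /\ b = yy) \/ (b = xx /\ a = yy) ->
     if s c then joins (top_end c) (right_end c) a b || joins (left_end c) (bot_end c) a b
     else joins (top_end c) (left_end c) a b || joins (right_end c) (bot_end c) a b].
    case: e => i j hi hj h; exists (Ordinal hi, Ordinal hj);
      rewrite -sNE /= ?h ?(negbTE h).
    - exists (top_end (Ordinal hi, Ordinal hj)), (right_end (Ordinal hi, Ordinal hj)).
      by split=> // a1 b1 [] [-> ->]; rewrite ?J1 ?J2.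
    - exists (left_end (Ordinal hi, Ordinal hj)), (bot_end (Ordinal hi, Ordinal hj)).
      by split=> // a1 b1 [] [-> ->]; rewrite ?J1 ?J2 ?orbT.
    - exists (top_end (Ordinal hi, Ordinal hj)), (left_end (Ordinal hi, Ordinal hj)).
      by split=> // a1 b1 [] [-> ->]; rewrite ?J1 ?J2.
    - exists (right_end (Ordinal hi, Ordinal hj)), (bot_end (Ordinal hi, Ordinal hj)).
      by split=> // a1 b1 [] [-> ->]; rewrite ?J1 ?J2 ?orbT.
  move=> [c [xx [yy [ex ey Hc]]]]; exists c; apply: Hc.
  by case: H => -[h1 h2]; [left | right]; split; apply: pl_inj; congruence.
by case=> e; apply: K e _; [left | right].
Qed.

Lemma smoothing_sym (s : kstate m n) : connect_sym (smoothing s).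
Proof.
apply: sym_connect_sym => u v; apply/idP/idP => /smoothing_edge h;
  apply/smoothing_edge; tauto.
Qed.

Lemma connect_eqv (s : kstate m n) u v :
  connect (smoothing s) u v <-> eqv m n (sN s) (pl u) (pl v).
Proof.
split.
  case/connectP => p; elim: p u => [|w p IH] u /=; first by move=> _ ->; apply: eqv_refl.
  case/andP => /smoothing_edge h /IH IHp /IHp; apply: eqv_trans.
  by case: h => h; [|apply: eqv_sym]; apply: eqv_edge.
(* A label outside the lattice is related to itself only, so a chain between two pieces stays among
   pieces. *)
have K x y : eqv m n (sN s) x y ->
    x = y \/ exists a b, [/\ pl a = x, pl b = y & connect (smoothing s) a b].
  elim=> {x y} [x y h|x|x y _ [->|[a [b [<- <- h]]]]|x y z _ [->|[a [b [<- <- h]]]] _].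
  - have [/valid_pl [a ea] /valid_pl [b eb]] := edge_valid h.
    right; exists a, b; split=> //; apply: connect1; apply/smoothing_edge.
    by rewrite ea eb; left.
  - by left.
  - by left.
  - by right; exists b, a; rewrite smoothing_sym.
  - by [].
  - case=> [<-|[c [d [/pl_inj e <- h']]]]; first by right; exists a, b.
    by right; exists a, d; split=> //; apply: connect_trans h _; rewrite -e.
by case/K => [/pl_inj ->|[a [b [/pl_inj -> /pl_inj ->]]]].
Qed.

Lemma pl_boundary p : pl (boundary_piece p) = bp m n (lab_of p).
Proof. by case: p => [] [] i. Qed.

End Bridge.

Definition realized m n (s : nat -> nat -> bool) (C : conn) : Prop :=
  forall l l', cdom C l -> cdom C l' ->
    cm C l = l' <-> l <> l' /\ eqv m n s (bp m n l) (bp m n l').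

Lemma realizesP m n (s : kstate m n) (T : crossingless m n n) :
  reflect (realized m n (sN s) (Conn T)) (realizes s T).
Proof.
have E p q : (T p == q) = (cm (Conn T) (lab_of p) == lab_of q).
  rewrite (@cmE (Conn T)) /=; apply/eqP/eqP => [-> //|/lab_of_inj //].
apply: (iffP forallP) => [H l l' /dom_lab_of [p <-] /dom_lab_of [q <-]|H p].
  have /forallP/(_ q)/eqP := H p; rewrite E -!pl_boundary => h.
  split=> [/eqP|[n1 /connect_eqv h1]].
    rewrite h => /andP [n1 /connect_eqv h2]; split=> // /lab_of_inj e.
    by rewrite e eqxx in n1.
  by apply/eqP; rewrite h h1 andbT; apply/eqP => e; rewrite e in n1.
apply/forallP => q; apply/eqP; rewrite E.
have := H _ _ (lab_of_dom p) (lab_of_dom q); rewrite -!pl_boundary => -[h1 h2].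
apply/eqP/andP => [/h1 [n1 /connect_eqv]|[n1 h]].
  by split=> //; apply/eqP => e; rewrite e in n1.
apply: h2; split; last by apply/connect_eqv.
by move=> /lab_of_inj e; rewrite e eqxx in n1.
Qed.

Lemma Conn_inj m a b : injective (@Conn m a b).
Proof.
move=> f g e; apply/val_inj/ffunP => p; apply: lab_of_inj.
have := congr1 (fun C => cm C (@lab_of m a b p)) e.
by rewrite (@cmE (Conn f)) (@cmE (Conn g)).
Qed.

Lemma catalan_ofE m n (s : kstate m n) (T : crossingless m n n) :
  (catalan_of s == Some (Conn T)) = realizes s T.
Proof.
have U T1 T2 : realizes s T1 -> realizes s T2 -> T1 = T2.
  move=> h h'; apply/val_inj/ffunP => p; apply/esym/eqP.
  by rewrite (eqP (forallP (forallP h' p) _)) -(eqP (forallP (forallP h p) _)).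
rewrite /catalan_of; case: pickP => [T1 h1|h] /=; last by rewrite h.
apply/eqP/idP => [/Some_inj /Conn_inj <- //|h]; by rewrite (U _ _ h1 h).
Qed.

Lemma coeffE m n (T : crossingless m n n) :
  coeff (Conn T) = (\sum_(s : kstate m n | realizes s T) state_weight s)%R.
Proof. by apply: eq_bigl => s; rewrite catalan_ofE. Qed.

Definition closed_piece m n (s : nat -> nat -> bool) (u : lp) : Prop :=
  valid m n u /\ forall l, dom m n n l -> ~ eqv m n s (bp m n l) u.

Definition closed_pred m n (s : kstate m n) : pred (piece m n) :=
  [pred u | ~~ [exists p, connect (smoothing s) (boundary_piece p) u]].

Lemma closed_predP m n (s : kstate m n) u :
  reflect (closed_piece m n (sN s) (pl u)) (closed_pred s u).
Proof.
apply: (iffP negP) => [H|[_ H] /existsP [p /connect_eqv]]; last first.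
  by rewrite pl_boundary; apply: H; apply: lab_of_dom.
split; first exact: pl_valid.
move=> l /dom_lab_of [p <-] h; apply: H; apply/existsP; exists p; apply/connect_eqv.
by rewrite pl_boundary.
Qed.

Lemma closed_pred_closed m n (s : kstate m n) : closed (smoothing s) (closed_pred s).
Proof.
apply: intro_closed; first exact: smoothing_sym.
move=> u v h /negP H; apply/negP => /existsP [p hp]; apply: H; apply/existsP; exists p.
by apply: connect_trans hp _; rewrite smoothing_sym; apply: connect1.
Qed.

(** Sending a component of A' to the component of a related element of A is injective. A relation is
    asked for and not a map: a piece may have to be replaced by another one of its component, and
    one map on pieces can then serve in both directions. *)
Lemma n_comp_le (T T' : finType) (e : rel T) (e' : rel T') (A : {pred T}) (A' : {pred T'})
    (r : T' -> T -> Prop) :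
  connect_sym e -> connect_sym e' -> closed e A ->
  (forall x, x \in A' -> exists2 u, u \in A & r x u) ->
  (forall x y u v, r x u -> r y v -> connect e u v -> connect e' x y) ->
  n_comp e' A' <= n_comp e A.
Proof.
move=> se se' cA H1 H2.
have [g hg] : exists g : T' -> option T, forall x, x \in A' ->
    if g x is Some u then u \in A /\ r x u else False.
  apply: (@fin_all_exists _ (fun=> option T) (fun x o => x \in A' ->
    if o is Some u then u \in A /\ r x u else False)) => x.
  case: (boolP (x \in A')) => [/H1 [u hu ru]|]; by [exists (Some u) | exists None].
pose f (x : T') : option T := omap (fingraph.root e) (g x).
rewrite /n_comp_mem /=.
have finj : {in predI (roots e') A' &, injective f}.
  move=> x y /andP [rx Ax] /andP [ry Ay]; have := hg x Ax; have := hg y Ay; rewrite /f.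
  case: (g x) (g y) => [u|] // [v|] //= [_ rv] [_ ru] [/eqP].
  rewrite root_connect // => /(H2 _ _ _ _ ru rv); rewrite -root_connect //.
  by move: rx ry => /eqP -> /eqP -> /eqP.
rewrite -(card_in_imset finj) -[leqRHS](card_imset _ (@Some_inj _)); apply: subset_leq_card.
apply/subsetP => o /imsetP [x /andP [_ Ax] ->]; have := hg x Ax; rewrite /f.
case: (g x) => //= u [Au _]; apply/imsetP; exists (fingraph.root e u) => //.
apply/andP; split; first exact: roots_root.
by move: Au; rewrite (closed_connect cA (connect_root e u)).
Qed.

(** * Sliding a return through a row *)

Section InLoop.
Variables i k : nat.

(** The four pieces around the face between rows i, i+1 and columns k, k+1. They form a closed curve
    when row i has the signs - + there and row i+1 the signs + -. *)
Definition in_loop (u : lp) : bool :=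
  match u with
  | PH a c => (c == k.+1) && ((a == i) || (a == i.+1))
  | PV a c => (a == i.+1) && ((c == k) || (c == k.+1))
  | _ => false
  end.

Definition beside_loop a b := ((a == i) || (a == i.+1)) && ((b == k) || (b == k.+1)).

Lemma beside_loopP a b : beside_loop a b ->
  [\/ a = i /\ b = k, a = i /\ b = k.+1, a = i.+1 /\ b = k | a = i.+1 /\ b = k.+1].
Proof.
by case/andP => /orP [] /eqP -> /orP [] /eqP ->;
  [constructor 1 | constructor 2 | constructor 3 | constructor 4].
Qed.

Lemma beside_loopN a b : ~~ beside_loop a b ->
  [/\ in_loop (PV a b) = false, in_loop (PH a b) = false,
      in_loop (PH a b.+1) = false & in_loop (PV a.+1 b) = false].
Proof. by rewrite /beside_loop => h; split; rewrite /=; lia. Qed.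

Lemma beside_loopNrow a b : ~~ beside_loop a b ->
  ~~ ((a == i.+1) && ((b == k) || (b == k.+1))).
Proof. rewrite /beside_loop; lia. Qed.

Lemma in_loopE :
  ((in_loop (PV i k) = false) * (in_loop (PV i k.+1) = false) *
   (in_loop (PH i k) = false) * (in_loop (PH i k.+1) = true) *
   (in_loop (PH i k.+2) = false) * (in_loop (PV i.+1 k) = true) *
   (in_loop (PV i.+1 k.+1) = true) * (in_loop (PH i.+1 k) = false) *
   (in_loop (PH i.+1 k.+1) = true) * (in_loop (PH i.+1 k.+2) = false) *
   (in_loop (PV i.+2 k) = false) * (in_loop (PV i.+2 k.+1) = false))%type.
Proof. do ![split]; rewrite /=; lia. Qed.

Lemma bp_in_loop m n l : i.+1 < m -> k.+1 < n -> dom m n n l ->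
  in_loop (bp m n l) = false.
Proof. by move=> ? ?; case: l => j /= ?; lia. Qed.

End InLoop.

Section SlideGraph.
Variables (m n i k : nat) (s s3 : nat -> nat -> bool).
Hypotheses (hi : i.+1 < m) (hk : k.+1 < n).
Notation in_loop := (in_loop i k).
Notation special := (beside_loop i k).
Let hi' : i < m := ltnW hi.
Let hk' : k < n := ltnW hk.

Hypotheses (s_k : s i k = false) (s_k1 : s i k.+1 = true).
Hypothesis agree : forall a b, ~~ ((a == i.+1) && ((b == k) || (b == k.+1))) ->
  s a b = s3 a b.
Hypotheses (s3_k : s3 i.+1 k = true) (s3_k1 : s3 i.+1 k.+1 = false).

Let row_i b : ~~ ((i == i.+1) && ((b == k) || (b == k.+1))).
Proof. by rewrite (ltn_eqF (ltnSn i)). Qed.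
Let s3i_k : s3 i k = false.
Proof. by rewrite -agree. Qed.
Let s3i_k1 : s3 i k.+1 = true.
Proof. by rewrite -agree. Qed.

Lemma in_loop_step u v : edge m n s3 u v -> in_loop u = in_loop v.
Proof.
case=> a b ha hb h; case: (boolP (special a b)) => [/beside_loopP []|/beside_loopN []].
all: try by move=> E1 E2 E3 E4; rewrite ?E1 ?E2 ?E3 ?E4.
all: case=> ea eb; subst a b; rewrite ?s3_k ?s3_k1 ?s3i_k ?s3i_k1 in h; by rewrite ?in_loopE.
Qed.

Let e1 : eqv m n s3 (PH i k.+1) (PV i.+1 k).
Proof. by apply/eqv_edge/EdgeRB; rewrite ?s3i_k //. Qed.
Let e2 : eqv m n s3 (PH i k.+1) (PV i.+1 k.+1).
Proof. by apply/eqv_edge/EdgeLB; rewrite ?s3i_k1 //. Qed.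
Let e3 : eqv m n s3 (PV i.+1 k) (PH i.+1 k.+1).
Proof. by apply/eqv_edge/EdgeTR; rewrite ?s3_k //. Qed.

Lemma in_loop_class u : in_loop u -> eqv m n s3 (PV i.+1 k) u.
Proof.
case: u => //= a b /andP [/eqP ->] /orP [] /eqP ->.
- exact: eqv_sym.
- exact: e3.
- exact: eqv_refl.
- exact: eqv_trans (eqv_sym e1) e2.
Qed.

Let f1 : eqv m n s (PH i k.+1) (PV i.+1 k).
Proof. by apply/eqv_edge/EdgeRB; rewrite ?s_k //. Qed.
Let f2 : eqv m n s (PH i k.+1) (PV i.+1 k.+1).
Proof. by apply/eqv_edge/EdgeLB; rewrite ?s_k1 //. Qed.

(** In s the pieces around the face lie on a strand through the piece p outside it. Contracting them
    to p gives the connectivity of [s3] away from the face, where they have become a closed curve of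
    their own. *)
Record slide_rel (p : lp) : Prop := SlideRel {
  slide_valid : valid m n p;
  slide_out : in_loop p = false;
  slide_in : forall u, in_loop u -> eqv m n s u p;
  slide_eqv : forall u v, in_loop u = false -> in_loop v = false ->
    (eqv m n s u v <-> eqv m n s3 u v) }.

Let mk_slide p : valid m n p -> in_loop p = false ->
  (forall u, in_loop u -> eqv m n s u p) ->
  (forall u v, edge m n s u v ->
     eqv m n s3 (if in_loop u then p else u) (if in_loop v then p else v)) ->
  (forall u v, edge m n s3 u v -> in_loop u = false -> eqv m n s u v) ->
  slide_rel p.
Proof.
move=> vp op ip H1 H2; split=> // u v ou ov; split=> h.
  have /= := @eqv_map _ _ s _ _ s3 (fun u => if in_loop u then p else u) H1 _ _ h.
  by rewrite ou ov.
have /= := @eqv_map _ _ s3 _ _ s (fun u => if in_loop u then p else u) _ _ _ h.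
rewrite ou ov; apply=> x y exy; have := in_loop_step exy.
case ox: (in_loop x) => <-; first exact: eqv_refl.
exact: H2.
Qed.

(** With + + the strand through the face joins the pieces below and to the right of the crossing
    (i+1, k+1), which the sign - of [s3] at this crossing does directly. *)
Lemma slide_pp : s i.+1 k = true -> s i.+1 k.+1 = true -> slide_rel (PV i.+2 k.+1).
Proof.
move=> h1 h2.
have f3 : eqv m n s (PV i.+1 k) (PH i.+1 k.+1).
  by apply/eqv_edge/EdgeTR; rewrite ?h1 //.
have f4 : eqv m n s (PH i.+1 k.+1) (PV i.+2 k.+1).
  by apply/eqv_edge/EdgeLB; rewrite ?h2 //.
have f5 : eqv m n s (PV i.+1 k.+1) (PH i.+1 k.+2).
  by apply/eqv_edge/EdgeTR; rewrite ?h2 //.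
have g1 := eqv_trans f3 f4; have g2 := eqv_trans f1 g1.
have g3 := eqv_trans (eqv_sym f2) g2.
apply: mk_slide.
- by rewrite /= hi hk.
- by rewrite in_loopE.
- by case=> //= a b /andP [/eqP ->] /orP [] /eqP ->.
{ move=> u v [] a b ha hb h;
    case: (boolP (special a b)) => [/beside_loopP []|hs].
  all: try by (have [E1 E2 E3 E4] := beside_loopN hs; rewrite ?E1 ?E2 ?E3 ?E4;
    apply: eqv_edge; constructor=> //; rewrite -agree //; exact: beside_loopNrow).
  all: case=> ea eb; subst a b; rewrite ?s_k ?s_k1 ?h1 ?h2 // in h; rewrite ?in_loopE;
    try exact: eqv_refl.
  all: try by apply: eqv_edge; constructor; rewrite ?s3_k ?s3_k1 ?s3i_k ?s3i_k1.
  by apply/eqv_sym/eqv_edge; constructor; rewrite ?s3_k1. }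
{ move=> u v [] a b ha hb h;
    case: (boolP (special a b)) => [/beside_loopP []|hs].
  all: try by (move=> _; apply: eqv_edge; constructor=> //;
    rewrite agree //; exact: beside_loopNrow).
  all: case=> ea eb; subst a b; rewrite ?s3_k ?s3_k1 ?s3i_k ?s3i_k1 // in h; rewrite ?in_loopE //.
  all: try by move=> _; apply: eqv_edge; constructor; rewrite ?s_k ?s_k1 ?h1.
  by move=> _; exact: eqv_trans (eqv_sym f5) g3. }
Qed.

(** Mirror image of + +: the strand joins the pieces to the left of and below the crossing (i+1, k),
    which the sign + of [s3] does directly. *)
Lemma slide_mm : s i.+1 k = false -> s i.+1 k.+1 = false -> slide_rel (PH i.+1 k).
Proof.
move=> h1 h2.
have f3 : eqv m n s (PV i.+1 k) (PH i.+1 k).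
  by apply/eqv_edge/EdgeTL; rewrite ?h1 //.
have f4 : eqv m n s (PH i.+1 k.+1) (PV i.+2 k).
  by apply/eqv_edge/EdgeRB; rewrite ?h1 //.
have f5 : eqv m n s (PV i.+1 k.+1) (PH i.+1 k.+1).
  by apply/eqv_edge/EdgeTL; rewrite ?h2 //.
have g2 := eqv_trans f1 f3.
have g3 := eqv_trans (eqv_sym f2) g2.
have g4 := eqv_trans (eqv_sym f5) g3.
apply: mk_slide.
- by rewrite /= hi ltnW // ltnW.
- by rewrite in_loopE.
- by case=> //= a b /andP [/eqP ->] /orP [] /eqP ->.
{ move=> u v [] a b ha hb h;
    case: (boolP (special a b)) => [/beside_loopP []|hs].
  all: try by (have [E1 E2 E3 E4] := beside_loopN hs; rewrite ?E1 ?E2 ?E3 ?E4;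
    apply: eqv_edge; constructor=> //; rewrite -agree //; exact: beside_loopNrow).
  all: case=> ea eb; subst a b; rewrite ?s_k ?s_k1 ?h1 ?h2 // in h; rewrite ?in_loopE;
    try exact: eqv_refl.
  all: try by apply: eqv_edge; constructor; rewrite ?s3_k ?s3_k1 ?s3i_k ?s3i_k1. }
{ move=> u v [] a b ha hb h;
    case: (boolP (special a b)) => [/beside_loopP []|hs].
  all: try by (move=> _; apply: eqv_edge; constructor=> //;
    rewrite agree //; exact: beside_loopNrow).
  all: case=> ea eb; subst a b; rewrite ?s3_k ?s3_k1 ?s3i_k ?s3i_k1 // in h; rewrite ?in_loopE //.
  all: try by move=> _; apply: eqv_edge; constructor; rewrite ?s_k ?s_k1 ?h2.
  by move=> _; exact: eqv_trans (eqv_sym g4) f4. }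
Qed.

End SlideGraph.

Lemma realized_slide m n i k s s3 p (C : conn) : i.+1 < m -> k.+1 < n ->
  ht C = m -> nt C = n -> nb C = n ->
  slide_rel m n i k s s3 p -> realized m n s C <-> realized m n s3 C.
Proof.
move=> hi hk e1 e2 e3 sr.
have E l l' : cdom C l -> cdom C l' ->
    eqv m n s (bp m n l) (bp m n l') <-> eqv m n s3 (bp m n l) (bp m n l').
  by rewrite e1 e2 e3 => d d'; apply: (slide_eqv sr); apply: bp_in_loop.
by split=> H l l' d d'; rewrite H // E.
Qed.

(** The curve around the face is one closed component of [s3]. The others match those of s, a piece
    on the face being replaced by p. *)
Lemma n_closed_slide m n (i k : nat) (s s3 : kstate m n) p : i.+1 < m -> k.+1 < n ->
  slide_rel m n i k (sN s) (sN s3) p ->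
  (forall u v, edge m n (sN s3) u v -> in_loop i k u = in_loop i k v) ->
  (forall u, in_loop i k u -> eqv m n (sN s3) (PV i.+1 k) u) ->
  n_closed s3 = (n_closed s).+1.
Proof.
move=> hi hk sr st cl.
have [x0 ex0] : exists x0 : piece m n, pl x0 = PV i.+1 k.
  by apply: valid_pl => /=; rewrite (ltnW hi) (ltnW hk).
have [q eq] := valid_pl (slide_valid sr).
have l0 : in_loop i k (PV i.+1 k) by rewrite /= !eqxx.
pose D := connect (smoothing s3) x0.
have DE u : D u = in_loop i k (pl u).
  apply/idP/idP => [/connect_eqv h|/cl h].
    by rewrite -(eqv_invariant st h) ex0.
  by apply/connect_eqv; rewrite ex0.
rewrite /n_closed -/(closed_pred s3) -/(closed_pred s).
have cD : closed (smoothing s3) D.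
  by move=> u v h; rewrite -!topredE /= /D;
     apply: (same_connect_r (@smoothing_sym _ _ s3)); apply: connect1.
have cA := @closed_pred_closed _ _ s3.
have -> : n_comp (smoothing s3) (closed_pred s3) =
    n_comp (smoothing s3) D + n_comp (smoothing s3) [predD closed_pred s3 & D].
  rewrite /n_comp_mem -(cardID D (predI _ (mem (closed_pred s3)))); congr (_ + _).
    apply: eq_card => u; rewrite !inE /= -andbA; congr (_ && _).
    case: (boolP (D u)) => hD; rewrite ?andbF // andbT; apply/(@closed_predP _ _ s3 u); split.
      exact: pl_valid.
    move=> l dl /(eqv_invariant st); rewrite bp_in_loop // -DE; by rewrite (hD : D u).
  apply: eq_card => u; rewrite !inE /=; by rewrite andbCA.
rewrite (n_comp_connect (@smoothing_sym _ _ s3)) add1n; congr _.+1.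
have outE u v : in_loop i k u = false -> in_loop i k v = false ->
   eqv m n (sN s3) u v <-> eqv m n (sN s) u v.
  by move=> hu hv; rewrite (slide_eqv sr).
have bo l : dom m n n l -> in_loop i k (bp m n l) = false by apply: bp_in_loop.
apply/eqP; rewrite eqn_leq; apply/andP; split.
  apply: (n_comp_le (r := fun u' u => u' = u /\ in_loop i k (pl u') = false)).
  - exact: smoothing_sym.
  - exact: smoothing_sym.
  - exact: closed_pred_closed.
  - move=> x; rewrite !inE => /andP [nD /(@closed_predP _ _ s3 x) [vx cx]].
    have {}nD : in_loop i k (pl x) = false by rewrite -DE; apply: negbTE.
    exists x => //; apply/(@closed_predP _ _ s x); split=> // l dl h; apply: (cx l dl).
    by apply/outE => //; apply: bo.
  - move=> x y u v [<- hx] [<- hy] /connect_eqv h; apply/connect_eqv.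
    exact/outE.
apply: (n_comp_le (r := fun u u' => eqv m n (sN s) (pl u) (pl u') /\ in_loop i k (pl u') = false)).
- exact: smoothing_sym.
- exact: smoothing_sym.
- by move=> u v h; have := cD u v h; have := cA u v h; rewrite !inE => -> ->.
- move=> u /(@closed_predP _ _ s u) [vu cu].
  have [u' [hu ou]] : exists u' : piece m n,
      eqv m n (sN s) (pl u) (pl u') /\ in_loop i k (pl u') = false.
    case ou: (in_loop i k (pl u)); last by exists u; split=> //; apply: eqv_refl.
    by exists q; rewrite eq; split; [apply: (slide_in sr) | apply: (slide_out sr)].
  exists u'; last by split.
  rewrite !inE; apply/andP; split; first by rewrite DE ou.
  apply/(@closed_predP _ _ s3 u'); split.
    exact: pl_valid.
  move=> l dl /outE h; apply: (cu l dl); apply: eqv_trans (h _ ou) (eqv_sym hu).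
  exact: bo.
- move=> u v u' v' [hu ou] [hv ov] /connect_eqv /outE h; apply/connect_eqv.
  exact: eqv_trans hu (eqv_trans (h ou ov) (eqv_sym hv)).
Qed.

Local Open Scope ring_scope.

Lemma varA_neq0 : varA != 0.
Proof. by rewrite /varA tofrac_eq0 polyX_eq0. Qed.

Definition loop_value : QA := - varA ^+ 2 - varA ^- 2.

Definition sgn_of (b : bool) : int := if b then 1 else -1.

Lemma state_weightE m n (s : kstate m n) :
  state_weight s = varA ^ (\sum_c sgn_of (s c)) * loop_value ^+ n_closed s.
Proof.
rewrite /state_weight; congr (varA ^ _ * _).
rewrite (bigID (fun c => s c)) /=; congr (_ + _).
  rewrite (eq_bigr (fun=> 1)); last by move=> c h; rewrite /sgn_of h.
  by rewrite -natz /n_plus -sumr_const; apply: eq_bigl => c; rewrite inE.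
rewrite (eq_bigr (fun=> -1)); last by move=> c /negbTE h; rewrite /sgn_of h.
rewrite sumrN; congr (- _); rewrite -natz /n_minus -sumr_const.
by apply: eq_bigl => c; rewrite inE.
Qed.

(** * Cancellation inside the state sum *)

Section SlideSum.
Variables m n i k : nat.
Hypotheses (hi : (i.+1 < m)%N) (hk : (k.+1 < n)%N).

Let r0 : 'I_m := Ordinal (ltnW hi).
Let r1 : 'I_m := Ordinal hi.
Let c0 : 'I_n := Ordinal (ltnW hk).
Let c1 : 'I_n := Ordinal hk.

Definition set_pair (s : kstate m n) (x y : bool) : kstate m n :=
  [ffun c => if c == (r1, c0) then x else if c == (r1, c1) then y else s c].

Let c01 : ((r1, c1) == (r1, c0)) = false.
Proof. by rewrite xpair_eqE eqxx /= -val_eqE /= eqn_leq ltnn. Qed.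

Lemma set_pair_set s x y x' y' : set_pair (set_pair s x y) x' y' = set_pair s x' y'.
Proof. by apply/ffunP => c; rewrite !ffunE; case: eqP => //; case: eqP. Qed.

Lemma set_pair_id s : set_pair s (s (r1, c0)) (s (r1, c1)) = s.
Proof. by apply/ffunP => c; rewrite !ffunE; case: eqP => [->|_] //; case: eqP => [->|]. Qed.

Lemma set_pair_fst s x y : set_pair s x y (r1, c0) = x.
Proof. by rewrite ffunE eqxx. Qed.

Lemma set_pair_snd s x y : set_pair s x y (r1, c1) = y.
Proof. by rewrite ffunE c01 eqxx. Qed.

Lemma set_pair_out s x y (a b : nat) : ~~ ((a == i.+1) && ((b == k) || (b == k.+1))) ->
  sN (set_pair s x y) a b = sN s a b.
Proof.
rewrite /sN => h; case: insubP => // a' _ ea; case: insubP => // b' _ eb.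
rewrite ffunE !xpair_eqE -!val_eqE /= ea eb; move: h.
by case: (a == i.+1) => //=; case: (b == k) => //=; case: (b == k.+1).
Qed.

Definition prior (s : kstate m n) := ~~ s (r0, c0) && s (r0, c1).

Lemma slide_pair s x : prior s ->
  exists p, slide_rel m n i k (sN (set_pair s x x)) (sN (set_pair s true false)) p.
Proof.
move=> /andP [p0 p1].
have out x' y' b : sN (set_pair s x' y') i b = sN s i b.
  by rewrite set_pair_out // (ltn_eqF (ltnSn i)).
have q0 : sN s i k = false by rewrite -[i]/(val r0) -[k]/(val c0) sNE (negbTE p0).
have q1 : sN s i k.+1 = true by rewrite -[i]/(val r0) -[k.+1]/(val c1) sNE p1.
have v0 x' y' : sN (set_pair s x' y') i.+1 k = x'.
  by rewrite -[i.+1]/(val r1) -[k]/(val c0) sNE set_pair_fst.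
have v1 x' y' : sN (set_pair s x' y') i.+1 k.+1 = y'.
  by rewrite -[i.+1]/(val r1) -[k.+1]/(val c1) sNE set_pair_snd.
case: x.
  exists (PV i.+2 k.+1); apply: slide_pp => //; rewrite ?out //.
  by move=> a b h; rewrite !set_pair_out.
exists (PH i.+1 k); apply: slide_mm => //; rewrite ?out //.
by move=> a b h; rewrite !set_pair_out.
Qed.

Lemma set_pair_step s u v : prior s -> edge m n (sN (set_pair s true false)) u v ->
  in_loop i k u = in_loop i k v.
Proof.
move=> ps; have /andP [p0 p1] := ps.
apply: (@in_loop_step m n i k (sN (set_pair s true false))) => //.
- by rewrite set_pair_out ?(ltn_eqF (ltnSn i)) // -[i]/(val r0) -[k]/(val c0) sNE (negbTE p0).
- by rewrite set_pair_out ?(ltn_eqF (ltnSn i)) // -[i]/(val r0) -[k.+1]/(val c1) sNE p1.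
- by rewrite -[i.+1]/(val r1) -[k]/(val c0) sNE set_pair_fst.
- by rewrite -[i.+1]/(val r1) -[k.+1]/(val c1) sNE set_pair_snd.
Qed.

Lemma set_pair_class s u : prior s -> in_loop i k u ->
  eqv m n (sN (set_pair s true false)) (PV i.+1 k) u.
Proof.
move=> ps; have /andP [p0 p1] := ps.
apply: (@in_loop_class m n i k (sN (set_pair s true false))) => //.
- by rewrite set_pair_out ?(ltn_eqF (ltnSn i)) // -[i]/(val r0) -[k]/(val c0) sNE (negbTE p0).
- by rewrite set_pair_out ?(ltn_eqF (ltnSn i)) // -[i]/(val r0) -[k.+1]/(val c1) sNE p1.
- by rewrite -[i.+1]/(val r1) -[k]/(val c0) sNE set_pair_fst.
Qed.

Lemma expo_set_pair s x y : \sum_c sgn_of (set_pair s x y c) =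
  sgn_of x + sgn_of y + \sum_(c | (c != (r1, c0)) && (c != (r1, c1))) sgn_of (s c).
Proof.
rewrite (bigD1 (r1, c0)) //= set_pair_fst (bigD1 (r1, c1)) /= ?c01 // set_pair_snd addrA.
congr (_ + _); apply: eq_bigr => c /andP [h1 h2].
by rewrite ffunE (negbTE h1) (negbTE h2).
Qed.

Definition summand (T : crossingless m n n) (s : kstate m n) : QA :=
  if realizes s T then state_weight s else 0.

Lemma slide_cancel T s : prior s ->
  summand T (set_pair s true true) + summand T (set_pair s false false)
  + summand T (set_pair s true false) = 0.
Proof.
move=> ps; have R x : realizes (set_pair s x x) T = realizes (set_pair s true false) T.
  have [p sr] := slide_pair x ps.
  have H := @realized_slide m n i k _ _ p (Conn T) hi hk erefl erefl erefl sr.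
  by apply/realizesP/realizesP; tauto.
have N x : n_closed (set_pair s true false) = (n_closed (set_pair s x x)).+1.
  have [p sr] := slide_pair x ps; apply: (n_closed_slide hi hk sr).
    by move=> u v; apply: set_pair_step.
  by move=> u; apply: set_pair_class.
have Rt := R true; have Rf := R false; have Nt := N true; have Nf := N false.
have et := expo_set_pair s true true; have ef := expo_set_pair s false false.
have em := expo_set_pair s true false.
move: Rt Rf Nt Nf et ef em; rewrite /summand !state_weightE.
move: (set_pair s true true) (set_pair s false false) (set_pair s true false).
move=> st sf sm Rt Rf Nt Nf et ef em.
rewrite Rt Rf; case: (realizes sm T); last by rewrite !addr0.
rewrite et ef em Nt.
have -> : n_closed sf = n_closed st by apply: succn_inj; rewrite -Nt -Nf.
set e := \sum_(c | _) _; set d := n_closed _.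
rewrite !(expfzDr _ _ varA_neq0) /sgn_of exprS.
have -> : varA ^ (1 : int) = varA by [].
have -> : varA ^ (-1 : int) = varA^-1 by [].
rewrite mulfV ?varA_neq0 // mul1r /loop_value.
set X := varA ^ e; set Y := _ ^+ d; move: X Y => X Y; rewrite !expr2 invfM; ring.
Qed.

(** Q is blind to the two signs below the return, so their four patterns occur over the same states
    elsewhere, and three of them cancel. *)
Lemma slide_sum T (Q : pred (kstate m n)) :
  (forall s x y, Q (set_pair s x y) = Q s) -> (forall s, Q s -> prior s) ->
  \sum_(s | Q s) summand T s =
  \sum_(s | Q s && (~~ s (r1, c0) && s (r1, c1))) summand T s.
Proof.
move=> Qs Qp.
(* All four patterns are parametrized by the states with the pattern - -. *)
have part x y : \sum_(s | Q s && ((s (r1, c0) == x) && (s (r1, c1) == y))) summand T s =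
    \sum_(s | Q s && ((s (r1, c0) == false) && (s (r1, c1) == false)))
      summand T (set_pair s x y).
  rewrite (reindex_onto (fun s => set_pair s x y) (fun s => set_pair s false false)) /=.
    apply: eq_bigl => s; rewrite Qs set_pair_fst set_pair_snd !eqxx !andbT set_pair_set.
    congr (_ && _); apply/eqP/andP => [<-|[/eqP e1 /eqP e2]].
      by rewrite set_pair_fst set_pair_snd.
    by rewrite -{2}(set_pair_id s) e1 e2.
  by move=> s /and3P [_ /eqP <- /eqP <-]; rewrite set_pair_set set_pair_id.
rewrite (bigID (fun s : kstate m n => s (r1, c0))) /=.
rewrite (bigID (fun s : kstate m n => s (r1, c1))) /=.
rewrite [X in _ + X](bigID (fun s : kstate m n => s (r1, c1))) /=.
have E x y : \sum_(s | Q s && ((s (r1, c0) == x) && (s (r1, c1) == y))) summand T s =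
   \sum_(s | (Q s && (if x then s (r1, c0) else ~~ s (r1, c0))) &&
             (if y then s (r1, c1) else ~~ s (r1, c1))) summand T s.
  apply: eq_bigl => s; rewrite -andbA; congr (_ && (_ && _));
  by [case: x; case: (s _) | case: y; case: (s _)].
rewrite -(E true true) -(E true false) -(E false true) -(E false false).
have -> : \sum_(s | Q s && (~~ s (r1, c0) && s (r1, c1))) summand T s =
   \sum_(s | Q s && ((s (r1, c0) == false) && (s (r1, c1) == true))) summand T s.
  by rewrite (E false true); apply: eq_bigl => s; rewrite andbA.
rewrite addrCA -[RHS]addr0; congr (_ + _).
rewrite (part true true) (part true false) (part false false) -!big_split /=.
apply: big1 => s /andP [/Qp ps _].
have cancelC (V : zmodType) (x y z : V) : x + y + z = 0 -> x + z + y = 0.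
  by rewrite addrAC.
exact: cancelC (slide_cancel T ps).
Qed.

End SlideSum.

Local Close Scope ring_scope.

(** * The first row *)

(* The signs of the crossings of the first row are e 1, ..., e n; the extra
   signs e 0 = + and e n.+1 = - make the left and the right end of the row
   behave like top points. *)
Section Words.
Variables (n : nat) (e : nat -> bool).

(** Columns are counted from 0, so column j bears the sign [e j.+1]. [bend c] says that columns c-1
    and c bear - +, and [kept j] that column j is in no such pair. [cnt] numbers the kept columns
    and [kap] inverts it; its default n stands for the right end. *)
Definition kept j := if e j.+1 then e j else ~~ e j.+2.
Definition cnt c := count kept (iota 0 c).
Definition kap i := nth n (filter kept (iota 0 n)) i.
Definition bend c := ~~ e c && e c.+1.

Lemma cntS c : cnt c.+1 = cnt c + kept c.
Proof. by rewrite /cnt -addn1 iotaD count_cat /= add0n addn0. Qed.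

Lemma cnt_le c d : c <= d -> cnt c <= cnt d.
Proof. by move/subnK <-; elim: (d - c) => //= k IH; rewrite addSn cntS; lia. Qed.

Lemma cnt_lt j : j < n -> kept j -> cnt j < cnt n.
Proof. by move=> hj kj; have := cnt_le hj; rewrite cntS kj; lia. Qed.

Lemma kap_cnt j : j < n -> kept j -> kap (cnt j) = j.
Proof.
move=> hj kj.
have E : iota 0 n = iota 0 j ++ j :: iota j.+1 (n - j.+1).
  by rewrite -{1}(subnKC hj) addSnnS iotaD.
by rewrite /kap E filter_cat /= kj nth_cat size_filter -/(cnt j) ltnn subnn.
Qed.

Lemma kapP i : i < cnt n -> [/\ kap i < n, kept (kap i) & cnt (kap i) = i].
Proof.
rewrite /cnt -size_filter => hi; have := mem_nth n hi.
rewrite mem_filter mem_iota /= => /andP [k h]; split=> //.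
have := kap_cnt h k; rewrite {1}/kap => /eqP.
rewrite nth_uniq ?filter_uniq ?iota_uniq //; first by move/eqP.
by rewrite size_filter; apply: cnt_lt.
Qed.

Lemma kap_n : kap (cnt n) = n.
Proof. by rewrite /kap nth_default // size_filter. Qed.

Lemma cnt_kap i : i <= cnt n -> cnt (kap i) = i.
Proof. by rewrite leq_eqVlt => /predU1P [->|/kapP [] //]; rewrite kap_n. Qed.

Lemma kap_lt i j : i < j -> j <= cnt n -> kap i < kap j.
Proof.
move=> ij hj; rewrite ltnNge; apply/negP => /cnt_le.
by rewrite !cnt_kap //; lia.
Qed.

Lemma kap_le i : i <= cnt n -> kap i <= n.
Proof. by rewrite leq_eqVlt => /predU1P [->|/kapP [/ltnW]] //; rewrite kap_n. Qed.

Lemma kept_bend j : kept j -> bend j = false /\ bend j.+1 = false.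
Proof. by rewrite /kept /bend; case: (e j) (e j.+1) (e j.+2) => [] [] []. Qed.

Hypotheses (e0 : e 0 = true) (en : e n.+1 = false).

Lemma bend_n : bend n = false.
Proof. by rewrite /bend en andbF. Qed.

Lemma kap_bend i : i <= cnt n -> bend (kap i) = false.
Proof.
rewrite leq_eqVlt => /predU1P [->|/kapP [_ /kept_bend []] //].
by rewrite kap_n bend_n.
Qed.

Section Graph.
Variables (m : nat) (s s2 : nat -> nat -> bool).
Hypothesis s_row : forall j, j < n -> s 0 j = e j.+1.
Hypothesis s_lost : forall i j, i < m -> j < n -> ~~ kept j -> s i.+1 j = e j.+1.
Hypothesis s_kept : forall i j, i < m -> j < n -> kept j -> s i.+1 j = s2 i (cnt j).

(** Where two lost columns bear - + in all rows, the horizontal piece between them in row i lies on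
    a detour of the strand of row i+1, which is row i of the reduced lattice. In the last row it
    lies on the bottom return, with image [PB c]. *)
Definition lost_piece i c := if i < m then PH i (cnt c) else PB c.

(** Follows the first row: + + leads down column c, - - down column c-1, + - is a return to the top
    and - + a return facing down. *)
Definition rho_row c :=
  if e c then if e c.+1 then PV 0 (cnt c) else PD c
  else if e c.+1 then lost_piece 0 c else PV 0 (cnt c.-1).

(* Where a piece of the lattice goes when the first row is absorbed into the
   boundary and the columns that are not kept are removed. *)
Definition rho (u : lp) : lp :=
  match u with
  | PH 0 c => rho_row c
  | PH i.+1 c => if bend c then lost_piece i.+1 c else PH i (cnt c)
  | PV 0 c => if e c.+1 then rho_row c.+1 else rho_row c
  | PV i.+1 c => if kept c then PV i (cnt c)
                 else lost_piece i (if e c.+1 then c else c.+1)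
  | _ => u
  end.

(** Inverse to [rho] up to components; [PD g] and [PB c] are represented by a piece of the return in
    question. *)
Definition rho_inv (u : lp) : lp :=
  match u with
  | PH i c => PH i.+1 (kap c) | PV i c => PV i.+1 (kap c)
  | PD g => PH 0 g | PB c => PH m c
  end.

Notation eqvs := (eqv m.+1 n s).
Notation eqv2 := (eqv m (cnt n) s2).

Lemma rho_edge u v : edge m.+1 n s u v -> eqv2 (rho u) (rho v).
Proof.
case=> -[|i] j hi hj h; try (rewrite s_row // in h); try (rewrite ltnS in hi);
  try (case: (boolP (kept j)) => kj;
    [ have [b1 b2] := kept_bend kj; rewrite s_kept // in h;
      have hc := cnt_lt hj kj
    | rewrite s_lost // in h ]).
- by rewrite /= h; apply: eqv_refl.
- by rewrite /= b2 kj cntS kj addn1; apply/eqv_edge/EdgeTR.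
- have b : bend j.+1 = false by rewrite /bend h.
  rewrite /= (negbTE kj) b /lost_piece hi h cntS (negbTE kj) addn0; exact: eqv_refl.
- by rewrite /= /rho_row /kept h; case: (e j); apply: eqv_refl.
- by rewrite /= b1 kj; apply/eqv_edge/EdgeLB.
- have b : bend j by move: kj; rewrite /bend /kept h andbT.
  rewrite /= (negbTE kj) b h; exact: eqv_refl.
- by rewrite /= (negbTE h); apply: eqv_refl.
- by rewrite /= b1 kj; apply/eqv_edge/EdgeTL.
- have b : bend j = false by rewrite /bend (negbTE h) andbF.
  rewrite /= (negbTE kj) b /lost_piece hi (negbTE h) cntS (negbTE kj) addn0.
  exact: eqv_refl.
- by rewrite /= /rho_row /kept (negbTE h); case: (e j.+2); apply: eqv_refl.
- by rewrite /= b2 kj cntS kj addn1; apply/eqv_edge/EdgeRB.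
- have b : bend j.+1.
    by move: kj; rewrite /bend /kept (negbTE h) negbK.
  rewrite /= (negbTE kj) b (negbTE h); exact: eqv_refl.
Qed.

Lemma lost_left j : j < n -> ~~ kept j -> ~~ e j.+1 ->
  [/\ e j.+2, j.+1 < n, kept j.+1 = false & bend j.+1].
Proof.
move=> hj; rewrite /kept /bend => + /negbTE h; rewrite h negbK => h2; split=> //.
  by rewrite ltn_neqAle hj andbT; apply/eqP => E; rewrite E en in h2.
by rewrite h2.
Qed.

Lemma s_any i j : i <= m -> j < n -> ~~ kept j -> s i j = e j.+1.
Proof. by case: i => [|i] hi hj kj; [apply: s_row | apply: s_lost]. Qed.

(** Row i+1 passes a lost pair of columns by climbing to row i and coming back, so its pieces on the
    two sides of the pair are connected. *)
Lemma chain i c : i < m -> c <= n -> bend c = false ->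
  eqvs (PH i.+1 c) (PH i.+1 (kap (cnt c))).
Proof.
move=> hi; move: {2}(n - c) (leqnn (n - c)) => d; elim: d c => [|d IH] c hd hc hb.
  by have -> : c = n by [lia]; rewrite kap_n; apply: eqv_refl.
move: (hc); rewrite leq_eqVlt => /predU1P [->|hcn].
  by rewrite kap_n; apply: eqv_refl.
case: (boolP (kept c)) => kc; first by rewrite kap_cnt //; apply: eqv_refl.
have ec : ~~ e c.+1.
  by apply/negP => h; move: kc hb; rewrite /kept /bend h andbT => /negbTE ->.
have [h2 hc1 kc1 b1] := lost_left hcn kc ec.
have E : cnt c.+2 = cnt c by rewrite !cntS kc1 (negbTE kc) !addn0.
have hi' : i <= m := ltnW hi.
have sc k : k <= m -> s k c = false.
  by move=> hk; rewrite s_any // (negbTE ec).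
have sc1 k : k <= m -> s k c.+1 = true by move=> hk; rewrite s_any // kc1.
apply: (eqv_trans (v := PV i.+1 c)).
  by apply/eqv_sym/eqv_edge/EdgeTL; rewrite ?sc.
apply: (eqv_trans (v := PH i c.+1)).
  by apply/eqv_sym/eqv_edge/EdgeRB; rewrite ?sc.
apply: (eqv_trans (v := PV i.+1 c.+1)).
  by apply/eqv_edge/EdgeLB; rewrite ?sc1.
apply: (eqv_trans (v := PH i.+1 c.+2)).
  by apply/eqv_edge/EdgeTR; rewrite ?sc1.
rewrite -E; apply: IH => //; first by lia.
by rewrite /bend h2.
Qed.

Lemma lost_rho i c : i <= m -> c <= n -> bend c ->
  eqvs (PH i c) (rho_inv (lost_piece i c)).
Proof.
move=> hi hc b; rewrite /lost_piece; case: ltnP => h /=; last first.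
  have -> : i = m by lia.
  exact: eqv_refl.
move: b; case: c hc => [|c] hc; first by rewrite /bend e0.
rewrite /bend => /andP [h1 h2].
have kc : ~~ kept c by rewrite /kept (negbTE h1) h2.
have E : cnt c.+1 = cnt c by rewrite cntS (negbTE kc) addn0.
apply: (eqv_trans (v := PV i.+1 c)).
  by apply/eqv_edge/EdgeRB; rewrite ?s_any.
apply: (eqv_trans (v := PH i.+1 c)).
  by apply/eqv_edge/EdgeTL; rewrite ?s_any.
rewrite E; apply: chain => //; first exact: ltnW.
by rewrite /bend (negbTE h1) andbF.
Qed.

Lemma rho_row_inv c : c <= n -> eqvs (PH 0 c) (rho_inv (rho_row c)).
Proof.
move=> hc; rewrite /rho_row; case h1: (e c); case h2: (e c.+1) => /=.
- have hcn : c < n by rewrite ltn_neqAle hc andbT; apply/eqP => E; rewrite E en in h2.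
  have kc : kept c by rewrite /kept h2.
  by rewrite kap_cnt //; apply/eqv_edge/EdgeLB; rewrite ?s_row ?h2.
- exact: eqv_refl.
- by apply: lost_rho => //; rewrite /bend h1 h2.
- case: c hc h1 h2 => [|c] hc h1 h2; first by rewrite e0 in h1.
  have kc : kept c by rewrite /kept h1 h2.
  by rewrite kap_cnt //; apply/eqv_edge/EdgeRB; rewrite ?s_row ?h1.
Qed.

Lemma rho_invP u : valid m.+1 n u -> eqvs u (rho_inv (rho u)).
Proof.
case: u => //= -[|i] c /andP [hi hc].
- exact: rho_row_inv.
- case: ifP => b; first exact: lost_rho.
  exact: chain.
- case: ifP => h; apply: (eqv_trans _ (rho_row_inv _)) => //; last exact: ltnW.
    by apply/eqv_edge/EdgeTR; rewrite ?s_row ?h.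
  by apply/eqv_edge/EdgeTL; rewrite ?s_row ?h.
- case: ifP => kc /=; first by rewrite kap_cnt //; apply: eqv_refl.
  have sc : s i c = e c.+1 by rewrite s_any // ?kc //; lia.
  have hi' : i <= m by lia.
  case: ifP => h.
    apply: (eqv_trans (v := PH i c)).
      by apply/eqv_sym/eqv_edge/EdgeLB; rewrite ?sc ?h.
    by apply: lost_rho => //; [lia | move: kc; rewrite /kept /bend h => ->].
  apply: (eqv_trans (v := PH i c.+1)).
    by apply/eqv_sym/eqv_edge/EdgeRB; rewrite ?sc ?h.
  by apply: lost_rho => //; move: kc; rewrite /kept /bend h /= => /negbFE ->.
Qed.

Lemma rho_inv_edge u v : edge m (cnt n) s2 u v -> eqvs (rho_inv u) (rho_inv v).
Proof.
case=> i c hi hc h /=; have [hk kk ck] := kapP hc; have [b1 b2] := kept_bend kk.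
all: have sE : s i.+1 (kap c) = s2 i c by rewrite s_kept // ck.
all: have cE : cnt (kap c).+1 = c.+1 by rewrite cntS kk ck addn1.
all: have ch := chain hi hk b2; rewrite cE in ch.
- by apply: eqv_trans ch; apply/eqv_edge/EdgeTR; rewrite ?sE.
- by apply/eqv_edge/EdgeLB; rewrite ?sE.
- by apply/eqv_edge/EdgeTL; rewrite ?sE.
- by apply: (eqv_trans (eqv_sym ch)); apply/eqv_edge/EdgeRB; rewrite ?sE.
Qed.

Lemma rho_eqv u v : valid m.+1 n u -> valid m.+1 n v ->
  eqvs u v <-> eqv2 (rho u) (rho v).
Proof.
move=> vu vv; split; first exact: eqv_map rho_edge _ _.
move=> /(eqv_map rho_inv_edge) h.
exact: eqv_trans (rho_invP vu) (eqv_trans h (eqv_sym (rho_invP vv))).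
Qed.

Lemma rho_inv_valid u : valid m (cnt n) u ->
  valid m.+1 n (rho_inv u) /\ rho (rho_inv u) = u.
Proof.
case: u => //= i c /andP [hi hc].
  have := kap_le hc; rewrite ltnS hi => ->; split=> //.
  by rewrite kap_bend // cnt_kap.
by have [-> -> ->] := kapP hc; rewrite ltnS hi.
Qed.

End Graph.
End Words.

(** * Boundary points before and after removing the first row *)

Section RowLabels.
Variables (n : nat) (e : nat -> bool).
(* The points y_1, x_1, ..., x_n, y'_1 in the order in which they are met. *)
Definition zl g : lab :=
  match g with 0 => LL 0 | g'.+1 => if g' == n then LR 0 else LT g' end.

(** The place, in the word y_1 x_1 ... x_n y'_1, of the point whose strand runs down the kept column
    j. The column itself belongs to place j+1; with + the strand comes from the neighbour on the
    left, with - from the one on the right. *)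
Definition zeta j := if e j.+1 then j else j.+2.

(** The old places of the points that survive. The bottom is moved by [kap] for the whole diagram
    and by [id] for a roof state, which loses points at its top only. *)
Definition io (kb : nat -> nat) (l : lab) : lab :=
  match l with
  | LT c => zl (zeta (kap n e c))
  | LB c => LB (kb c)
  | LL i => LL i.+1
  | LR i => LR i.+1
  end.

(** A change + - in the first row makes an arc between neighbouring points of the top word, and a
    change - + ends up as an arc between neighbouring bottom points ([pairs_bot]). *)
Definition pairs_top (C : conn) :=
  forall g, g <= n -> e g -> ~~ e g.+1 -> cm C (zl g) = zl g.+1.
Definition pairs_bot (C : conn) :=
  forall c, bend e c -> cm C (LB c.-1) = LB c.

Definition io_spec kb (C D : conn) :=
  forall l, cdom D l -> cm C (io kb l) = io kb (cm D l).

Notation kap := (kap n e).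
Notation cnt := (cnt e).
Notation kept := (kept e).
Notation bend := (bend e).

Lemma zl_dom m b g : g <= n.+1 -> dom m.+1 n b (zl g).
Proof. by case: g => [|g] //= hg; case: (altP eqP) => //= h; lia. Qed.

Lemma zl_inj g h : g <= n.+1 -> h <= n.+1 -> zl g = zl h -> g = h.
Proof.
case: g h => [|g] [|h] //=; try by case: eqP.
by case: eqP => [->|_]; case: eqP => [->|_] // _ _ [->].
Qed.

Lemma zeta_le c : c < cnt n -> zeta (kap c) <= n.+1 /\
  (if e (kap c).+1 then e (kap c) else ~~ e (kap c).+2).
Proof.
case/kapP => hk kk _; rewrite /zeta; split; last by move: kk; rewrite /kept; case: (e _).
by case: ifP => _; lia.
Qed.

Lemma zeta_lt c d : c < d -> d < cnt n -> zeta (kap c) < zeta (kap d).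
Proof.
move=> cd hd; have hc := ltn_trans cd hd.
have kcd := @kap_lt n e _ _ cd (ltnW hd).
have [_ zc] := zeta_le hc; have [_ zd] := zeta_le hd; rewrite /zeta.
move: zc zd kcd; case h1: (e (kap c).+1); case h2: (e (kap d).+1) => //= a b h; try lia.
have : (kap d) != (kap c).+1 by apply/eqP => E; rewrite E h1 in b.
have : (kap d) != (kap c).+2 by apply/eqP => E; rewrite E in b; rewrite b in a.
by move: (kap c) (kap d) h => *; lia.
Qed.

Lemma io_dom m kb l : (forall c, c < cnt n -> kb c < n) ->
  dom m (cnt n) (cnt n) l -> dom m.+1 n n (io kb l).
Proof.
move=> hkb; case: l => i //= hi; last exact: hkb.
by apply: zl_dom; case: (zeta_le hi).
Qed.

Lemma io_alive kb m b l g : dom m (cnt n) b l -> g <= n -> e g -> ~~ e g.+1 ->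
  io kb l <> zl g /\ io kb l <> zl g.+1.
Proof.
move=> d hg h1 h2.
have Z x : zl x <> LB (kb (if l is LB i then i else 0)) /\
    (if l is LL i then zl x <> LL i.+1 else if l is LR i then zl x <> LR i.+1 else True).
  by case: l {d} => i; case: x => [|x] //=; case: eqP.
case: l d Z => i hi Z.
- have [z _] := zeta_le hi; have [_ kk _] := kapP hi; move: kk; rewrite /kept.
  rewrite -[io kb (LT i)]/(zl (zeta (kap i))).
  case k1: (e (kap i).+1) => a; split=> /(zl_inj z) E; have {}E := E ltac:(lia);
    move: E; rewrite /zeta k1 => E.
  + by rewrite -E k1 in h2.
  + by rewrite -E a in h2.
  + by rewrite -E (negbTE a) in h1.
  + by case: E => E; rewrite -E k1 in h1.
- by have [h _] := Z g; have [h' _] := Z g.+1; split=> E; [apply: h | apply: h'].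
- by have [_ h] := Z g; have [_ h'] := Z g.+1; split=> E; [apply: h | apply: h'].
- by have [_ h] := Z g; have [_ h'] := Z g.+1; split=> E; [apply: h | apply: h'].
Qed.

Hypotheses (e0 : e 0 = true) (en : forall g, n < g -> e g = false).

Let en1 : e n.+1 = false. Proof. exact: en. Qed.

Lemma bend_lt c : bend c -> 0 < c < n.
Proof.
case: c => [|c]; first by rewrite /bend e0.
by case/andP => _ h /=; rewrite ltnNge; apply/negP => h'; rewrite en in h.
Qed.

Lemma zl_cases g : g <= n.+1 ->
(exists2 c, c < cnt n & zl g = zl (zeta (kap c))) \/
(exists h, [/\ h <= n, e h, ~~ e h.+1 & zl g = zl h \/ zl g = zl h.+1]).
Proof.
have kc j : j < n -> kept j -> cnt j < cnt n by apply: cnt_lt.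
move=> hg; case eg: (e g).
  case eg1: (e g.+1).
    have hgn : g < n by rewrite ltnNge; apply/negP => h; rewrite en in eg1.
    have kg : kept g by rewrite /kept eg1.
    left; exists (cnt g); rewrite ?kc //.
    by rewrite kap_cnt // /zeta eg1.
  have hgn : g <= n by rewrite leqNgt; apply/negP => h; rewrite en in eg.
  by right; exists g; rewrite eg1; split=> //; left.
case: g hg eg => [|g]; first by rewrite e0.
rewrite ltnS => hg eg.
case eg1: (e g); first by right; exists g; rewrite eg; split=> //; right.
case: g hg eg eg1 => [|g]; first by rewrite e0.
move=> hg eg2 eg1; have kg : kept g by rewrite /kept eg1 eg2.
left; exists (cnt g); rewrite ?kc //.
by rewrite kap_cnt // /zeta eg1.
Qed.

Lemma lab_cases m l : dom m.+1 n n l ->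
  [\/ exists2 l', dom m (cnt n) (cnt n) l' & l = io kap l',
      exists g, [/\ g <= n, e g, ~~ e g.+1 & l = zl g \/ l = zl g.+1] |
      exists c, bend c /\ (l = LB c.-1 \/ l = LB c)].
Proof.
have kc j : j < n -> kept j -> cnt j < cnt n by apply: cnt_lt.
have Z g : g <= n.+1 ->
  (exists2 l', dom m (cnt n) (cnt n) l' & zl g = io kap l') \/
  (exists h, [/\ h <= n, e h, ~~ e h.+1 & zl g = zl h \/ zl g = zl h.+1]).
  by move=> /zl_cases [[c hc ->]|]; [left; exists (LT c) | right].
case: l => i hi.
- have [] := Z i.+1; rewrite /= in hi *; first by lia.
    rewrite (ltn_eqF hi) => h; by constructor 1.
  by rewrite (ltn_eqF hi) => h; constructor 2.
- rewrite /= in hi; case: (boolP (kept i)) => ki.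
    constructor 1; exists (LB (cnt i)); rewrite /= ?kc //.
    by rewrite kap_cnt.
  constructor 3; move: ki; rewrite /kept; case ei: (e i.+1) => ki.
    by exists i; rewrite /bend ki ei; split=> //; right.
  by exists i.+1; rewrite /bend ei -[e i.+2]negbK ki; split=> //; left.
- case: i hi => [|i] hi.
    by have [//|h|h] := Z 0; [constructor 1 | constructor 2].
  by constructor 1; exists (LL i).
- case: i hi => [|i] hi.
    by have [//||] := Z n.+1; rewrite /= eqxx => h; [constructor 1 | constructor 2].
  by constructor 1; exists (LR i).
Qed.

Section Realized.
Variables (m : nat) (s s2 : nat -> nat -> bool).
Hypothesis s_row : forall j, j < n -> s 0 j = e j.+1.
Hypothesis s_lost : forall i j, i < m -> j < n -> ~~ kept j -> s i.+1 j = e j.+1.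
Hypothesis s_kept : forall i j, i < m -> j < n -> kept j -> s i.+1 j = s2 i (cnt j).

Notation rho := (rho e m).
Notation bp1 := (bp m.+1 n).
Notation eqv2 := (eqv m (cnt n) s2).

Lemma rho_zl g : g <= n.+1 ->
  rho (bp1 (zl g)) = rho_row e m (if e g then g else g.-1).
Proof.
case: g => [|g] hg /=; first by rewrite e0.
case: eqP => [->|h] /=; first by rewrite en1.
by case: ifP.
Qed.

Lemma rho_io l : dom m (cnt n) (cnt n) l -> rho (bp1 (io kap l)) = bp m (cnt n) l.
Proof.
case: l => i /= hi.
- have [h z] := zeta_le hi; rewrite rho_zl //; have [hk kk ck] := kapP hi.
  rewrite /zeta; move: z kk; case h1: (e (kap i).+1) => z kk.
    by rewrite z /rho_row z h1 ck.
  by rewrite (negbTE z) /rho_row h1 (negbTE z) ck.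
- by have [hk kk ck] := kapP hi; rewrite kk ck.
- by rewrite /bend e0.
- by rewrite bend_n.
Qed.

Lemma rho_dead_top g : g <= n -> e g -> ~~ e g.+1 ->
  rho (bp1 (zl g)) = PD g /\ rho (bp1 (zl g.+1)) = PD g.
Proof.
move=> hg h1 h2; rewrite !rho_zl //; last by lia.
by rewrite h1 (negbTE h2) /rho_row /= h1 (negbTE h2).
Qed.

Lemma rho_dead_bot c : bend c ->
  rho (bp1 (LB c.-1)) = PB c /\ rho (bp1 (LB c)) = PB c.
Proof.
move=> b; have := bend_lt b; move: b; case: c => // c; rewrite /bend /= /kept => /andP [h1 h2] _.
by rewrite (negbTE h1) h2 /= /lost_piece ltnn.
Qed.

Lemma eqv2_dead u v : ~~ valid m (cnt n) u -> eqv2 u v -> u = v.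
Proof.
move=> nv h; have : u = v \/ (valid m (cnt n) u /\ valid m (cnt n) v).
  elim: {nv} h => {u v} [u v /edge_valid ? //|u|u v _ [->|[]]|u v w _ [->|[h1 h2]] _ [<-|[h3 h4]]];
    by [left | right].
by case=> // -[h1]; rewrite h1 in nv.
Qed.

Lemma bp_valid m' n' l : dom m' n' n' l -> valid m' n' (bp m' n' l).
Proof. by case: l => i /= ->; rewrite ?leqnn. Qed.

Lemma bp_eqv l l' : dom m.+1 n n l -> dom m.+1 n n l' ->
  eqv m.+1 n s (bp1 l) (bp1 l') <-> eqv2 (rho (bp1 l)) (rho (bp1 l')).
Proof. by move=> d d'; apply: rho_eqv => //; apply: bp_valid. Qed.

Variable C : conn.
Hypotheses (hC : ht C = m.+1) (nC : nt C = n) (bC : nb C = n).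

Let dC l : cdom C l = dom m.+1 n n l. Proof. exact: domE. Qed.

Let bdom c : bend c -> dom m.+1 n n (LB c.-1) /\ dom m.+1 n n (LB c).
Proof. by move/bend_lt => /=; lia. Qed.

Lemma realized_pairs : realized m.+1 n s C -> pairs_top C /\ pairs_bot C.
Proof.
move=> H; split=> [g hg h1 h2|c b].
  have d : cdom C (zl g) by rewrite dC zl_dom // ltnW.
  have d' : cdom C (zl g.+1) by rewrite dC zl_dom.
  apply/H => //; split; first by move/zl_inj; lia.
  have [e1 e2] := rho_dead_top hg h1 h2.
  by rewrite bp_eqv -?dC // e1 e2; apply: eqv_refl.
have [d d'] := bdom b; have := bend_lt b => bl; have [e1 e2] := rho_dead_bot b.
apply/H; rewrite ?dC //; split; first by case; lia.
by rewrite bp_eqv // e1 e2; apply: eqv_refl.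
Qed.

Variable D : conn.
Hypotheses (hD : ht D = m) (nD : nt D = cnt n) (bD : nb D = cnt n).

Let dD l : cdom D l = dom m (cnt n) (cnt n) l. Proof. exact: domE. Qed.

Hypotheses (pt : pairs_top C) (pb : pairs_bot C) (sp : io_spec kap C D).

Let io_inj l l' : cdom D l -> cdom D l' -> io kap l = io kap l' -> l = l'.
Proof.
rewrite !dD; case: l => i; case: l' => j //=;
  try by rewrite /zl; case: (zeta _) => [|?] //; case: eqP.
- move=> hi hj E; congr LT.
  have [z1 _] := zeta_le hi; have [z2 _] := zeta_le hj.
  have {}E := zl_inj z1 z2 E.
  by case: (ltngtP i j) => // h; [have := zeta_lt h hj | have := zeta_lt h hi]; rewrite E ltnn.
- move=> hi hj [E]; congr LB.
  by case: (ltngtP i j) => // h;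
    [have := @kap_lt n e _ _ h (ltnW hj) | have := @kap_lt n e _ _ h (ltnW hi)]; rewrite E ltnn.
- by move=> _ _ [->].
- by move=> _ _ [->].
Qed.

(** Connectivity of surviving points is transported by [rho]. The other points are mated by
    [pairs_top] and [pairs_bot], and as [PD] and [PB] are isolated, their components contain no
    further boundary point. *)
Lemma realized_reduce : realized m.+1 n s C <-> realized m (cnt n) s2 D.
Proof.
have ioD l : cdom D l -> cdom C (io kap l).
  by rewrite dD dC; apply: io_dom => c /kapP [].
have ioE l l' : cdom D l -> cdom D l' ->
    eqv m.+1 n s (bp1 (io kap l)) (bp1 (io kap l')) <->
    eqv2 (bp m (cnt n) l) (bp m (cnt n) l').
  by move=> d d'; rewrite bp_eqv -?dC ?ioD // !rho_io -?dD.
split=> H.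
  move=> l l' d d'; rewrite -ioE // -[cm D l = l']/(id (cm D l = l')).
  have := H _ _ (ioD _ d) (ioD _ d'); rewrite sp // => -[h1 h2]; split.
    by move=> E; rewrite E in h1; have [//|n1 h] := h1; split=> // E'; rewrite E' in n1.
  case=> n1 h; apply: io_inj; rewrite ?cm_dom //; apply: h2; split=> //.
  by move/io_inj; tauto.
have dead l l' x : cdom C l -> cdom C l' -> rho (bp1 l) = x -> ~~ valid m (cnt n) x ->
    eqv m.+1 n s (bp1 l) (bp1 l') -> rho (bp1 l') = x.
  by move=> d d' E nv; rewrite bp_eqv -?dC // E => /(eqv2_dead nv).
have top g l' : g <= n -> e g -> ~~ e g.+1 -> cdom C l' -> rho (bp1 l') = PD g ->
    l' = zl g \/ l' = zl g.+1.
  move=> hg h1 h2; rewrite dC => /lab_cases [[l d ->]|[h [k1 k2 k3 k4]]|[c [b k]]].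
  - by rewrite rho_io //; case: l d.
  - have [e1 e2] := rho_dead_top k1 k2 k3.
    by case: k4 => ->; rewrite ?e1 ?e2 => -[->]; tauto.
  - have [e1 e2] := rho_dead_bot b; by case: k => ->; rewrite ?e1 ?e2.
have bot c l' : bend c -> cdom C l' -> rho (bp1 l') = PB c ->
    l' = LB c.-1 \/ l' = LB c.
  move=> b; rewrite dC => /lab_cases [[l d ->]|[h [k1 k2 k3 k4]]|[c' [b' k]]].
  - by rewrite rho_io //; case: l d.
  - have [e1 e2] := rho_dead_top k1 k2 k3; by case: k4 => ->; rewrite ?e1 ?e2.
  - have [e1 e2] := rho_dead_bot b'.
    by case: k => ->; rewrite ?e1 ?e2 => -[->]; tauto.
have two l l1 l' x : cdom C l -> cdom C l1 -> cm C l = l1 -> ~~ valid m (cnt n) x ->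
    rho (bp1 l) = x -> rho (bp1 l1) = x -> cdom C l' ->
    (rho (bp1 l') = x -> l' = l \/ l' = l1) ->
    cm C l = l' <-> l <> l' /\ eqv m.+1 n s (bp1 l) (bp1 l').
  move=> d d1 E nv r r1 d' K; split=> [<-|[n1 h]].
    rewrite E; split; first by move=> E'; have := cm_neq d; rewrite E E' eqxx.
    by rewrite bp_eqv -?dC // r r1; apply: eqv_refl.
  by case: (K (dead _ _ _ d d' r nv h)) => E'; [case: n1 | rewrite E].
move=> l l' d d'; move: (d); rewrite dC => /lab_cases [[k dk Ek]|[h [k1 k2 k3 k4]]|[c [b k]]].
- subst l; rewrite -dD in dk; rewrite sp //; split.
    move=> <-; rewrite ioE ?cm_dom //.
    have [|n1 h] := (H k (cm D k) dk _).1 erefl; first by rewrite cm_dom.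
    by split=> // /io_inj E; apply: n1; apply: E; rewrite ?cm_dom.
  case=> n1 hh; move: (d'); rewrite dC => /lab_cases [[k' dk' Ek']|[h [k1 k2 k3 k4]]|[c [b kk]]].
  + subst l'; rewrite -dD in dk'; congr io; apply/H => //; split; last by apply/ioE.
    by move=> E; apply: n1; rewrite E.
  + have [e1 e2] := rho_dead_top k1 k2 k3.
    have r : rho (bp1 l') = PD h by case: k4 => ->.
    have := @dead _ _ _ d' d r isT (eqv_sym hh); rewrite rho_io -?dD //; by case: (k) dk.
  + have [e1 e2] := rho_dead_bot b.
    have r : rho (bp1 l') = PB c by case: kk => ->.
    have := @dead _ _ _ d' d r isT (eqv_sym hh); rewrite rho_io -?dD //; by case: (k) dk.
- have [e1 e2] := rho_dead_top k1 k2 k3.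
  have dz : cdom C (zl h) by rewrite dC zl_dom // ltnW.
  have dz' : cdom C (zl h.+1) by rewrite dC zl_dom.
  case: k4 => El; subst l.
    by apply: (two _ (zl h.+1) _ (PD h)) => //; [apply: pt | apply: top].
  apply: (two _ (zl h) _ (PD h)) => //; first by apply/cm_eq_sym/pt.
  by move=> /(top _ _ k1 k2 k3 d'); tauto.
- have [e1 e2] := rho_dead_bot b; have [db db'] := bdom b; rewrite -!dC in db db'.
  case: k => El; subst l.
    by apply: (two _ (LB c) _ (PB c)) => //; [apply: pb | apply: bot].
  apply: (two _ (LB c.-1) _ (PB c)) => //; first by apply/cm_eq_sym/pb.
  by move=> /(bot _ _ b d'); tauto.
Qed.

End Realized.

Section ClosedPieces.
Variables (m : nat) (s s2 : nat -> nat -> bool).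
Hypothesis s_row : forall j, j < n -> s 0 j = e j.+1.
Hypothesis s_lost : forall i j, i < m -> j < n -> ~~ kept j -> s i.+1 j = e j.+1.
Hypothesis s_kept : forall i j, i < m -> j < n -> kept j -> s i.+1 j = s2 i (cnt j).

Notation rho := (rho e m).
Notation bp1 := (bp m.+1 n).

Let beqv := rho_eqv e0 en1 s_row s_lost s_kept.

Lemma rho_valid u : valid m.+1 n u -> valid m (cnt n) (rho u) \/
  exists2 l, dom m.+1 n n l & rho u = rho (bp1 l).
Proof.
have lost i c : i <= m -> bend c -> valid m (cnt n) (lost_piece e m i c) \/
    exists2 l, dom m.+1 n n l & lost_piece e m i c = rho (bp1 l).
  move=> hi b; have := bend_lt b => hc; rewrite {1 2}/lost_piece.
  case: ltnP => h /=; first by left; rewrite h cnt_le //; lia.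
  right; exists (LB c); first by rewrite /=; lia.
  by have [_ ->] := rho_dead_bot m b.
have row c : c <= n -> valid m (cnt n) (rho_row e m c) \/
    exists2 l, dom m.+1 n n l & rho_row e m c = rho (bp1 l).
  move=> hc; case h1: (e c); case h2: (e c.+1).
  - left; rewrite /rho_row h1 h2 /=; apply: cnt_lt; last by rewrite /kept h2.
    by rewrite ltnNge; apply/negP => h; rewrite en in h2.
  - right; exists (zl c); first by rewrite zl_dom // ltnW.
    by rewrite rho_zl ?h1 // ltnW.
  - by rewrite /rho_row h1 h2; apply: lost; rewrite // /bend h1 h2.
  - case: c hc h1 h2 => [|c] hc h1 h2; first by rewrite e0 in h1.
    left; rewrite /rho_row h1 h2 /=; apply: cnt_lt => //; by rewrite /kept h1 h2.
case: u => //= -[|i] c /andP [hi hc].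
- exact: row.
- case: ifP => b; first exact: lost.
  by left; rewrite /= -ltnS hi cnt_le.
- by case: ifP => h; apply: row => //; apply: ltnW.
- case: ifP => kc; first by left; rewrite /= -ltnS hi cnt_lt.
  apply: lost; first by rewrite -ltnS.
  by move: kc; rewrite /kept /bend; case h: (e c.+1) => /=;
    rewrite ?h => /negbT; rewrite ?negbK => ->.
Qed.

Lemma closed_rho u : closed_piece m.+1 n s u -> closed_piece m (cnt n) s2 (rho u).
Proof.
case=> vu cu; case: (rho_valid vu) => [vr|[l dl E]]; last first.
  by case: (cu l dl); apply/beqv; rewrite ?bp_valid // E; apply: eqv_refl.
split=> // l dl; rewrite -rho_io // => h.
have d : dom m.+1 n n (io kap l) by apply: io_dom => // c /kapP [].
by apply: (cu _ d); apply/beqv; rewrite ?bp_valid.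
Qed.

Lemma closed_rho_inv u : closed_piece m (cnt n) s2 u ->
  closed_piece m.+1 n s (rho_inv n e m u).
Proof.
case=> vu cu; have [vr r] := rho_inv_valid en1 vu; split=> // l dl.
move/beqv; rewrite bp_valid // => /(_ isT vr); rewrite r.
case: (lab_cases dl) => [[k dk ->]|[h [k1 k2 k3 k4]]|[c [b k]]].
- by rewrite rho_io //; apply: cu.
- have [e1 e2] := rho_dead_top m k1 k2 k3.
  have -> : rho (bp1 l) = PD h by case: k4 => ->.
  by move/(eqv2_dead (isT : ~~ valid m (cnt n) (PD h))) => E; rewrite -E in vu.
- have [e1 e2] := rho_dead_bot m b.
  have -> : rho (bp1 l) = PB c by case: k => ->.
  by move/(eqv2_dead (isT : ~~ valid m (cnt n) (PB c))) => E; rewrite -E in vu.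
Qed.

End ClosedPieces.
End RowLabels.

(** * State sums with a prescribed first row *)

Section RowSum.
Variables (m n : nat) (w : {ffun 'I_n -> bool}).

Definition ext (g : nat) : bool :=
  match g with
  | 0 => true
  | j.+1 => if insub j is Some j' then w j' else false
  end.

Lemma ext_ord (j : 'I_n) : ext j.+1 = w j.
Proof. by rewrite /ext valK. Qed.

Lemma ext_out g : n < g -> ext g = false.
Proof. by case: g => // j h /=; rewrite insubN // -leqNgt. Qed.

Arguments ext : simpl never.

Let e0 : ext 0 = true. Proof. by []. Qed.
Let en1 : ext n.+1 = false. Proof. exact: ext_out. Qed.

Notation kept := (kept ext).
Notation bend := (bend ext).
Notation cnt := (cnt ext).
Notation kap := (kap n ext).

Definition row_of (s : kstate m.+1 n) : {ffun 'I_n -> bool} := [ffun j => s (ord0, j)].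

(** How far the returns facing down have been pushed: through r further rows, and in the next one
    those starting at columns k < c. *)
Definition forced r c (s : kstate m.+1 n) : bool :=
  [forall i : 'I_m, forall k : 'I_n,
     bend k.+1 && ((i < r) || ((i == r :> nat) && (k < c)))
     ==> ~~ sN s i.+1 k && sN s i.+1 k.+1].

Lemma forcedP r c s : reflect (forall i k, i < m -> k < n -> bend k.+1 ->
    (i < r) || ((i == r) && (k < c)) -> ~~ sN s i.+1 k && sN s i.+1 k.+1)
  (forced r c s).
Proof.
apply: (iffP forallP) => [H i k hi hk b h|H i].
  by have /forallP/(_ (Ordinal hk)) := H (Ordinal hi); rewrite /= b h.
by apply/forallP => k; apply/implyP => /andP [b h]; apply: H.
Qed.

Lemma row_ofP s j : row_of s = w -> j < n -> sN s 0 j = ext j.+1.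
Proof.
move=> hw hj; rewrite -[j]/(val (Ordinal hj)) -[0]/(val (@ord0 m)) sNE.
by rewrite ext_ord -hw ffunE.
Qed.

Variable T : crossingless m.+1 n n.

(** [slide_sum] applies: the row above already has - + at this place, and the two crossings belong
    to no other return, since [bend] cannot hold at neighbouring places. *)
Lemma forced_step r c : r < m -> c < n ->
  (\sum_(s | (row_of s == w) && forced r c s) summand T s =
   \sum_(s | (row_of s == w) && forced r c.+1 s) summand T s)%R.
Proof.
move=> hr hc; case: (boolP (bend c.+1)) => b; last first.
  apply: eq_bigl => s; congr (_ && _).
  apply/forcedP/forcedP => H i k hi hk bk h; apply: H => //.
    move: h => /orP [->//|/andP [/eqP -> h]]; rewrite ltnn eqxx /=.
    move: h; rewrite ltnS leq_eqVlt => /predU1P [E|//].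
    by rewrite E (negbTE b) in bk.
  by move: h => /orP [->//|/andP [-> h]]; rewrite (ltn_trans h (ltnSn _)) orbT.
have hi : r.+1 < m.+1 by [].
have hk : c.+1 < n by have /andP [] := bend_lt e0 ext_out b.
rewrite (@slide_sum m.+1 n r c hi hk T (fun s => (row_of s == w) && forced r c s)).
- apply: eq_bigl => s; rewrite -andbA; congr (_ && _).
  have E1 : s (Ordinal hi, Ordinal (ltnW hk)) = sN s r.+1 c.
    by rewrite -(sNE s (Ordinal hi) (Ordinal (ltnW hk))).
  have E2 : s (Ordinal hi, Ordinal hk) = sN s r.+1 c.+1.
    by rewrite -(sNE s (Ordinal hi) (Ordinal hk)).
  rewrite E1 E2; apply/andP/forcedP => [[/forcedP H1 H2] i k hi' hk' bk|H].
    case: (ltngtP i r) => //= [h|->] //; first by move=> _; apply: H1; rewrite ?h.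
    rewrite ltnS leq_eqVlt => /predU1P [->//|h].
    by apply: H1; rewrite // eqxx h orbT.
  split; last by apply: H => //; rewrite eqxx ltnSn orbT.
  apply/forcedP => i k hi' hk' bk h; apply: H => //.
  by move: h => /orP [->//|/andP [-> h]]; rewrite (ltn_trans h (ltnSn _)) orbT.
- move=> s x y; congr (_ && _).
    apply: (congr1 (fun z => z == w)); apply/ffunP => j; rewrite !ffunE.
    by rewrite !xpair_eqE -!val_eqE.
  { apply/forcedP/forcedP => H i k hi' hk' bk h; move: (H i k hi' hk' bk h).
  all: rewrite !set_pair_out //; apply/negP => /andP [/eqP [E] /orP [] /eqP E'];
    move: h; rewrite E E' ltnn eqxx /=; try lia.
  all: by move=> _; move: bk b; rewrite E' /bend => /andP [_ ->]. }
- move=> s /andP [/eqP hw /forcedP H]; rewrite /prior.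
  rewrite -(sNE s _ (Ordinal (ltnW hk))) -(sNE s _ (Ordinal hk)) /=.
  case: r hr hi H => [|r] hr hi H.
    by rewrite !row_ofP //; move: b; rewrite /bend => /andP [-> ->].
  by apply: H => //; [apply: ltnW | rewrite ltnSn].
Qed.

Lemma forced_sum : (\sum_(s | row_of s == w) summand T s =
  \sum_(s | (row_of s == w) && forced m 0 s) summand T s)%R.
Proof.
have A r : r < m -> (\sum_(s | (row_of s == w) && forced r 0 s) summand T s =
   \sum_(s | (row_of s == w) && forced r.+1 0 s) summand T s)%R.
  move=> hr; have B c : c <= n ->
    (\sum_(s | (row_of s == w) && forced r 0 s) summand T s =
     \sum_(s | (row_of s == w) && forced r c s) summand T s)%R.
    by elim: c => // c IH hc; rewrite IH 1?ltnW // forced_step.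
  rewrite (B n) //; apply: eq_bigl => s; congr (_ && _).
  apply/forcedP/forcedP => H i k hi hk bk h; apply: H => //.
    by move: h; rewrite ltn0 andbF orbF ltnS leq_eqVlt hk andbT orbC.
  by rewrite ltn0 andbF orbF ltnS leq_eqVlt; move: h; rewrite hk andbT orbC.
have C r : r <= m -> (\sum_(s | (row_of s == w) && forced 0 0 s) summand T s =
   \sum_(s | (row_of s == w) && forced r 0 s) summand T s)%R.
  by elim: r => // r IH hr; rewrite IH 1?ltnW // A.
rewrite -(C m) //; apply: eq_bigl => s.
have -> : forced 0 0 s; last by rewrite andbT.
by apply/forcedP => i k _ _ _; rewrite !ltn0 andbF.
Qed.

(** The states left by [forced_sum] are the states of the smaller lattice with - + inserted in the
    lost columns of every row. *)
Definition expand (s2 : kstate m (cnt n)) : kstate m.+1 n :=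
  [ffun c : 'I_m.+1 * 'I_n => if nat_of_ord c.1 == 0 then w c.2
             else if kept c.2 then sN s2 (c.1).-1 (cnt c.2) else ext (c.2).+1].

Definition contract (s : kstate m.+1 n) : kstate m (cnt n) :=
  [ffun d : 'I_m * 'I_(cnt n) => sN s (d.1).+1 (kap d.2)].

Lemma sN_expand s2 i j : i < m.+1 -> j < n -> sN (expand s2) i j =
  if i == 0 then ext j.+1 else if kept j then sN s2 i.-1 (cnt j) else ext j.+1.
Proof.
move=> hi hj; rewrite -[i]/(val (Ordinal hi)) -[j]/(val (Ordinal hj)) sNE ffunE.
by rewrite -ext_ord.
Qed.

Lemma expand_row s2 j : j < n -> sN (expand s2) 0 j = ext j.+1.
Proof. by move=> hj; rewrite sN_expand. Qed.

Lemma expand_lost s2 i j : i < m -> j < n -> ~~ kept j -> sN (expand s2) i.+1 j = ext j.+1.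
Proof. by move=> hi hj /negbTE kj; rewrite sN_expand //= kj. Qed.

Lemma expand_kept s2 i j : i < m -> j < n -> kept j ->
  sN (expand s2) i.+1 j = sN s2 i (cnt j).
Proof. by move=> hi hj kj; rewrite sN_expand //= kj. Qed.

Lemma expandK : cancel expand contract.
Proof.
move=> s2; apply/ffunP => -[i c]; rewrite ffunE /=.
have [h k E] := kapP (ltn_ord c).
by rewrite expand_kept // E sNE.
Qed.

Lemma expand_forced s2 : (row_of (expand s2) == w) && forced m 0 (expand s2).
Proof.
apply/andP; split.
  apply/eqP/ffunP => j; rewrite ffunE -sNE expand_row //; exact: ext_ord.
apply/forcedP => i k hi hk b _; have /andP [_ hk1] := bend_lt e0 ext_out b.
move: (b); rewrite /bend => /andP [h1 h2].
have k0 : ~~ kept k by rewrite /kept (negbTE h1) h2.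
have k1 : ~~ kept k.+1 by rewrite /kept h2.
by rewrite !expand_lost // h1 h2.
Qed.

Lemma contractK s : (row_of s == w) && forced m 0 s -> expand (contract s) = s.
Proof.
move=> /andP [/eqP hw /forcedP H]; apply/ffunP => -[i j]; rewrite -2!sNE.
have hj := ltn_ord j.
case: i => -[|i] hi /=; first by rewrite expand_row // row_ofP.
rewrite ltnS in hi; case: (boolP (kept j)) => kj.
  rewrite expand_kept //; have hc := cnt_lt hj kj.
  rewrite -[i in LHS]/(val (Ordinal hi)) -[cnt j]/(val (Ordinal hc)) sNE ffunE /=.
  by rewrite kap_cnt.
rewrite expand_lost //; move: kj; rewrite /kept; case h: (ext j.+1) => k.
  case: j hj h k => -[|j] hj hj' //= h k.
  have b : bend j.+1 by rewrite /bend k.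
  have hj1 : j < n by apply: ltnW.
  by have /andP [_ ->] := H i j hi hj1 b (introT orP (or_introl hi)).
have b : bend j.+1 by rewrite /bend h -[ext _]negbK k.
by have /andP [/negbTE -> _] := H i j hi hj b (introT orP (or_introl hi)).
Qed.

Local Open Scope ring_scope.

Lemma expo_expand s2 : \sum_c sgn_of (expand s2 c) =
  \sum_j sgn_of (w j) + \sum_c sgn_of (s2 c).
Proof.
have pair a b (F : 'I_a * 'I_b -> int) : \sum_c F c = \sum_i \sum_j F (i, j).
  by rewrite pair_bigA; apply: eq_bigr => -[].
rewrite !pair big_ord_recl /=; congr (_ + _).
  by apply: eq_bigr => j _; rewrite ffunE.
apply: eq_bigr => i _; have hi : (i.+1 < m.+1)%N by rewrite ltnS.
pose G j : int := if kept j then sgn_of (sN s2 i (cnt j)) else sgn_of (ext j.+1).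
have -> : \sum_(j < n) sgn_of (expand s2 (lift ord0 i, j)) = \sum_(0 <= j < n) G j.
  rewrite big_mkord; apply: eq_bigr => j _; rewrite -sNE /= /bump /= add1n sN_expand //=.
  by rewrite /G; case: ifP.
have -> : \sum_(c < cnt n) sgn_of (s2 (i, c)) = \sum_(0 <= c < cnt n) sgn_of (sN s2 i c).
  by rewrite big_mkord; apply: eq_bigr => c _; rewrite sNE.
(* A lost pair contributes -1 + 1 = 0; the correction records that only its left column has been
   summed so far. *)
have P c : \sum_(0 <= j < c) G j =
    \sum_(0 <= k < cnt c) sgn_of (sN s2 i k) - (if bend c then 1 else 0).
  elim: c => [|c IH]; first by rewrite !big_geq // /bend /= subr0.
  rewrite big_nat_recr //= IH cntS /G; case: (boolP (kept c)) => kc.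
    have [-> ->] := kept_bend kc.
    by rewrite addn1 big_nat_recr //= !subr0.
  rewrite addn0 -addrA; congr (_ + _); move: kc; rewrite /kept /bend.
  by case: (ext c) (ext c.+1) (ext c.+2) => [] [] [].
by rewrite P (bend_n en1) subr0.
Qed.

Lemma row_zero : ~ (pairs_top n ext (Conn T) /\ pairs_bot ext (Conn T)) ->
  \sum_(s | row_of s == w) summand T s = 0.
Proof.
move=> H; rewrite forced_sum big1 // => s /contractK <-.
rewrite /summand; case: realizesP => // r; case: H.
have sr := expand_row (contract s); have sl := @expand_lost (contract s).
exact: (realized_pairs e0 ext_out sr sl (@expand_kept (contract s)) (C := Conn T)).
Qed.

(** After [forced_sum] the states on both sides correspond by [expand]. As [rho] matches both the
    realized connections and the closed components, the weights differ by the first row alone. *)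
Lemma row_reduce (T2 : crossingless m (cnt n) (cnt n)) :
  pairs_top n ext (Conn T) -> pairs_bot ext (Conn T) ->
  io_spec n ext kap (Conn T) (Conn T2) ->
  \sum_(s | row_of s == w) summand T s =
  varA ^ (\sum_j sgn_of (w j)) * coeff (Conn T2).
Proof.
move=> pt pb sp; rewrite forced_sum (reindex_onto expand contract); last exact: contractK.
rewrite coeffE mulr_sumr.
rewrite (eq_bigl (fun=> true)); last by move=> s; rewrite expand_forced expandK eqxx.
rewrite [RHS]big_mkcond; apply: eq_bigr => s2 _; rewrite /summand.
have sr := expand_row s2; have sl := @expand_lost s2; have sk := @expand_kept s2.
have R := realized_reduce e0 ext_out sr sl sk (C := Conn T) (D := Conn T2)
  erefl erefl erefl erefl erefl erefl pt pb sp.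
have -> : realizes (expand s2) T = realizes s2 T2.
  by apply/realizesP/realizesP => /R.
case: ifP => // _; rewrite !state_weightE expo_expand (expfzDr _ _ varA_neq0) -mulrA.
congr (_ * (_ * _ ^+ _)).
have E u v : valid m.+1 n u -> valid m.+1 n v ->
  eqv m.+1 n (sN (expand s2)) u v <-> eqv m (cnt n) (sN s2) (rho ext m u) (rho ext m v).
  by apply: rho_eqv.
rewrite /n_closed -/(closed_pred (expand s2)) -/(closed_pred s2).
apply/eqP; rewrite eqn_leq; apply/andP; split.
  apply: (n_comp_le (r := fun u u' => rho ext m (pl u) = pl u')).
  - exact: smoothing_sym.
  - exact: smoothing_sym.
  - exact: closed_pred_closed.
  - move=> u /(@closed_predP _ _ (expand s2) u) cu.
    have cr := closed_rho e0 ext_out sr sl sk cu.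
    have [u' eu'] := valid_pl (proj1 cr).
    by exists u' => //; apply/(@closed_predP _ _ s2 u'); rewrite eu'.
  - move=> u v u' v' hu hv /connect_eqv h; apply/connect_eqv.
    by apply/E; rewrite ?pl_valid // hu hv.
apply: (n_comp_le (r := fun u' u => rho ext m (pl u) = pl u')).
- exact: smoothing_sym.
- exact: smoothing_sym.
- exact: closed_pred_closed.
- move=> u' /(@closed_predP _ _ s2 u') cu.
  have ci := closed_rho_inv e0 ext_out sr sl sk cu.
  have [u eu] := valid_pl (proj1 ci).
  exists u; first by apply/(@closed_predP _ _ (expand s2) u); rewrite eu.
  by rewrite eu; have [_ ->] := rho_inv_valid en1 (proj1 cu).
- move=> u' v' u v hu hv /connect_eqv h; apply/connect_eqv.
  by rewrite -hu -hv; apply/E; rewrite ?pl_valid.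
Qed.

End RowSum.

Lemma coeff_rows m n (T : crossingless m.+1 n n) :
  (coeff (Conn T) = \sum_w \sum_(s | row_of s == w) summand T s)%R.
Proof.
by rewrite coeffE big_mkcond (partition_big (@row_of m n) predT).
Qed.

(** * Plucking arcs at the top and stripping returns at the bottom *)

Section Pluck.
Variables (n : nat) (e : nat -> bool).
Hypotheses (e0 : e 0 = true) (en : forall g, n < g -> e g = false).

Let en1 : e n.+1 = false. Proof. exact: en. Qed.
Notation kept := (kept e).
Notation bend := (bend e).
Notation cnt := (cnt e).
Notation kap := (kap n e).
Notation zl := (zl n).
Notation io := (io n e).

Definition pluck_spec (R R2 : conn) : Prop :=
  [/\ ht R = (ht R2).+1, nt R2 = cnt n, nb R2 = nb R & io_spec n e id R R2].

(* Boundary rank counted from y_1 instead of x_1. *)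
Definition rpos (R : conn) (l : lab) : nat := if l is LL 0 then 0 else (cps R l).+1.

Lemma rpos_zl R g : nt R = n -> g <= n.+1 -> rpos R (zl g) = g.
Proof.
move=> nR; case: g => [|g] //= hg; case: eqP => [->|_] //=.
by rewrite nR addn0.
Qed.

(** Moving y_1 from the last place to the first is a rotation of the boundary word, so a crossing
    that starts at y_1 is a crossing that ends there. *)
Lemma rpos_noncross R h l l' : ht R = h.+1 -> cdom R l -> cdom R l' ->
  rpos R l < rpos R l' -> rpos R l' < rpos R (cm R l) ->
  rpos R (cm R l) < rpos R (cm R l') -> False.
Proof.
move=> hR d d'.
have last u : cdom R u -> u <> LL 0 -> cps R u < cps R (LL 0).
  by case: u => [i|i|[|i]|i] //=; lia.
have E u : u <> LL 0 -> rpos R u = (cps R u).+1 by case: u => [i|i|[|i]|i].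
have pos u v : rpos R u < rpos R v -> rpos R v = (cps R v).+1 /\ v <> LL 0.
  by case: v => [i|i|[|i]|i].
move=> k1 k2 k3; have [E1 n1] := pos _ _ k1; have [E2 n2] := pos _ _ k2.
have [E3 n3] := pos _ _ k3; rewrite E1 E2 in k2; rewrite E2 E3 in k3.
case: (altP (l =P LL 0)) => [El|/eqP nl]; last first.
  by rewrite E1 E // in k1; apply: (cm_noncross d d').
apply: (@cm_noncross R l' (cm R l)); rewrite ?cm_dom //.
rewrite cmK El; apply: last; rewrite ?cm_dom //.
Qed.

(** The points removed are joined to each other, so the others are closed under the matching and
    [restrict] applies. *)
Lemma pluck_exists R h : ht R = h.+1 -> nt R = n -> pairs_top n e R ->
  exists R2, pluck_spec R R2.
Proof.
move=> hR nR pt.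
have [||||R2 [h1 h2 h3 h4]] := @restrict R h (cnt n) (nb R) (io id) (rpos R).
- by move=> l l'; apply: (rpos_noncross hR).
- case=> i /= hi; rewrite ?hR ?nR //.
  by have [z _] := zeta_le hi; apply: zl_dom.
- have T i : i < cnt n -> rpos R (io id (LT i)) = zeta e (kap i) /\ zeta e (kap i) <= n.+1.
    by move=> hi; have [z _] := zeta_le hi; split=> //; exact: (rpos_zl nR z).
  move=> l l' d d'; case: l d => i hi; case: l' d' => j hj;
    rewrite /= in hi hj *; try (have [-> Zi] := T _ hi); try (have [-> Zj] := T _ hj);
    rewrite ?hR ?nR; try by lia.
  by move=> ij; apply: zeta_lt.
- move=> l d; have dR : cdom R (io id l).
    case: l d => i /= hi; rewrite ?hR ?nR //.
    by have [z _] := zeta_le hi; apply: zl_dom.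
  have Z g : g <= n.+1 -> cm R (io id l) = zl g ->
      exists2 l', dom h (cnt n) (nb R) l' & cm R (io id l) = io id l'.
    move=> hg E; case: (zl_cases e0 en hg) => [[c hc Ec]|[k [k1 k2 k3 k4]]].
      by exists (LT c); rewrite // E Ec.
    exfalso; have [a1 a2] := io_alive id d k1 k2 k3; have p := pt _ k1 k2 k3.
    move: E; case: k4 => ->; move/cm_eq_sym; first by rewrite p => /esym.
    by move/cm_eq_sym: p => -> /esym.
  have := cm_dom R (io id l); rewrite dR; case El: (cm R (io id l)) => [i|i|i|i] /= hi.
  + rewrite nR in hi; rewrite -El; apply: (Z i.+1); first by rewrite ltnS ltnW.
    by rewrite El /= (ltn_eqF hi).
  + by exists (LB i).
  + case: i El hi => [|i] El hi; first by rewrite -El; apply: (Z 0).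
    by exists (LL i); rewrite //= -ltnS -hR.
  + case: i El hi => [|i] El hi; last by exists (LR i); rewrite //= -ltnS -hR.
    by rewrite -El; apply: (Z n.+1); rewrite //= eqxx.
exists R2; split; rewrite ?h1 // => l; rewrite h1 h2 h3; exact: h4.
Qed.

(** K collects the returns facing down; every kept column is a through strand. *)
Definition bends_spec (K : conn) : Prop :=
  [/\ bottom_state K, nt K = cnt n, nb K = n,
      (forall c, c < cnt n -> cm K (LT c) = LB (kap c)) & pairs_bot e K].

Lemma bends_exists : exists K, bends_spec K.
Proof.
pose f l := match l with
  | LT c => LB (kap c)
  | LB j => if kept j then LT (cnt j) else if e j.+1 then LB j.-1 else LB j.+1
  | _ => l end.
have lostR j : ~~ kept j -> e j.+1 -> bend j.
  by rewrite /kept /bend => + h; rewrite h => ->.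
have lostL j : ~~ kept j -> ~~ e j.+1 -> bend j.+1.
  by rewrite /kept /bend => + h; rewrite (negbTE h) negbK => ->.
have bL c : bend c.+1 -> ~~ kept c /\ ~~ e c.+1.
  by rewrite /bend /kept => /andP [h1 h2]; rewrite (negbTE h1) h2.
have bR c : bend c -> ~~ kept c /\ e c.+1.
  by rewrite /bend /kept => /andP [h1 h2]; rewrite h2 h1.
have fL c : bend c -> f (LB c.-1) = LB c.
  move=> b; have /andP [h _] := bend_lt e0 en b; case: c h b => // c _ /bL [k1 k2].
  by rewrite /f /= (negbTE k1) (negbTE k2).
have fR c : bend c -> f (LB c) = LB c.-1.
  by move=> /bR [k1 k2]; rewrite /f (negbTE k1) k2.
have lost j : ~~ kept j -> exists c, bend c /\ (j = c.-1 \/ j = c).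
  move=> kj; case ej: (e j.+1); first by exists j; split; [apply: lostR | right].
  by exists j.+1; split; [apply: lostL; rewrite // ej | left].
have [||||K [h1 h2 h3 h4]] := @build 0 (cnt n) n f.
- case=> j //= hj; first by have [] := kapP hj.
  case: (boolP (kept j)) => kj /=; first exact: cnt_lt.
  have [c [b [E|E]]] := lost j kj; have := bend_lt e0 en b.
    have := fL _ b; rewrite -E /= (negbTE kj) => ->; by case/andP.
  by have := fR _ b; rewrite -E /= (negbTE kj) => -> /=; lia.
- case=> j //= hj.
    by have [_ kk ck] := kapP hj; rewrite kk ck.
  case: (boolP (kept j)) => kj; first by rewrite /= kap_cnt.
  have [c [b [E|E]]] := lost j kj.
    by have := fL _ b; rewrite -E /= (negbTE kj) => ->; have := fR _ b; rewrite -E.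
  by have := fR _ b; rewrite -E /= (negbTE kj) => ->; have := fL _ b; rewrite -E.
- case=> j //= hj; case: (boolP (kept j)) => kj //.
  have [c [b [E|E]]] := lost j kj; have := bend_lt e0 en b => bc.
    by have := fL _ b; rewrite -E /= (negbTE kj) => -> []; lia.
  by have := fR _ b; rewrite -E /= (negbTE kj) => -> []; lia.
- case=> i // [] j // hi hj /= k1 k2.
  + have mk : j < cnt n -> i < j -> kap i < kap j by move=> h h'; exact: kap_lt h' (ltnW h).
    have [? _ _] := kapP hi; have [? _ _] := kapP hj; have := mk hj k1; lia.
  + have [? ki _] := kapP hi; rewrite /= in hi hj.
    case: (boolP (kept j)) => kj /=; first by have := cnt_lt hj kj; lia.
    have [c [b [E|E]]] := lost j kj; have bc := bend_lt e0 en b.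
      have := fL _ b; rewrite -E /= (negbTE kj) => -> /= k3.
      have ? : kap i != c by apply/eqP => E'; have [k _] := bR _ b; rewrite -E' ki in k.
      lia.
    have := fR _ b; rewrite -E /= (negbTE kj) => -> /= k3.
    by lia.
  + by rewrite /= in hi hj; lia.
  + rewrite /= in hi hj; move: k2; case: (boolP (kept i)) => ki /=.
      by have := cnt_lt hi ki; lia.
    have [c [b [E|E]]] := lost i ki; have bc := bend_lt e0 en b.
      by have := fL _ b; rewrite -E /= (negbTE ki) => -> /=; lia.
    by have := fR _ b; rewrite -E /= (negbTE ki) => -> /=; lia.
exists K; split=> //.
- apply: bottom_stateI => //; apply/no_top_returnP => i; rewrite h2 => hi.
  by rewrite h4.
- by move=> c hc; rewrite h4.
- move=> c b; have := bend_lt e0 en b => bc.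
  by rewrite h4 ?fL //=; lia.
Qed.

Lemma bends_pairs K G' G : bends_spec K -> stack_spec G' K G -> pairs_bot e G.
Proof.
move=> [bK nK bbK cK pK] sp c b; have bc := bend_lt e0 en b.
have d : cdom K (LB c.-1) by rewrite /= bbK; lia.
by have := stack_tau sp d isT; rewrite pK //= => ->.
Qed.

Lemma strip_bends K G : bends_spec K -> nb G = n -> pairs_bot e G ->
  exists2 G', stack_spec G' K G & nb G' = nt K.
Proof.
move=> [bK nK bbK cK pK] nG pG; have hK := bottom_ht bK.
pose i2 l := if l is LB c then LB (kap c) else l.
have i2d l : dom (ht G) (nt G) (cnt n) l -> cdom G (i2 l).
  by case: l => //= c /kapP []; rewrite nG.
have [||||G' [h1 h2 h3 h4]] := @restrict G (ht G) (nt G) (cnt n) i2 (cps G).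
- exact: cm_noncross.
- exact: i2d.
- case=> i [] j //= hi hj; rewrite ?nG; try (have [? _ _] := kapP hi);
    try (have [? _ _] := kapP hj); try lia.
  have : j < i -> kap j < kap i by move=> h; exact: kap_lt h (ltnW hi).
  by lia.
- move=> l d; have := cm_dom G (i2 l); rewrite i2d //.
  case E: (cm G (i2 l)) => [i|i|i|i] /= hi; try by [exists (LT i) | exists (LL i) | exists (LR i)].
  rewrite nG in hi; case: (boolP (kept i)) => ki.
    by exists (LB (cnt i)); rewrite /= ?cnt_lt ?kap_cnt.
  exfalso; have k j : i2 l = LB j -> kept j.
    by case: l d {E} => //= c /kapP [_ ? _] [<-].
  move/cm_eq_sym: E => E; move: ki; rewrite /kept; case ei: (e i.+1) => ki.
    have b : bend i by rewrite /bend ki ei.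
    have := pG _ b; move/cm_eq_sym; rewrite E => /k.
    have := bend_lt e0 en b; case: (i) b => // i' + _.
    by rewrite /bend /kept /= => /andP [h5 h6]; rewrite (negbTE h5) h6.
  have b : bend i.+1 by rewrite /bend ei -[e i.+2]negbK ki.
  have := pG _ b; rewrite /= E => /k.
  by move: b; rewrite /bend /kept => /andP [h5 h6]; rewrite h6 (negbTE h5).
exists G'; last by rewrite h3 nK.
have sgE l : dom (ht G) (nt G) (cnt n) l -> sg G' K l = i2 l.
  by case: l => //= c hc; rewrite cK.
split.
- by rewrite h1 hK addn0.
- by rewrite h2.
- by rewrite bbK.
- move=> l; rewrite (domE _ h1 h2 h3) => d; rewrite !sgE ?h4 //.
  by rewrite -(domE _ h1 h2 h3) cm_dom (domE _ h1 h2 h3).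
- move=> l d tl tcl; have [[i hi E]|[i hi E]] := bottom_dom bK d; first by rewrite E in tl.
  subst l; rewrite bbK in hi; case: (boolP (kept i)) => ki.
    exfalso; have := cK _ (cnt_lt hi ki); rewrite kap_cnt // => /cm_eq_sym E.
    by rewrite E in tcl.
  move: ki; rewrite /kept; case ei: (e i.+1) => ki.
    have b : bend i by rewrite /bend ki ei.
    have E1 := pK _ b; have E2 := pG _ b; move/cm_eq_sym: E1 => /= ->.
    by move/cm_eq_sym: E2.
  have b : bend i.+1 by rewrite /bend ei -[e i.+2]negbK ki.
  by have E1 := pK _ b; have E2 := pG _ b; rewrite /= in E1 E2 *; rewrite E1 E2.
Qed.

Section Stacked.
Variables (R G C : conn) (h : nat).
Hypotheses (hR : ht R = h.+1) (nR : nt R = n) (rR : no_bot_return R).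
Hypotheses (fG : no_top_return G) (nG : nb G = n) (eRG : nb R = nt G).
Hypothesis sC : stack_spec R G C.

Lemma zl_cdom g : g <= n.+1 -> cdom R (zl g).
Proof.
by move=> hg; rewrite hR nR; apply: zl_dom.
Qed.

Lemma sg_zl g : sg R G (zl g) = zl g.
Proof. by case: g => [|g] //=; case: eqP. Qed.

Lemma sg_eq_zl u g : g <= n.+1 -> cdom R u -> sg R G u = zl g -> u = zl g.
Proof.
by move=> hg du E; apply: (@sg_injective R G) => //; rewrite ?zl_cdom ?sg_zl.
Qed.

Lemma stack_pairs_top : pairs_top n e C <-> pairs_top n e R.
Proof.
split=> H g hg h1 h2; have := H g hg h1 h2.
  rewrite -{1}sg_zl (stack_sg sC) ?zl_cdom // 1?ltnW // => /sg_eq_zl; apply=> //.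
  by rewrite cm_dom zl_cdom // ltnW.
by move=> E; rewrite -{1}sg_zl (stack_sg sC) ?zl_cdom 1?ltnW // E sg_zl.
Qed.

(** R has no bottom return, so a bottom return of the product cannot pass through R and is one of
    G. *)
Lemma stack_pairs_bot : pairs_bot e C <-> pairs_bot e G.
Proof.
split=> H c b; have := H c b; have bc := bend_lt e0 en b.
  have d : cdom G (LB c.-1) by rewrite /= nG; lia.
  case: (boolP (top_lab (cm G (LB c.-1)))) => t.
    case E: (cm G (LB c.-1)) t => [i|||] // _.
    have := cm_dom G (LB c.-1); rewrite d E /= -eRG => hi.
    have := stack_sg sC (l := LB i) hi; rewrite /=.
    move/cm_eq_sym: (E) => -> /= -> .
    have := no_bot_returnP _ rR _ hi; case: (cm R (LB i)) => //=.
  have := stack_tau sC d isT t; rewrite /= => -> E; apply: (@tau_inj (ht R)); exact: E.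
have d : cdom G (LB c.-1) by rewrite /= nG; lia.
by move=> E; have := stack_tau sC d isT; rewrite E /=; apply.
Qed.

Variables R2 G2 K D : conn.
Hypotheses (pR : pluck_spec R R2) (bK : bends_spec K) (sG : stack_spec G2 K G).
Hypotheses (eG2 : nb G2 = nt K) (sD : stack_spec R2 G2 D).

Let hR2 : ht R2 = h. Proof. by case: pR; rewrite hR => -[]. Qed.
Let fG2 : no_top_return G2. Proof. exact: stack_floor_inv sG fG. Qed.
Let e2 : nb R2 = nt G2. Proof. by case: pR => _ _ -> _; rewrite eRG (stack_nt sG). Qed.

Let io_tau v : cdom G2 v -> ~~ top_lab v ->
  io kap (tau h v) = tau h.+1 (sg G2 K v).
Proof.
case: bK => _ nK _ cK _; case: v => //= i hi _; try by rewrite addSn.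
by rewrite cK // -nK -eG2.
Qed.

Let io_sg u : cdom R2 u -> io kap (sg R2 G2 u) = sg R G (io id u).
Proof.
case: u => i //= hi; first by rewrite sg_zl.
have hi' : i < nt G2 by rewrite -e2.
rewrite hR2 hR io_tau ?cm_dom //; last exact: (no_top_returnP _ fG2).
by rewrite -(stack_sg sG).
Qed.

(** Removing the first row commutes with stacking: the product is plucked in R and stripped in G. *)
Lemma stack_io : io_spec n e kap C D.
Proof.
have [_ _ _ sR] := pR.
have dio u : cdom R2 u -> cdom R (io id u).
  case: pR => _ n2 b2 _; case: u => i /=; rewrite ?hR2 ?hR ?b2 //.
  rewrite n2 => hi; have [z _] := zeta_le hi; by have := zl_cdom z; rewrite hR.
move=> l /(stack_specP fG2 e2 sD) [[u du ->]|[v [dv tv tcv ->]]].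
  by rewrite io_sg // (stack_sg sC) ?dio // sR // (stack_sg sD) // io_sg ?cm_dom.
rewrite (stack_tau sD) // hR2 !io_tau ?cm_dom // -hR.
have dsv : cdom G (sg G2 K v).
  rewrite (domE _ (stack_ht sG) (stack_nt sG) (stack_nb sG)); apply: sg_dom => //.
  by case: bK => /bottom_floor.
have nts w : cdom G2 w -> ~~ top_lab w -> ~~ top_lab (sg G2 K w).
  case: bK => /bottom_floor fK nK _ cK _; case: w => //= i hi _.
  by rewrite top_tau; apply: (no_top_returnP _ fK); rewrite -eG2.
by rewrite (stack_tau sC) // ?(stack_sg sG) // ?nts ?cm_dom.
Qed.

End Stacked.
End Pluck.

Lemma conn_cast C m a b : ht C = m -> nt C = a -> nb C = b ->
  exists T : crossingless m a b, C = Conn T.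
Proof. by case: C => m' a' b' T /= <- <- <-; exists T. Qed.

Lemma pluck_roof n e R R2 : pluck_spec n e R R2 -> no_bot_return R -> no_bot_return R2.
Proof.
case=> _ _ eb io rR; apply/no_bot_returnP => i hi; have := io (LB i) hi; rewrite /=.
have := no_bot_returnP _ rR i; rewrite -eb => /(_ hi).
by case: (cm R2 (LB i)) => //= j h e'; rewrite e' in h.
Qed.

(** Stripping [B1 = K *_v B] is stripping B and then K, by associativity. *)
Lemma strip_two K B B1 F G' : bottom_state K -> bottom_state B -> nb K = nt B ->
  stack_spec K B B1 -> vprod1 G' B1 = Some F ->
  exists2 G, stack_spec G' K G & vprod1 G B = Some F.
Proof.
move=> bK bB e s v; have fK := bottom_floor bK; have fB := bottom_floor bB.
have bB1 := stack_bottom bK bB e s.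
have e1 : nb G' = nt K by rewrite (vprod1_nb v) (stack_nt s).
have [G sG] := stack_exists fK e1; exists G => //.
have eG : nb G = nt B by rewrite (stack_nb sG).
have [F' sF'] := stack_exists fB eG.
have sA := stack_assoc fK fB e1 e sG sF' s.
have -> : F = F'; last exact: spec_vprod1.
apply: (stack_spec_uniq _ (vprod1_nb v) (vprod1_spec _ v) sA); exact: bottom_floor.
Qed.

Lemma strip_two_inv K B B1 F G G' : bottom_state K -> bottom_state B -> nb K = nt B ->
  stack_spec K B B1 -> nb G' = nt K -> stack_spec G' K G -> vprod1 G B = Some F ->
  vprod1 G' B1 = Some F.
Proof.
move=> bK bB e s e1 sG v; have bB1 := stack_bottom bK bB e s.
apply: spec_vprod1; rewrite ?bottom_floor ?(stack_nt s) //.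
by apply: stack_assoc sG (vprod1_spec _ v) s => //; apply: bottom_floor.
Qed.

Local Open Scope ring_scope.

Lemma bracket_nocat C : nt C != nb C -> bracket (Some C) = 0.
Proof. by rewrite /bracket /is_catalan => /negbTE ->. Qed.

Lemma ThetaE R B F : bottom_state B -> nb F = nb B ->
  Theta (R, phi B) (Some F) =
  if strip1 F (phi B) is Some G then bracket (vprod1 R G) else 0.
Proof. by move=> bB e; rewrite /Theta /=; case: (strip1 F (phi B)). Qed.

Lemma vprod1_dims C1 C2 T : vprod1 C1 C2 = Some T ->
  [/\ ht T = (ht C1 + ht C2)%N, nt T = nt C1 & nb T = nb C2].
Proof.
rewrite /vprod1; case: eqP => // _; case: pickP => //= f _ [<-]; by split.
Qed.

Lemma strip1_dims F I G : strip1 F I = Some G ->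
  exists B, [/\ bottom_state B, nb B = nb F, phi B = I & nb G = nt B].
Proof.
rewrite /strip1; case e: (phi_inv (nb F) I) => [B|] //; case: pickP => //= T _ [<-].
by exists B; have [b1 b2 b3] := (phi_invP _ _ _).1 e.
Qed.

(** The product can be a Catalan state only if n_b(F) = n_t(R) + 2|I|. *)
Lemma Theta_nb R B F : bottom_state B -> nt R = nt B -> nb F <> nb B ->
  Theta (R, phi B) (Some F) = 0.
Proof.
move=> bB e ne; rewrite /Theta /=; case eG: (strip1 F (phi B)) => [G|] //=.
case ev: (vprod1 R G) => [C|] //.
have [B' [bB' nB' pB' nG]] := strip1_dims eG; have [_ nC bC] := vprod1_dims ev.
apply: bracket_nocat; apply/eqP => E; apply: ne.
by rewrite -nB' (phi_card bB') (phi_card bB) pB' -nG -bC -E nC e.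
Qed.

(** * The first-row relation between the functions Theta *)

Section Relation.
Variables (R B : conn) (h : nat).
Hypotheses (hR : ht R = h.+1) (rR : no_bot_return R).
Hypotheses (bB : bottom_state B) (nRB : nt R = nt B).

Let n := nt R.
Let word := {ffun 'I_n -> bool}.

(** [B1] carries the new index set. [None] stands for a word that contributes nothing, because R
    lacks the arc at some change + -. *)
Definition word_data (w : word) (d : option conn * conn * conn) : Prop :=
  let: (o, K, B1) := d in
  [/\ bends_spec n (ext w) K, stack_spec K B B1 &
      if o is Some R2 then pairs_top n (ext w) R /\ pluck_spec n (ext w) R R2
      else ~ pairs_top n (ext w) R].

Lemma word_data_exists w : exists d, word_data w d.
Proof.
have en := @ext_out n w.
have [K bK] := bends_exists (erefl : ext w 0%N = true) en.
have [B1 sB1] : exists B1, stack_spec K B B1.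
  by apply: stack_exists; [apply: bottom_floor | case: bK => _ _ -> _ _].
have [pt|npt] : pairs_top n (ext w) R \/ ~ pairs_top n (ext w) R.
  pose b := [forall g : 'I_n.+1, ext w g && ~~ ext w g.+1 ==>
                                (cm R (zl n g) == zl n g.+1)].
  case: (boolP b) => hb; [left | right].
    move=> g hg h1 h2; have /forallP/(_ (Ordinal (hg : (g < n.+1)%N))) := hb.
    by rewrite /= h1 h2 => /eqP.
  move=> H; move/negP: hb; apply; apply/forallP => g; apply/implyP => /andP [h1 h2].
  by apply/eqP; apply: H => //; rewrite -ltnS.
have [R2 pR2] := pluck_exists (erefl : ext w 0%N = true) en hR (erefl n) pt.
  by exists (Some R2, K, B1).
by exists (None, K, B1).
Qed.

(** The first row of [R *_v G] lies in R, so the data serve all F at once. F matters only in whether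
    the returns of K are present in G; if they are not, the sum over the states with this first row
    vanishes, as does Theta on the right. *)
Lemma Theta_relation (d : word -> option conn * conn * conn) :
  (forall w, word_data w (d w)) -> forall F, floor_or_K0 F ->
  Theta (R, phi B) F =
  \sum_w (if (d w).1.1 is Some R2
          then varA ^ (\sum_j sgn_of (w j)) * Theta (R2, phi (d w).2) F else 0).
Proof.
move=> hd [F|] fF; last first.
  rewrite /Theta /= big1 // => w _; by case: (d w).1.1 => //= R2; rewrite mulr0.
have bB1 w : bottom_state (d w).2.
  have := hd w; case: (d w) => -[o K] B1 /= [[bK _ nK _ _] s _].
  by apply: (stack_bottom bK bB) s; rewrite nK.
have nbB1 w : nb (d w).2 = nb B.
  by have := hd w; case: (d w) => -[o K] B1 /= [_ s _]; rewrite (stack_nb s).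
case: (eqVneq (nb F) (nb B)) => [eF|/eqP ne]; last first.
  rewrite Theta_nb // big1 // => w _; have := hd w; have := bB1 w; have := nbB1 w.
  case: (d w) => -[[R2|] K] B1 //= nB1 bB' [bK s [_ [_ n2 _ _]]].
  rewrite Theta_nb ?mulr0 //; last by rewrite nB1.
  by rewrite n2 (stack_nt s); case: bK.
rewrite ThetaE //; case eG: (strip1 F (phi B)) => [G|]; last first.
  rewrite big1 // => w _; have := hd w; have := bB1 w; have := nbB1 w.
  case: (d w) => -[[R2|] K] B1 //= nB1 bB' [[bK _ nK _ _] s _].
  rewrite ThetaE ?nB1 //; case eG': (strip1 F (phi B1)) => [G'|]; last by rewrite mulr0.
  exfalso; have {}eG' : vprod1 G' B1 = Some F by apply/strip1P; rewrite // nB1.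
  have [G _ v] := strip_two bK bB (etrans nK nRB) s eG'.
  by have /strip1P : vprod1 G B = Some F := v; rewrite eG => /(_ bB eF).
have vG : vprod1 G B = Some F by apply/strip1P.
have sG := vprod1_spec (bottom_floor bB) vG.
have fG : no_top_return G by apply: stack_floor_inv sG fF.
have nG : nb G = n by rewrite (vprod1_nb vG).
case: (eqVneq (nb R) (nt G)) => [eRG|ne]; last first.
  rewrite /vprod1 (negbTE ne) /= big1 // => w _; have := hd w; have := bB1 w; have := nbB1 w.
  case: (d w) => -[[R2|] K] B1 //= nB1 bB' [bK s [_ [_ _ b2 _]]].
  rewrite ThetaE ?nB1 //; case eG': (strip1 F (phi B1)) => [G'|]; last by rewrite mulr0.
  have {}eG' : vprod1 G' B1 = Some F by apply/strip1P; rewrite // nB1.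
  have sG' := vprod1_spec (bottom_floor bB') eG'.
  by rewrite /vprod1 b2 -(stack_nt sG') (stack_nt sG) (negbTE ne) mulr0.
have [C sC] := stack_exists fG eRG.
rewrite (spec_vprod1 fG eRG sC).
have hC : ht C = (h + ht G).+1 by rewrite (stack_ht sC) hR.
have nC : nt C = n by rewrite (stack_nt sC).
have bC : nb C = n by rewrite (stack_nb sC).
have [T ET] := conn_cast hC nC bC.
rewrite /bracket /is_catalan nC bC eqxx ET coeff_rows; apply: eq_bigr => w _.
have := hd w; have := bB1 w; have := nbB1 w.
have en := @ext_out n w.
have pt : pairs_top n (ext w) C <-> pairs_top n (ext w) R.
  exact: (stack_pairs_top _ hR (erefl n) fG eRG sC).
have pb : pairs_bot (ext w) C <-> pairs_bot (ext w) G.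
  exact: (stack_pairs_bot (erefl : ext w 0%N = true) en hR (erefl n) rR fG nG eRG sC).
case: (d w) => -[[R2|] K] B1 /= nB1 bB' [bK s]; last first.
  by move=> npt; apply: row_zero => -[/=]; rewrite -ET pt.
move=> [pR pR2]; have eK : nb K = nt B by case: bK => _ _ -> _ _.
have btK : bottom_state K by case: bK.
rewrite ThetaE ?nB1 //; case eG': (strip1 F (phi B1)) => [G'|]; last first.
  rewrite mulr0; apply: row_zero => -[_]; rewrite -ET pb => pbG.
  have [G' sG' eG2] := strip_bends (erefl : ext w 0%N = true) en bK nG pbG.
  have /strip1P := strip_two_inv btK bB eK s eG2 sG' vG.
  by rewrite eG' nB1 => /(_ bB' eF).
have {}eG' : vprod1 G' B1 = Some F by apply/strip1P; rewrite // nB1.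
have [G2 sG2 vG2] := strip_two btK bB eK s eG'.
have EG : G2 = G by apply: strip_uniq vG2 vG.
subst G2; have eG2 : nb G' = nt K by rewrite (vprod1_nb eG') (stack_nt s).
have fG' : no_top_return G' by apply: stack_floor_inv sG2 fG.
have e2 : nb R2 = nt G' by case: pR2 => _ _ -> _; rewrite eRG (stack_nt sG2).
have [D sD] := stack_exists fG' e2.
rewrite (spec_vprod1 fG' e2 sD).
have hD : ht D = (h + ht G)%N.
  by rewrite (stack_ht sD) (stack_ht sG2) (bottom_ht btK) addn0;
     case: pR2; rewrite hR => -[->].
have nD : nt D = cnt (ext w) n by rewrite (stack_nt sD); case: pR2.
have bD : nb D = cnt (ext w) n by rewrite (stack_nb sD) eG2; case: bK.
have [T2 ET2] := conn_cast hD nD bD.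
rewrite /= /is_catalan nD bD eqxx ET2; apply: row_reduce; rewrite -ET -?ET2.
- exact/pt.
- exact/pb/(bends_pairs (erefl : ext w 0%N = true) en bK sG2).
- exact: (@stack_io n _ R G C h hR (erefl n) fG eRG sC R2 G' K D pR2 bK sG2 eG2 sD).
Qed.

End Relation.

Local Close Scope ring_scope.

(** * Rotating the top side of a roof state *)

Definition minus_word n : {ffun 'I_n -> bool} := [ffun=> false].

Lemma ext_minus n g : ext (minus_word n) g = (g == 0).
Proof.
case: g => [//|g] /=; rewrite /ext; case: insubP => // j _ _; by rewrite ffunE.
Qed.

Lemma kept_minus n j : kept (ext (minus_word n)) j.
Proof. by rewrite /kept !ext_minus. Qed.

Lemma all_kept n e : (forall j, j < n -> kept e j) ->
  cnt e n = n /\ forall c, c <= n -> kap n e c = c.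
Proof.
move=> H; have E c : c <= n -> cnt e c = c.
  by elim: c => // c IH hc; rewrite cntS IH ?H ?addn1 // ltnW.
split; first exact: E.
move=> c; rewrite leq_eqVlt => /predU1P [->|hc]; first by rewrite -{2}(E n) // kap_n.
by rewrite -{1}(E c) ?kap_cnt ?H // ltnW.
Qed.

Lemma cnt_full n e : cnt e n = n -> forall j, j < n -> kept e j.
Proof.
move=> E j hj; rewrite /cnt in E.
have : all (kept e) (iota 0 n) by rewrite all_count E size_iota.
by move/allP; apply; rewrite mem_iota.
Qed.

(** The place of a point of T after one rotation: x_n leaves the window as the new y'_1, and the
    points of both sides move down by one. *)
Definition rot_lab n (l : lab) : lab :=
  match l with
  | LT c => if c.+1 == n then LR 0 else LT c.+1
  | LB i => LB i
  | LL i => LL i.+1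
  | LR i => LR i.+1
  end.

Lemma io_minus n l : (if l is LT c then c < n else true) ->
  io n (ext (minus_word n)) id l = rot_lab n l.
Proof.
case: l => //= c hc.
have [_ ->] : cnt (ext (minus_word n)) n = n /\ _ := all_kept (fun j _ => kept_minus n j).
  by rewrite /zeta ext_minus.
exact: ltnW.
Qed.

Definition rotated (M T : conn) : bool :=
  [&& ht M == (ht T).+1, nt M == nt T, nb M == nb T, cm M (LL 0) == LT 0 &
     [forall p : bpt (ht T) (nt T) (nb T),
        cm M (rot_lab (nt T) (lab_of p)) == rot_lab (nt T) (cm T (lab_of p))]].

Lemma rotatedP M T : reflect
  [/\ ht M = (ht T).+1, nt M = nt T, nb M = nb T, cm M (LL 0) = LT 0 &
     forall l, cdom T l -> cm M (rot_lab (nt T) l) = rot_lab (nt T) (cm T l)]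
  (rotated M T).
Proof.
apply: (iffP and5P) => [[/eqP h1 /eqP h2 /eqP h3 /eqP h4 /forallP h5]|[-> -> -> -> h5]].
  by split=> // l /dom_lab_of [p <-]; apply/eqP.
by split=> //; apply/forallP => p; apply/eqP/h5/lab_of_dom.
Qed.

Lemma rotated_exists T : 0 < nt T -> exists M, rotated M T.
Proof.
move=> n0; pose n := nt T; pose h := ht T; pose b := nb T.
pose dn l := match l with
  | LT c => LT c.-1 | LB i => LB i | LL i => LL i.-1
  | LR i => if i is j.+1 then LR j else LT n.-1 end.
pose f l := if l == LL 0 then LT 0 else if l == LT 0 then LL 0
            else rot_lab n (cm T (dn l)).
have rd l : cdom T l -> [/\ dom h.+1 n b (rot_lab n l), rot_lab n l != LL 0,
    rot_lab n l != LT 0, dn (rot_lab n l) = l &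
    lpos h.+1 n b (rot_lab n l) = (cps T l).+1].
  case: l => i /=; rewrite -/n -/h -/b => hi; rewrite ?lab_eqE //.
  - by case: eqP => E; rewrite ?lab_eqE /=; split=> //; rewrite -?E //; lia.
  - by split=> //; lia.
  - by split=> //; lia.
  - by split=> //; lia.
have cs l : dom h.+1 n b l -> [\/ l = LL 0, l = LT 0 | exists2 u, cdom T u & l = rot_lab n u].
  case: l => [[|i]|i|[|i]|[|i]] /= hi; try by [constructor 1 | constructor 2].
  - by constructor 3; exists (LT i); rewrite /= ?(ltn_eqF hi) //; apply: ltnW.
  - by constructor 3; exists (LB i).
  - by constructor 3; exists (LL i).
  - by constructor 3; exists (LT n.-1); rewrite /= ?prednK ?eqxx.
  - by constructor 3; exists (LR i).
have fr u : cdom T u -> f (rot_lab n u) = rot_lab n (cm T u).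
  by move=> /rd [_ /negbTE h1 /negbTE h2 h3 _]; rewrite /f h1 h2 h3.
have fL : f (LL 0) = LT 0 by [].
have fT : f (LT 0) = LL 0 by [].
have pL : lpos h.+1 n b (LL 0) = n + h + b + h.+1 by rewrite /=; lia.
have pT : lpos h.+1 n b (LT 0) = 0 by [].
have lt u : cdom T u -> cps T u < n + b + h + h by apply: lpos_lt.
have [||||M [h1 h2 h3 h4]] := @build h.+1 n b f.
- move=> l /cs [->|->|[u du ->]] //.
  by rewrite fr //; case: (rd (cm T u)); rewrite ?cm_dom.
- by move=> l /cs [->|->|[u du ->]] //; rewrite !fr ?cm_dom // cmK.
- move=> l /cs [->|->|[u du ->]] //; rewrite fr // => E.
  have [_ _ _ e1 _] := rd _ du; have := rd (cm T u); rewrite cm_dom => /(_ du) [_ _ _ e2 _].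
  by have := cm_neq du; rewrite -e2 E e1 eqxx.
- have K u : cdom T u -> lpos h.+1 n b (rot_lab n (cm T u)) = (cps T (cm T u)).+1.
    by move=> du; have := rd (cm T u); rewrite cm_dom => /(_ du) [].
  move=> l l' /cs [->|->|[u du ->]] /cs [->|->|[v dv ->]];
    rewrite ?fL ?fT ?pL ?pT ?fr ?K //; try lia;
    try (have [_ _ _ _ ->] := rd _ du); try (have [_ _ _ _ ->] := rd _ dv);
    try (have := lt _ du); try (have := lt _ dv); try (have := lt (cm T u));
    try (have := lt (cm T v)); rewrite ?cm_dom ?du ?dv; try lia.
  rewrite !ltnS => *; exact: (cm_noncross du dv).
exists M; apply/rotatedP; split=> //; first by rewrite h4.
by move=> l dl; rewrite h4 ?fr //; case: (rd _ dl).
Qed.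

(** The value T is a dummy, never taken when n_t(T) > 0. *)
Definition rotate (T : conn) : conn :=
  if [pick M : crossingless (ht T).+1 (nt T) (nb T) | rotated (Conn M) T] is Some M
  then Conn M else T.

Lemma rotate_rotated T : 0 < nt T -> rotated (rotate T) T.
Proof.
move=> n0; rewrite /rotate; case: pickP => [M //|H].
have [M hM] := rotated_exists n0; have [e1 e2 e3 _ _] := rotatedP _ _ hM.
by have [X E] := conn_cast e1 e2 e3; rewrite E in hM; rewrite H in hM.
Qed.

Lemma rot_lab_inj n l l' : (if l is LT c then c < n else true) ->
  (if l' is LT c then c < n else true) -> rot_lab n l = rot_lab n l' -> l = l'.
Proof.
case: l => i; case: l' => j //= hi hj; try (by case: eqP); try (by case => ->).
case: eqP => a; case: eqP => b //; last by case=> ->.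
by move=> _; congr LT; lia.
Qed.

Lemma cdom_top C l : cdom C l -> if l is LT c then c < nt C else true.
Proof. by case: l. Qed.

Lemma rotated_uniq M M' T : 0 < nt T -> rotated M T -> rotated M' T -> M = M'.
Proof.
move=> n0 /rotatedP [h1 h2 h3 h4 h5] /rotatedP [k1 k2 k3 k4 k5].
apply: conn_ext; try congruence.
move=> l; rewrite (domE _ h1 h2 h3) => d.
have [->|[->|[u du ->]]] : l = LL 0 \/ l = LT 0 \/ exists2 u, cdom T u & l = rot_lab (nt T) u.
  case: l d => [[|i]|i|[|i]|[|i]] /= hi; try by [left | right; left].
  - by right; right; exists (LT i); rewrite /= ?(ltn_eqF hi) //; apply: ltnW.
  - by right; right; exists (LB i).
  - by right; right; exists (LL i).
  - by right; right; exists (LT (nt T).-1); rewrite /= ?prednK ?eqxx.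
  - by right; right; exists (LR i).
- by rewrite h4 k4.
- by move/cm_eq_sym: h4 => ->; move/cm_eq_sym: k4.
- by rewrite h5 // k5.
Qed.

Lemma rotated_uniq_inv M T T' : rotated M T -> rotated M T' -> T = T'.
Proof.
move=> /rotatedP [h1 h2 h3 h4 h5] /rotatedP [k1 k2 k3 k4 k5].
have e1 : ht T = ht T' by lia.
have e2 : nt T = nt T' by lia.
have e3 : nb T = nb T' by lia.
apply: conn_ext => // l dl; have dl' : cdom T' l by rewrite -(domE _ e1 e2 e3).
have c1 := @cdom_top T (cm T l); rewrite cm_dom in c1.
have c2 := @cdom_top T' (cm T' l); rewrite cm_dom in c2; have {}c2 := c2 dl'.
rewrite -e2 in c2; apply: (@rot_lab_inj (nt T) _ _ (c1 dl) c2).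
by rewrite -h5 // e2 k5 // -(domE _ e1 e2 e3).
Qed.

Lemma minus_word_rotated n M T : 0 < n -> nt M = n ->
  pluck_spec n (ext (minus_word n)) M T -> pairs_top n (ext (minus_word n)) M ->
  rotated M T.
Proof.
move=> n0 nM [h1 h2 h3 h4] pt.
have [E _] : cnt (ext (minus_word n)) n = n /\ _ := all_kept (fun j _ => kept_minus n j).
rewrite E in h2; apply/rotatedP; split=> //; first by rewrite h2.
  have := pt 0 (leq0n n); rewrite !ext_minus => /(_ isT isT) -> /=.
  by rewrite (ltn_eqF n0).
move=> l dl; rewrite h2; have c1 := cdom_top dl.
have c2 := @cdom_top T (cm T l); rewrite cm_dom in c2; have {}c2 := c2 dl.
by rewrite h2 in c1 c2; have := h4 l dl; rewrite !io_minus.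
Qed.

Lemma rotated_pairs M T : 0 < nt T -> rotated M T ->
  pairs_top (nt T) (ext (minus_word (nt T))) M.
Proof.
move=> n0 /rotatedP [_ _ _ h _] g hg; rewrite !ext_minus => /eqP -> _ /=.
by rewrite (ltn_eqF n0).
Qed.

Lemma rotated_roof M T : rotated M T -> no_bot_return T -> no_bot_return M.
Proof.
move=> /rotatedP [_ _ h3 _ h5] r; apply/no_bot_returnP => i; rewrite h3 => hi.
have := h5 (LB i) hi => /= ->; have := no_bot_returnP _ r i hi.
by case: (cm T (LB i)) => //= j _; case: ifP.
Qed.

Section Iterate.
Variable T : conn.
Hypothesis n0 : 0 < nt T.

Lemma iter_rotate_dims d : [/\ ht (iter d rotate T) = ht T + d,
  nt (iter d rotate T) = nt T & nb (iter d rotate T) = nb T].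
Proof.
elim: d => [|d [e1 e2 e3]]; first by rewrite addn0.
have n0' : 0 < nt (iter d rotate T) by rewrite e2.
have /rotatedP [f1 f2 f3 _ _] := rotate_rotated n0'.
by rewrite /= f1 f2 f3 e1 addnS.
Qed.

Lemma iter_rotated d : rotated (iter d.+1 rotate T) (iter d rotate T).
Proof. by apply: rotate_rotated; have [_ -> _] := iter_rotate_dims d. Qed.

Lemma iter_rotate_roof d : no_bot_return T -> no_bot_return (iter d rotate T).
Proof. by move=> r; elim: d => // d; apply: rotated_roof (iter_rotated d). Qed.

(** Each rotation puts a point joined to y_1 in front and shifts the others; a point not joined to
    the top keeps that property. *)
Lemma iter_rotate_top d c : c < d -> c < nt T -> ~~ top_lab (cm (iter d rotate T) (LT c)).
Proof.
elim: d c => // d IH c hc hcn; have /rotatedP [_ _ _ h4 h5] := iter_rotated d.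
case: c hc hcn => [|c] hc hcn; first by move/cm_eq_sym: h4 => ->.
have [_ e2 _] := iter_rotate_dims d; rewrite e2 in h5.
have hc' := ltnW hcn; have := h5 (LT c); rewrite /= (ltn_eqF hcn) => -> //.
by have := IH c hc hc'; case: (cm _ (LT c)).
Qed.

Lemma iter_rotate_middle : no_bot_return T -> middle_state (iter (nt T) rotate T).
Proof.
move=> r; apply/andP; split; last exact: iter_rotate_roof.
apply/no_top_returnP => c; have [_ -> _] := iter_rotate_dims (nt T) => hc.
exact: iter_rotate_top.
Qed.

End Iterate.

Local Open Scope ring_scope.

(** * Expansions *)

Local Notation marked := (conn * {fset nat})%type.

(** A list, possibly with repetitions and zero coefficients, makes sums and multiples immediate;
    [expands_fset] cleans up at the end. *)
Definition expands (S : marked -> Prop) (f : conn0 -> QA) : Prop :=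
  exists L : seq (QA * marked), (forall x, x \in L -> S x.2) /\
    forall F, floor_or_K0 F -> f F = \sum_(x <- L) x.1 * Theta x.2 F.

Lemma expands_ext S f g : (forall F, floor_or_K0 F -> f F = g F) ->
  expands S f -> expands S g.
Proof. by move=> E [L [h1 h2]]; exists L; split=> // F hF; rewrite -E // h2. Qed.

Lemma expands_sub (S S' : marked -> Prop) f : (forall w, S w -> S' w) ->
  expands S f -> expands S' f.
Proof. by move=> H [L [h1 h2]]; exists L; split=> // x /h1 /H. Qed.

Lemma expands0 S : expands S (fun=> 0).
Proof. by exists [::]; split=> // F _; rewrite big_nil. Qed.

Lemma expandsD S f g : expands S f -> expands S g -> expands S (fun F => f F + g F).
Proof.
move=> [L [h1 h2]] [L' [h1' h2']]; exists (L ++ L'); split.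
  by move=> x; rewrite mem_cat => /orP [/h1|/h1'].
by move=> F hF; rewrite big_cat /= h2 // h2'.
Qed.

Lemma expandsZ S c f : expands S f -> expands S (fun F => c * f F).
Proof.
move=> [L [h1 h2]]; exists [seq (c * x.1, x.2) | x <- L]; split.
  by move=> x /mapP [y hy ->]; exact: (h1 y hy).
by move=> F hF; rewrite big_map h2 // mulr_sumr; apply: eq_bigr => x _; rewrite mulrA.
Qed.

Lemma expands_sum S (X : finType) (f : X -> conn0 -> QA) :
  (forall x, expands S (f x)) -> expands S (fun F => \sum_x f x F).
Proof.
move=> H; suff K (s : seq X) : expands S (fun F => \sum_(x <- s) f x F) by [].
elim: s => [|x s IH].
  by apply: expands_ext (expands0 S) => F _; rewrite big_nil.
by apply: expands_ext (expandsD (H x) IH) => F _; rewrite big_cons.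
Qed.

Lemma expands_gen (S : marked -> Prop) w : S w -> expands S (Theta w).
Proof.
move=> h; exists [:: (1, w)]; split; first by move=> x; rewrite inE => /eqP ->.
by move=> F _; rewrite big_seq1 mul1r.
Qed.

Lemma expandsN S f g : expands S f -> expands S g -> expands S (fun F => f F - g F).
Proof.
move=> hf hg; apply: expands_ext (expandsD hf (expandsZ (-1) hg)) => F _.
by rewrite mulN1r.
Qed.

(* The determinant of E is 1 at A = 0, hence nonzero. *)
Lemma solve_at0 S (X : finType) (f : X -> conn0 -> QA) (E : X -> X -> {poly rat}) :
  (forall x y, (E x y).[0] = (x == y)%:R) ->
  (forall x, expands S (fun F => \sum_y tofrac (E x y) * f y F)) ->
  forall x, expands S (f x).
Proof.
move=> E0 H.
pose A : 'M[{poly rat}]_#|X| := \matrix_(i, j) E (enum_val i) (enum_val j).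
pose M : 'M[QA]_#|X| := map_mx (@tofrac _) A.
have uM : M \in unitmx.
  rewrite unitmxE det_map_mx unitfE tofrac_eq0; apply/eqP => d0.
  have : \det (map_mx (horner_eval 0) A) = 0 by rewrite det_map_mx d0 /= raddf0.
  have -> : map_mx (horner_eval 0) A = 1%:M.
    by apply/matrixP => i j; rewrite !mxE /horner_eval E0 (inj_eq enum_val_inj).
  by rewrite det1 => /eqP; rewrite oner_eq0.
move=> x; have K F : f x F = \sum_i invmx M (enum_rank x) i *
    \sum_y tofrac (E (enum_val i) y) * f y F.
  have -> : f x F = (invmx M *m (M *m \col_j f (enum_val j) F)) (enum_rank x) ord0.
    by rewrite mulmxA mulVmx // mul1mx mxE enum_rankK.
  rewrite mxE; apply: eq_bigr => i _; congr (_ * _); rewrite mxE.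
  rewrite (reindex (enum_val : 'I_#|X| -> X)) /=; last exact/onW_bij/enum_val_bij.
  by apply: eq_bigr => j _; rewrite !mxE.
apply: expands_ext (_ : expands S (fun F => \sum_i invmx M (enum_rank x) i *
    \sum_y tofrac (E (enum_val i) y) * f y F)); first by move=> F _; rewrite -K.
by apply: expands_sum => i; apply: expandsZ.
Qed.

(** * The linear system for a fixed number of top points *)

Section Step.
Variables (n b : nat) (B : conn).
Hypotheses (n0 : (0 < n)%N) (bB : bottom_state B) (nB : nt B = n).
Notation S := (target n b (phi B)).

Hypothesis IH : forall R B1, (nt R < n)%N -> no_bot_return R -> nb R = b ->
  bottom_state B1 -> nt B1 = nt R ->
  expands (target (nt R) b (phi B1)) (Theta (R, phi B1)).

(** Twice the number of signs +: the exponent of A from one row after multiplication by A^n. *)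
Definition weight_exp (w : {ffun 'I_n -> bool}) : nat := (\sum_j (w j).*2)%N.

Lemma weight_expE (w : {ffun 'I_n -> bool}) :
  varA ^+ n * varA ^ (\sum_j sgn_of (w j)) = varA ^+ weight_exp w.
Proof.
have -> : varA ^+ n = varA ^ (n%:Z) by [].
rewrite -(expfzDr _ _ varA_neq0) [RHS]exprnP; congr (varA ^ _).
have -> : n%:Z = \sum_(j < n) 1 by rewrite sumr_const card_ord natz.
rewrite -big_split /= /weight_exp -natz natr_sum; apply: eq_bigr => j _.
by case: (w j).
Qed.

Lemma weight_exp0 (w : {ffun 'I_n -> bool}) : (weight_exp w == 0%N) = (w == minus_word n).
Proof.
rewrite /weight_exp sum_nat_eq0; apply/forallP/eqP => [H|-> j]; last by rewrite ffunE.
by apply/ffunP => j; rewrite ffunE; have := H j; case: (w j).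
Qed.

Variable h : nat.
Definition roof_type := {T : crossingless h n b | no_bot_return (Conn T)}.

(** Induction on the number d of rows above height h; each costs a factor A^n and one rotation. R is
    arbitrary of height h + d, since the induction passes from it to its plucked states. *)
Lemma rotation_expansion d R : no_bot_return R -> ht R = (h + d)%N -> nt R = n ->
  nb R = b -> exists e : roof_type -> {poly rat},
    (forall x, (e x).[0] = (R == iter d rotate (Conn (val x)))%:R) /\
    expands S (fun F => varA ^+ (d * n) * Theta (R, phi B) F
                        - \sum_x tofrac (e x) * Theta (Conn (val x), phi B) F).
Proof.
elim: d R => [|d IHd] R rR hR nR bR.
  rewrite addn0 in hR; have [T ET] := conn_cast hR nR bR; subst R.
  exists (fun x => (Conn T == Conn (val x))%:R); split.
    by move=> x; case: eqP => _; rewrite ?hornerC ?horner0 // hornerC.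
  apply: expands_ext (expands0 S) => F _; rewrite mul0n expr0 mul1r.
  rewrite (bigD1 (exist _ T rR : roof_type)) //= eqxx tofrac1 mul1r big1 ?addr0 ?subrr //.
  move=> x nx; case: eqP => [/Conn_inj E|_]; last by rewrite tofrac0 mul0r.
  by case/eqP: nx; apply: val_inj.
rewrite addnS in hR; have [T ET] := conn_cast hR nR bR; subst R.
have nRB : nt (Conn T) = nt B by rewrite nB.
have [dat hdat] := fin_all_exists (word_data_exists hR bB nRB).
pose term (w : {ffun 'I_n -> bool}) F : QA := if (dat w).1.1 is Some R2
  then varA ^ (\sum_j sgn_of (w j)) * Theta (R2, phi (dat w).2) F else 0.
have full_minus : cnt (ext (minus_word n)) n = n.
  by have [] := all_kept (n := n) (fun j _ => kept_minus n j).
have P (w : {ffun 'I_n -> bool}) : exists e : roof_type -> {poly rat},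
    (forall x, (e x).[0] = ((w == minus_word n) &&
                            (Conn T == iter d.+1 rotate (Conn (val x))))%:R) /\
    expands S (fun F => varA ^+ (d.+1 * n) * term w F
                        - \sum_x tofrac (e x) * Theta (Conn (val x), phi B) F).
  rewrite /term; have := hdat w; case: (dat w) => [[[R2|] K] B1] /= [bK sB1 H]; last first.
    (* The word contributes nothing. The value at 0 agrees, since a rotated state can be plucked by
       - ... -. *)
    exists (fun=> 0); split.
      move=> x; rewrite horner0; case: eqP => //= E; case: eqP => //= ET; case: H.
      rewrite E ET; have /= rp := iter_rotated (n0 : (0 < nt (Conn (val x)))%N) d.
      have [_ ni _] := iter_rotate_dims (n0 : (0 < nt (Conn (val x)))%N) d.
      have n0' : (0 < nt (iter d rotate (Conn (val x))))%N by rewrite ni.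
      by have := rotated_pairs n0' rp; rewrite ni.
    apply: expands_ext (expands0 S) => F _; rewrite mulr0 big1 ?subr0 // => x _.
    by rewrite tofrac0 mul0r.
  case: H => pt pR2; have [/= h2 n2 b2 _] := pR2; have [btK nK bK' kK _] := bK.
  have rR2 := pluck_roof pR2 rR.
  case: (ltnP (cnt (ext w) n) n) => [lt|ge].
    (* Some return faces down: [R2] has fewer top points, and the whole term expands by the
       induction hypothesis and [target_trans]. *)
    exists (fun=> 0); split.
      move=> x; rewrite horner0; case: eqP => //= E.
      by rewrite E full_minus ltnn in lt.
    apply: expands_ext (expandsZ (varA ^+ (d.+1 * n)) (expandsZ
      (varA ^ (\sum_j sgn_of (w j))) (f := Theta (R2, phi B1)) _)).
      by move=> F _; rewrite [X in _ - X]big1 ?subr0 // => x _; rewrite tofrac0 mul0r.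
    have eKB : nb K = nt B by rewrite bK'.
    have bB1 := stack_bottom btK bB eKB sB1.
    have nB1 : nt B1 = nt R2 by rewrite (stack_nt sB1) nK n2.
    apply: (@expands_sub (target (nt R2) b (phi B1))).
      move=> x; rewrite n2 -nK -nB; exact: target_trans sB1 eKB.
    by apply: IH => //; rewrite n2.
  have full : cnt (ext w) n = n.
    by apply/eqP; rewrite eqn_leq ge andbT /cnt -[leqRHS](size_iota 0 n) count_size.
  have [_ kapE] := all_kept (cnt_full full).
  (* No return faces down: K is the identity and the index set stays the same. *)
  have EB : B1 = B.
    have eKB : nb K = nt B by rewrite bK'.
    apply: (stack_spec_uniq (bottom_floor bB) eKB sB1).
    apply: ident_stack => //; last by rewrite nK full bK'.
    move=> i; rewrite bK' => hi; apply/cm_eq_sym; rewrite kK ?full // kapE //.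
    exact: ltnW.
  subst B1.
  have [|||e0 [e0P e0S]] := IHd R2 rR2.
  - by case: h2.
  - by rewrite n2 full.
  - by rewrite b2.
  (* At A = 0 the power leaves only the word - ... -. Then [R2] is the given state rotated back, so
     comparing that state with rotate^(d+1) x is comparing [R2] with rotate^d x. *)
  exists (fun x => 'X^(weight_exp w) * e0 x); split.
    move=> x; rewrite hornerM hornerXn e0P expr0n weight_exp0.
    case: eqP => [Ew|_]; last by rewrite mul0r.
    rewrite mul1r /=; congr (nat_of_bool _)%:R.
    have ni : nt (iter d rotate (Conn (val x))) = n.
      by have [] := iter_rotate_dims (n0 : (0 < nt (Conn (val x)))%N) d.
    have n0' : (0 < nt (iter d rotate (Conn (val x))))%N by rewrite ni.
    have rT : rotated (Conn T) R2.
      by apply: (minus_word_rotated n0); rewrite // -Ew.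
    apply/eqP/eqP => [E|E].
      rewrite -E in n0' *; exact: rotated_uniq rT (rotate_rotated n0').
    by apply: (rotated_uniq_inv rT); rewrite E; apply: rotate_rotated.
  apply: expands_ext (expandsZ (varA ^+ weight_exp w) e0S) => F _.
  rewrite mulrBr mulr_sumr -weight_expE; congr (_ - _).
    by rewrite mulSn exprD; ring.
  apply: eq_bigr => x _; rewrite tofracM tofracXn -/varA weight_expE; ring.
have [e eP] := fin_all_exists P.
exists (fun x => \sum_w e w x); split.
  move=> x; rewrite horner_sum (bigD1 (minus_word n)) //=.
  have [-> _] := eP (minus_word n); rewrite eqxx big1 ?addr0 // => w /negbTE nw.
  by have [-> _] := eP w; rewrite nw.
apply: expands_ext (expands_sum (fun w => (eP w).2)) => F fF.
rewrite (Theta_relation hR rR bB nRB hdat fF) sumrB mulr_sumr; congr (_ - _).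
rewrite exchange_big; apply: eq_bigr => x _.
by rewrite rmorph_sum mulr_suml.
Qed.

Lemma iter_rotate_inj d T T' : nt T = n -> nt T' = n ->
  iter d rotate T = iter d rotate T' -> T = T'.
Proof.
move=> e e'; elim: d => // d IHd' E; apply: IHd'.
have t0 : (0 < nt T)%N by rewrite e.
have t0' : (0 < nt T')%N by rewrite e'.
apply: (rotated_uniq_inv (iter_rotated t0 d)).
by rewrite E; apply: iter_rotated.
Qed.

(** With n rotations the state expanded by [rotation_expansion] is a middle state, so its Theta is a
    known function and each y yields one equation in the unknowns. *)
Lemma roof_expands (x : roof_type) : expands S (Theta (Conn (val x), phi B)).
Proof.
have tn0 (y : roof_type) : (0 < nt (Conn (val y)))%N by [].
have Q (y : roof_type) : exists e : roof_type -> {poly rat},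
    (forall z, (e z).[0] = (iter n rotate (Conn (val y)) == iter n rotate (Conn (val z)))%:R) /\
    expands S (fun F => \sum_z tofrac (e z) * Theta (Conn (val z), phi B) F).
  have [d1 d2 d3] := iter_rotate_dims (tn0 y) n.
  have [||||e [e1 e2]] := rotation_expansion (d := n) (R := iter n rotate (Conn (val y))) => //.
    by apply: iter_rotate_roof => //; exact: (valP y).
  exists e; split=> //.
  have hS : S (iter n rotate (Conn (val y)), phi B).
    have := target_refl (R := iter n rotate (Conn (val y))) bB.
    rewrite d2 d3; apply; first by rewrite nB.
    by apply: (iter_rotate_middle (tn0 y)); exact: (valP y).
  apply: expands_ext (expandsN (expandsZ (varA ^+ (n * n)) (expands_gen hS)) e2) => F _.
  by rewrite subKr.
have [E EP] := fin_all_exists Q.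
apply: (@solve_at0 S _ (fun x => Theta (Conn (val x), phi B)) E) => [y z|y]; last first.
  by case: (EP y).
have [-> _] := EP y; congr (nat_of_bool _)%:R; apply/eqP/eqP => [|-> //].
by move/iter_rotate_inj => /(_ erefl erefl) /Conn_inj /val_inj.
Qed.

End Step.

(** Induction on n_t(R); without top points R is a middle state already. *)
Lemma Theta_expands R B : no_bot_return R -> bottom_state B -> nt B = nt R ->
  expands (target (nt R) (nb R) (phi B)) (Theta (R, phi B)).
Proof.
move: {2}(nt R) (leqnn (nt R)) => k; elim: k R B => [|k IHk] R B.
  move=> hk rR bB e; apply: expands_gen; apply: target_refl => //; apply/andP; split=> //.
  by apply/no_top_returnP => i; move: hk; rewrite leqn0 => /eqP ->.
move=> hk rR bB e; case: (posnP (nt R)) => [z|n0].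
  by apply: (IHk R B) => //; rewrite z.
have [T ET] := conn_cast (erefl (ht R)) (erefl (nt R)) (erefl (nb R)).
have rT : no_bot_return (Conn T) by rewrite -ET.
have := @roof_expands (nt R) (nb R) B n0 bB e _ (ht R) (exist _ T rT); rewrite /= -ET; apply.
move=> R' B1 lt rR' bR' bB1 e'; rewrite -bR'; apply: IHk => //.
by rewrite -ltnS; apply: leq_trans lt hk.
Qed.

Lemma expands_fset S f : expands S f ->
  exists (P : {fset marked}) (Q : marked -> QA),
    (forall w, w \in P -> S w /\ Q w != 0) /\
    (forall F, floor_or_K0 F -> f F = \sum_(w <- P) Q w * Theta w F).
Proof.
move=> [L [h1 h2]]; pose Q w : QA := \sum_(x <- L | x.2 == w) x.1.
pose U := undup [seq x.2 | x <- L].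
exists [fset w in U | Q w != 0]%fset, Q; split.
  move=> w; rewrite !inE => /andP [/= hw ->]; split=> //.
  by move: hw; rewrite mem_undup => /mapP [x hx ->]; apply: h1.
move=> F fF; rewrite h2 //.
have -> : \sum_(w <- [fset w in U | Q w != 0]%fset) Q w * Theta w F =
    \sum_(w <- U) Q w * Theta w F.
  rewrite [RHS](bigID (fun w => Q w != 0)) /= [X in _ + X]big1 ?addr0; last first.
    by move=> w /negPn /eqP ->; rewrite mul0r.
  rewrite -[RHS]big_filter; apply: perm_big; apply: uniq_perm.
  - exact: fset_uniq.
  - by rewrite filter_uniq // undup_uniq.
  - by move=> w; rewrite !inE mem_filter andbC.
under [RHS]eq_bigr => w _ do rewrite /Q mulr_suml big_mkcond.
rewrite exchange_big /=; apply: eq_big_seq => x hx.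
rewrite -big_mkcond /= (eq_bigl (fun w => w == x.2)); last by move=> w; rewrite eq_sym.
rewrite -big_filter filter_pred1_uniq ?undup_uniq ?big_seq1 //.
by rewrite mem_undup map_f.
Qed.

Theorem theorem4p7 (R : conn) (I : {fset nat}) (hRI : in_W (R, I)) :
  exists (P : {fset conn * {fset nat}}) (Q : conn * {fset nat} -> QA),
    (forall w, w \in P ->
       [/\ in_W w, middle_state w.1, trileq (R, I) w & Q w != 0]) /\
    (forall F : option conn, floor_or_K0 F ->
       Theta (R, I) F = \sum_(w <- P) Q w * Theta w F).
Proof.
have /andP [rR _] := hRI; rewrite /= in rR.
(* The product is a Catalan state only if F has n_t(R) + 2|I| bottom points, so I is examined for
   this n alone. *)
case e: (phi_inv (nt R + 2 * #|` I|) I) => [B|].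
  have [bB eB pB] := (phi_invP _ _ _).1 e.
  have nB : nt B = nt R by apply/eqP; have := phi_card bB; rewrite eB pB => /addIn ->.
  have [P [Q [h1 h2]]] := expands_fset (Theta_expands rR bB nB).
  exists P, Q; split; last by move=> F fF; rewrite -h2 // pB.
  by move=> w /h1 [/target_trileq]; rewrite pB => -[].
(* I is not in L_n for the one n that could give a Catalan state, so the function is zero and the
   empty expansion will do. *)
exists fset0, (fun=> 0); split; first by move=> w; rewrite inE.
move=> F _; rewrite big1_seq; last by move=> w /=; rewrite inE.
case: F => [F|] //; rewrite /Theta /=; case eG: (strip1 F I) => [G|] //=.
case ev: (vprod1 R G) => [C|] //.
have [B [bB nBF pB nG]] := strip1_dims eG; have [_ nC bC] := vprod1_dims ev.
apply: bracket_nocat; apply/eqP => E.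
have : phi_inv (nt R + 2 * #|` I|) I = Some B; last by rewrite e.
by apply/phi_invP; split; rewrite // (phi_card bB) pB -nG -bC -E nC.
Qed.
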